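(* Let $n>1$. Let $M^{2n+1}$ be a closed manifold with a contact form $\alpha$, let $N^{2n-1}\subset M^{2n+1}$ be a codimension two contact submanifold with a product tubular neighbourhood $N\times D^2$, and let $\theta:M\setminus N\to S^1=\mathbb{R}/2\pi\mathbb{Z}$ be an open-book structure with binding $N$ which supports $\ker\alpha$, where $\alpha$ is adapted to $\theta$ and is in the axisymmetric normal form $$\alpha|_{N\times D^2}=f_0(\rho)\beta+g_0(\rho)\,d\theta$$ described in the context, with $\beta=\alpha|_N$. Suppose that $N^{2n-1}$ admits a non-zero (i.e. nowhere vanishing) closed $1$-form $\nu$ with $\nu\wedge(d\beta)^{n-1}=0$. Then there exists a family of contact forms $\{\alpha_t\}_{0\le t<1}$ on $M^{2n+1}$ which starts with $\alpha_0=\alpha$ and converges as $t\to1$ to a non-zero (i.e. nowhere vanishing) $1$-form $\alpha_1$ with $\alpha_1\wedge d\alpha_1=0$. That is, the contact structure $\ker\alpha$ converges to the codimension one foliation defined by $\alpha_1$ at the end of an isotopic deformation.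
   Context: Open-book structures. Let $\alpha$ be a contact form on a closed manifold $M^{2n+1}$ and $N^{2n-1}$ a codimension two contact submanifold. Suppose a tubular neighbourhood of $N$ is the product $N\times D^2$ and the pull-back of the angular coordinate of $D^2$ extends to a fibre bundle projection $\theta:M\setminus N\to S^1$. The open-book structure defined by $\theta$ (with binding $N$) supports the contact structure $\ker\alpha$ if there is a function $h:M\to\mathbb{R}$ with $d\theta\wedge(d(e^h\alpha))^n>0$ on $M\setminus N$. The contact form $e^h\alpha$ is then called adapted. If a supporting open-book structure is specified, the contact form $\alpha$ itself is assumed to be adapted, i.e. $d\theta\wedge(d\alpha)^n>0$ on $M\setminus N$. Axisymmetric normal form. Let $\rho$ denote the square of the radial coordinate of the unit disk $D^2$ (so $N\times D^2=\{0\le\rho\le1\}$). After modifying $\rho$ and $\theta$ if necessary, $\alpha=f_0(\rho)\beta+g_0(\rho)d\theta$ on $N\times D^2$, where $\beta$ is (the pull-back of) $\alpha|_N$, $f_0$ is a positive decreasing function with $f_0(0)=1$, and $g_0$ is a non-negative non-decreasing function which is smoothly tangent to $\rho$ at $\rho=0$ and to the constant $1$ at $\rho=1$. *)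

(* Defs.v *)
From HB Require Import structures.
From mathcomp Require Import all_boot all_order all_algebra all_fingroup.
From mathcomp Require Import all_classical all_reals all_analysis.

Set Implicit Arguments.
Unset Strict Implicit.
Unset Printing Implicit Defensive.

Import Order.TTheory GRing.Theory Num.Theory.
Import numFieldNormedType.Exports.

Local Open Scope classical_set_scope.
Local Open Scope ring_scope.

(** * Smooth functions and differential forms on open sets of R^m *)

Fixpoint iter_partial (R : realType) (m : nat) (W : normedModType R)
    (s : seq 'I_m) (f : 'rV[R]_m -> W) : 'rV[R]_m -> W :=
  if s is i :: s' then fun x => 'D_(delta_mx 0 i) (iter_partial s' f) x else f.

(* For open [U] this says that [f] is C^oo on [U]. It is only used for open
   [U]; the values of [f] outside [U] are irrelevant. *)
Definition smooth_on (R : realType) (m : nat) (W : normedModType R)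
    (U : set 'rV[R]_m) (f : 'rV[R]_m -> W) : Prop :=
  forall x, U x -> forall s : seq 'I_m, differentiable (iter_partial s f) x.

Definition smooth_fun (R : realType) (f : R -> R) : Prop :=
  forall (k : nat) (x : R), derivable (derive1n k f) x 1.

(* A field of k-covectors: a point and k vectors (the rows of a matrix) are
   mapped to a scalar. *)
Definition form (R : realType) (m k : nat) : Type :=
  'rV[R]_m -> 'M[R]_(k, m) -> R.

(* d w (v_0, .., v_k) = \sum_i (-1)^i D_{v_i} (w (v_0, .., ^v_i, .., v_k)) *)
Definition dform (R : realType) (m k : nat) (w : form R m k) :
    form R m k.+1 :=
  fun x A => \sum_(i < k.+1)
    (-1) ^+ i * 'D_(row i A) (fun y => w y (row' i A)) x.

(* Determinant convention: (dx_1 /\ dx_2) (v, w) = v_1 w_2 - v_2 w_1. *)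
Definition wedge (R : realType) (m k l : nat) (w : form R m k)
    (e : form R m l) : form R m (k + l) :=
  fun x A => (k`! * l`!)%:R^-1 *
    \sum_(s : 'S_(k + l)) (-1) ^+ s *
       w x (usubmx (row_perm s A)) * e x (dsubmx (row_perm s A)).

Fixpoint wedge_pow (R : realType) (m k : nat) (w : form R m k) (j : nat) :
    form R m (j * k) :=
  match j return form R m (j * k) with
  | 0 => fun _ _ => 1
  | j'.+1 => wedge w (@wedge_pow R m k w j')
  end.
Arguments wedge_pow {R m k} w j.

Definition pull (R : realType) (m l k : nat) (f : 'rV[R]_m -> 'rV[R]_l)
    (w : form R l k) : form R m k :=
  fun x A => w (f x) (A *m jacobian f x).

(** * Smooth manifolds *)

Record charted_space (R : realType) (m : nat) := ChartedSpace {
  cs_carrier :> topologicalType;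
  cs_index : Type;
  cs_dom : cs_index -> set cs_carrier;
  cs_chart : cs_index -> cs_carrier -> 'rV[R]_m;
  cs_inv : cs_index -> 'rV[R]_m -> cs_carrier }.

Definition cs_image (R : realType) (m : nat) (M : charted_space R m)
    (i : cs_index M) : set 'rV[R]_m := cs_chart i @` cs_dom i.

Record is_manifold (R : realType) (m : nat) (M : charted_space R m) : Prop := {
  mfd_hausdorff : hausdorff_space M;
  mfd_second_countable : @second_countable M;
  mfd_cover : forall p : M, exists i : cs_index M, cs_dom i p;
  mfd_open_dom : forall i : cs_index M, open (cs_dom i);
  mfd_open_image : forall i : cs_index M, open (cs_image i);
  mfd_chartK : forall (i : cs_index M) (p : M),
    cs_dom i p -> cs_inv i (cs_chart i p) = p;
  mfd_chart_continuous : forall (i : cs_index M) (p : M),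
    cs_dom i p -> {for p, continuous (cs_chart i)};
  mfd_inv_continuous : forall (i : cs_index M) (x : 'rV[R]_m),
    cs_image i x -> {for x, continuous (cs_inv i)};
  mfd_transition : forall i j : cs_index M,
    smooth_on (cs_chart i @` (cs_dom i `&` cs_dom j)) (cs_chart j \o cs_inv i)
}.

(* Smooth manifolds without boundary, of dimension m; not assumed to be
   connected or non-empty. *)
Record manifold (R : realType) (m : nat) := Manifold {
  mfd_space :> charted_space R m;
  mfd_axioms : is_manifold mfd_space }.

Definition closed_manifold (R : realType) (m : nat) (M : manifold R m) : Prop :=
  compact [set: M].

Definition euclid (R : realType) (m : nat) : charted_space R m :=
  @ChartedSpace R m 'rV[R]_m unit (fun _ => setT) (fun _ x => x) (fun _ x => x).

(* Product charts, with values in R^(m + k). *)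
Definition prod_space (R : realType) (m k : nat) (M : charted_space R m)
    (P : charted_space R k) : charted_space R (m + k) :=
  @ChartedSpace R (m + k) (M * P)%type (cs_index M * cs_index P)%type
    (fun i => cs_dom i.1 `*` cs_dom i.2)
    (fun i p => row_mx (cs_chart i.1 p.1) (cs_chart i.2 p.2))
    (fun i x => (cs_inv i.1 (lsubmx x), cs_inv i.2 (rsubmx x))).

(* [smooth_map A f]: A is open and the restriction of f to A is smooth. *)
Definition smooth_map (R : realType) (m k : nat) (M : charted_space R m)
    (P : charted_space R k) (A : set M) (f : M -> P) : Prop :=
  [/\ open A,
      forall p, A p -> {for p, continuous f} &
      forall (i : cs_index M) (j : cs_index P),
        smooth_on (cs_chart i @` (A `&` cs_dom i `&` f @^-1` cs_dom j))
                  (cs_chart j \o f \o cs_inv i)].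

Definition diffeo_on (R : realType) (m k : nat) (M : charted_space R m)
    (P : charted_space R k) (A : set M) (B : set P) (f : M -> P) : Prop :=
  smooth_map A f /\
  exists g : P -> M,
    [/\ smooth_map B g,
        forall p, A p -> B (f p) /\ g (f p) = p &
        forall q, B q -> A (g q) /\ f (g q) = q].

(** * Differential forms on manifolds *)

(* A form is given by its expressions in all the charts; only the values of
   [w i] on the image of the chart [i] are relevant. *)
Definition mform (R : realType) (m : nat) (M : charted_space R m) (k : nat) :
    Type := cs_index M -> form R m k.

Definition md (R : realType) (m : nat) (M : charted_space R m) (k : nat)
    (w : mform M k) : mform M k.+1 := fun i => dform (w i).

Definition mwedge (R : realType) (m : nat) (M : charted_space R m) (k l : nat)
    (w : mform M k) (e : mform M l) : mform M (k + l) :=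
  fun i => wedge (w i) (e i).

Definition mwedge_pow (R : realType) (m : nat) (M : charted_space R m)
    (k : nat) (w : mform M k) (j : nat) : mform M (j * k) :=
  fun i => wedge_pow (w i) j.
Arguments mwedge_pow {R m M k} w j.

(* [is_pullback A f w e]: e = f^* w at the points of A. *)
Definition is_pullback (R : realType) (m l k : nat) (M : charted_space R m)
    (P : charted_space R l) (A : set M) (f : M -> P)
    (w : mform P k) (e : mform M k) : Prop :=
  forall (i : cs_index M) (j : cs_index P) (p : M),
    A p -> cs_dom i p -> cs_dom j (f p) ->
    forall V : 'M[R]_(k, m),
      e i (cs_chart i p) V =
      pull (cs_chart j \o f \o cs_inv i) (w j) (cs_chart i p) V.

(* The first condition is the compatibility of the local expressions under
   changes of charts. *)
Definition smooth_1form (R : realType) (m : nat) (M : charted_space R m)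
    (w : mform M 1) : Prop :=
  [/\ is_pullback [set: M] id w w,
      forall (i : cs_index M) (x : 'rV[R]_m), cs_image i x -> scalar (w i x) &
      forall (i : cs_index M) (v : 'rV[R]_m),
        smooth_on (cs_image i) (fun x => w i x v : R^o)].

Definition mform_eq (R : realType) (m : nat) (M : charted_space R m) (k : nat)
    (w e : mform M k) : Prop :=
  forall (i : cs_index M) (x : 'rV[R]_m), cs_image i x ->
    forall V : 'M[R]_(k, m), w i x V = e i x V.

Definition mform_zero (R : realType) (m : nat) (M : charted_space R m)
    (k : nat) (w : mform M k) : Prop :=
  mform_eq w (fun _ _ _ => 0).

Definition nowhere_zero (R : realType) (m : nat) (M : charted_space R m)
    (k : nat) (w : mform M k) : Prop :=
  forall (i : cs_index M) (x : 'rV[R]_m), cs_image i x ->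
    exists V : 'M[R]_(k, m), w i x V <> 0.

(* To be used with m = 2n + 1. *)
Definition contact_form (R : realType) (m : nat) (M : charted_space R m)
    (n : nat) (a : mform M 1) : Prop :=
  smooth_1form a /\ nowhere_zero (mwedge a (mwedge_pow (md a) n)).

(** * Open books *)

(* The circle R / 2 pi Z is identified with the unit circle of R^2. *)
Definition circle_pt (R : realType) (s : R) : 'rV[R]_2 :=
  \row_(j < 2) (if j == 0 then cos s else sin s).

Definition sqr_radius (R : realType) (z : 'rV[R]_2) : R :=
  z 0 0 ^+ 2 + z 0 1 ^+ 2.

(* The closed 1-form (x dy - y dx) / (x^2 + y^2); it is 0 at the origin since
   division by 0 yields 0. *)
Definition angle_form (R : realType) : form R 2 1 :=
  fun z w => (z 0 0 * w 0 1 - z 0 1 * w 0 0) / sqr_radius z.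

Definition dtheta (R : realType) (m : nat) (M : charted_space R m)
    (theta : M -> 'rV[R]_2) : mform M 1 :=
  fun i => pull (theta \o cs_inv i) (@angle_form R).

(* [iota : N -> M] is the inclusion and [phi] restricts to the tubular
   neighbourhood N x D^2, D^2 the closed unit disk. A smooth embedding of the
   manifold with boundary N x D^2 is the restriction of a diffeomorphism from
   N x {|z|^2 < r}, r > 1, onto an open set. In particular iota is a smooth
   embedding. *)
Definition tubular_nbhd (R : realType) (m k : nat) (M : manifold R m)
    (N : manifold R k) (iota : N -> M) (phi : N * 'rV[R]_2 -> M) : Prop :=
  (forall x, phi (x, 0) = iota x) /\
  exists2 r : R, 1 < r &
    let A := [set q : N * 'rV[R]_2 | sqr_radius q.2 < r] in
    @diffeo_on R (k + 2) m (prod_space N (euclid R 2)) M A (phi @` A) phi.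

(* theta : M \ N -> S^1 is a smooth fibre bundle: over an arc around every
   point of the circle it is smoothly isomorphic to arc x F. *)
Definition circle_bundle (R : realType) (m : nat) (M : manifold R m.+1)
    (E : set M) (theta : M -> 'rV[R]_2) : Prop :=
  [/\ @smooth_map R m.+1 2 M (euclid R 2) E theta,
      forall p, E p -> sqr_radius (theta p) = 1 &
      exists F : manifold R m, forall a : R,
        exists2 delta : R, 0 < delta <= pi &
        exists Psi : 'rV[R]_1 * F -> M,
          @diffeo_on R (1 + m) m.+1 (prod_space (euclid R 1) F) M
            [set q : 'rV[R]_1 * F | `|q.1 0 0 - a| < delta]
            [set p | E p /\
               exists2 s : R, `|s - a| < delta & theta p = circle_pt s]
            Psi /\
          forall q : 'rV[R]_1 * F, `|q.1 0 0 - a| < delta ->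
            theta (Psi q) = circle_pt (q.1 0 0)].

(* The values of theta on the binding are irrelevant. *)
Definition open_book (R : realType) (m k : nat) (M : manifold R m.+1)
    (N : manifold R k) (iota : N -> M) (phi : N * 'rV[R]_2 -> M)
    (theta : M -> 'rV[R]_2) : Prop :=
  [/\ tubular_nbhd iota phi,
      circle_bundle (~` range iota) theta &
      forall (x : N) (z : 'rV[R]_2), 0 < sqr_radius z <= 1 ->
        theta (phi (x, z)) = (Num.sqrt (sqr_radius z))^-1 *: z].

(* d theta /\ (d a)^n > 0 on E, for the orientation of M given by the volume
   form a /\ (d a)^n. *)
Definition adapted (R : realType) (m : nat) (M : charted_space R m) (n : nat)
    (E : set M) (theta : M -> 'rV[R]_2) (a : mform M 1) : Prop :=
  forall (i : cs_index M) (p : M), E p -> cs_dom i p ->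
    forall V : 'M[R]_(1 + n * 2, m),
      0 < mwedge a (mwedge_pow (md a) n) i (cs_chart i p) V ->
      0 < mwedge (dtheta theta) (mwedge_pow (md a) n) i (cs_chart i p) V.

(* f(rho) b + g(rho) d theta on N x R^2, rho being the squared radius. *)
Definition axisym_form (R : realType) (k : nat) (N : charted_space R k)
    (f g : R -> R) (b : mform N 1) : mform (prod_space N (euclid R 2)) 1 :=
  fun i x v =>
    let rho := sqr_radius (rsubmx x) in
    f rho * b i.1 (lsubmx x) (lsubmx v)
    + g rho * angle_form (rsubmx x) (rsubmx v).

(* A smooth function on [0, 1] is the restriction of a smooth function on R. *)
Definition axisymmetric (R : realType) (m k : nat) (M : manifold R m)
    (N : manifold R k) (phi : N * 'rV[R]_2 -> M) (f0 g0 : R -> R)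
    (a : mform M 1) (b : mform N 1) : Prop :=
  [/\ [/\ smooth_fun f0, f0 0 = 1,
          forall r, 0 <= r <= 1 -> 0 < f0 r &
          forall r s, 0 <= r -> r < s -> s <= 1 -> f0 s < f0 r],
      [/\ smooth_fun g0,
          forall r, 0 <= r <= 1 -> 0 <= g0 r &
          forall r s, 0 <= r -> r <= s -> s <= 1 -> g0 r <= g0 s],
      (* tangency to infinite order *)
      forall j : nat, derive1n j g0 0 = derive1n j (fun r : R => r : R^o) 0 /\
                      derive1n j g0 1 = derive1n j (fun _ : R => 1 : R^o) 1 &
      @is_pullback R (k + 2) m 1 (prod_space N (euclid R 2)) M
        [set q : N * 'rV[R]_2 | sqr_radius q.2 <= 1] phi a (axisym_form f0 g0 b)].

(** * Families of 1-forms *)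

(* Smooth dependence on (t, x) for 0 <= t < 1. Smoothness at the end point
   t = 0 means that there is a smooth extension to t < 0; the forms [w t] for
   t < 0 are such an extension and have no other role. *)
Definition smooth_family (R : realType) (m : nat) (M : charted_space R m)
    (w : R -> mform M 1) : Prop :=
  forall (i : cs_index M) (v : 'rV[R]_m),
    smooth_on [set y : 'rV[R]_(1 + m) |
                 lsubmx y 0 0 < 1 /\ cs_image i (rsubmx y)]
      (fun y => w (lsubmx y 0 0) i (rsubmx y) v : R^o).

(* Convergence in the C^oo topology as t -> 1, t < 1: uniform convergence of
   all partial derivatives on the compact subsets of the charts. *)
Definition cvg_smooth (R : realType) (m : nat) (M : charted_space R m)
    (w : R -> mform M 1) (w1 : mform M 1) : Prop :=
  forall (i : cs_index M) (K : set 'rV[R]_m) (v : 'rV[R]_m) (s : seq 'I_m),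
    compact K -> K `<=` cs_image i ->
    forall e : R, 0 < e ->
      \forall t \near 1^'-, forall x, K x ->
        `| iter_partial s (fun y => w t i y v : R^o) x
           - iter_partial s (fun y => w1 i y v : R^o) x | < e.

(* Main.v *)
Require Import Defs.
From HB Require Import structures.
From mathcomp Require Import all_boot all_order all_algebra all_fingroup.
From mathcomp Require Import all_classical all_reals all_analysis.
From mathcomp Require Import ring lra zify.

(** The deformation is a segment: [alpha_t = (1 - t) alpha + t alpha1]. Off a
    neighbourhood of the binding alpha1 is d theta, and on N x D^2 it is
    [a(rho) nu + b(rho) d theta + e(rho) d rho], where [a > 0] exactly for
    [rho < 1/2], [b > 0] exactly for [rho > 1/2] and [b = 1] from [rho = 3/4] on,
    and [e > 0] exactly for [rho < 3/4]. As nu and d theta are closed and [a b = 0],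
    the form alpha1 satisfies [alpha1 /\ d alpha1 = 0], and it vanishes nowhere
    because [e > 0] where [a] and [b] vanish. Convergence is plain for a segment.

    It remains to see that alpha_t is contact for [t < 1]. Off the tube,
    [d alpha_t = (1 - t) d alpha], and
    [alpha_t /\ (d alpha_t)^n] is a positive multiple of
    [(1 - t) alpha /\ (d alpha)^n + t d theta /\ (d alpha)^n], which is positive
    because alpha is adapted to the open book ([contact_outer]).

    On the tube no power has to be expanded. The Reeb vector R of beta lies in the
    kernel of nu, since [nu /\ (d beta)^(n-1) = 0] ([reeb_vector]). Hence a map
    [v |-> v + x(v) R + y(v) d/dtheta] of the tangent space can be chosen so as to
    pull alpha_t and d alpha_t back to [(1 - t) alpha] and [(1 - t) d alpha]
    ([model_contact]), and the contact condition for alpha_t follows from that for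
    alpha. The coefficients x and y solve a linear system whose determinant is
    [F G' - F' G], with [F = (1 - t) f0] and [G = (1 - t) g0 + t b]. It is positive:
    by monotonicity all its terms are non-negative, and [f0 g0' - f0' g0] is not 0,
    as otherwise [f0 d/dtheta - g0 R] would lie in the kernels of alpha and
    d alpha, which is incompatible with [alpha /\ (d alpha)^n <> 0]
    ([model_wronskian_neq0], [wedge_top_kernel0]). On the binding d rho vanishes,
    and a multiple of R alone suffices ([binding_contact]).

    All this takes place in charts. The closedness of nu and d theta passes to the
    charts of M because exterior differentiation commutes with pull-backs
    ([ext_d_pull]), which rests on the symmetry of second derivatives
    ([derive_comm]); smoothness is obtained from a coinduction principle
    ([smooth_on_coind]) and the profiles from [exp(-1/x)] ([flat_smooth]). *)

Set Implicit Arguments.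
Unset Strict Implicit.
Unset Printing Implicit Defensive.

Import Order.TTheory GRing.Theory Num.Theory.
Import numFieldNormedType.Exports.

Local Open Scope classical_set_scope.
Local Open Scope ring_scope.

Local Notation form := Defs.form.

(** * Alternating multilinear functions and wedge products *)

Section Alternation.
Variables (R : realType) (m : nat).

Definition alternate (k : nat) (G : 'M[R]_(k, m) -> R) (V : 'M[R]_(k, m)) : R :=
  \sum_(s : 'S_k) (-1) ^+ s * G (row_perm s V).

(** Reindexing the sum by the odd permutation [t] changes the sign of each term. *)
Lemma alternate_sym0 (k : nat) (t : 'S_k) (G : 'M[R]_(k, m) -> R) V :
  odd_perm t -> (forall W, G (row_perm t W) = G W) -> alternate G V = 0.
Proof.
move=> ot Gt; suff: alternate G V = - alternate G V.
  by move/eqP; rewrite -addr_eq0 -mulr2n mulrn_eq0 /= => /eqP.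
rewrite {1}/alternate (reindex_inj (mulgI t)) /= -sumrN; apply: eq_bigr => s _.
by rewrite odd_permM ot row_permM Gt signr_addb mulN1r mulNr.
Qed.

Lemma alternate_eq_rows0 (k : nat) (G : 'M[R]_(k, m) -> R) V (i j : 'I_k) :
  i != j -> row i V = row j V -> alternate G V = 0.
Proof.
move=> ij eqV; have tV : row_perm (tperm i j) V = V.
  apply/row_matrixP => l; rewrite row_permEsub; apply/rowP => c; rewrite !mxE.
  have := congr1 (fun r : 'rV_m => r 0 c) eqV; rewrite !mxE.
  by case: tpermP => [->|->|].
suff: alternate G V = - alternate G V.
  by move/eqP; rewrite -addr_eq0 -mulr2n mulrn_eq0 /= => /eqP.
rewrite {1}/alternate (reindex_inj (mulIg (tperm i j))) /= -sumrN.
apply: eq_bigr => s _.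
by rewrite odd_permM odd_tperm ij row_permM tV signr_addb mulrN1 mulNr.
Qed.

Definition multilinear (k : nat) (f : 'M[R]_(k, m) -> R) : Prop :=
  forall i a b A B C,
    row i A = a *: row i B + b *: row i C ->
    (forall j, j != i -> row j B = row j A) ->
    (forall j, j != i -> row j C = row j A) ->
    f A = a * f B + b * f C.

Lemma alternate_multilinear (k : nat) (G : 'M[R]_(k, m) -> R) :
  multilinear G -> multilinear (alternate G).
Proof.
move=> Gl i a b A B C rA rB rC; rewrite /alternate !mulr_sumr -big_split /=.
apply: eq_bigr => s _.
have row_s j D : row j (row_perm s D) = row (s j) D.
  by apply/rowP => c; rewrite !mxE.
rewrite (Gl ((s^-1)%g i) a b _ (row_perm s B) (row_perm s C)).
- by rewrite mulrDr !(mulrCA ((-1) ^+ _)).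
- by rewrite !row_s permKV.
- by move=> j ji; rewrite !row_s rB // -(inj_eq (@perm_inj _ s^-1)%g) permK.
- by move=> j ji; rewrite !row_s rC // -(inj_eq (@perm_inj _ s^-1)%g) permK.
Qed.

Lemma tensor_multilinear (k l : nat) (f : 'M[R]_(k, m) -> R)
    (g : 'M[R]_(l, m) -> R) :
  multilinear f -> multilinear g ->
  multilinear (fun V : 'M[R]_(k + l, m) => f (usubmx V) * g (dsubmx V)).
Proof.
move=> fl gl i a b A B C.
have row_u j (D : 'M[R]_(k + l, m)) : row j (usubmx D) = row (lshift l j) D.
  by apply/rowP => c; rewrite !mxE.
have row_d j (D : 'M[R]_(k + l, m)) : row j (dsubmx D) = row (rshift k j) D.
  by apply/rowP => c; rewrite !mxE.
rewrite -(splitK i); case: (fintype.split i) => {}i /= rA rB rC.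
- have eB : dsubmx B = dsubmx A.
    by apply/row_matrixP => j; rewrite !row_d rB // eq_rlshift.
  have eC : dsubmx C = dsubmx A.
    by apply/row_matrixP => j; rewrite !row_d rC // eq_rlshift.
  rewrite (fl i a b _ (usubmx B) (usubmx C)) ?eB ?eC ?row_u //.
  + ring.
  + by move=> j ji; rewrite !row_u rB // eq_lshift.
  + by move=> j ji; rewrite !row_u rC // eq_lshift.
- have eB : usubmx B = usubmx A.
    by apply/row_matrixP => j; rewrite !row_u rB // eq_lrshift.
  have eC : usubmx C = usubmx A.
    by apply/row_matrixP => j; rewrite !row_u rC // eq_lrshift.
  rewrite (gl i a b _ (dsubmx B) (dsubmx C)) ?eB ?eC ?row_d //.
  + ring.
  + by move=> j ji; rewrite !row_d rB // eq_rshift.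
  + by move=> j ji; rewrite !row_d rC // eq_rshift.
Qed.

Definition replace_row (k : nat) (i : 'I_k) (u : 'rV[R]_m) (V : 'M[R]_(k, m)) :=
  \matrix_(j < k, c < m) (if j == i then u 0 c else V j c).

Lemma row_replace_row (k : nat) (i j : 'I_k) u (V : 'M[R]_(k, m)) :
  row j (replace_row i u V) = if j == i then u else row j V.
Proof. by apply/rowP => c; rewrite !mxE; case: ifP; rewrite ?mxE. Qed.

Lemma replace_row_id (k : nat) (i : 'I_k) (V : 'M[R]_(k, m)) :
  replace_row i (row i V) V = V.
Proof.
by apply/row_matrixP => j; rewrite row_replace_row; case: eqP => // ->.
Qed.

Lemma multilinear_replace (k : nat) (f : 'M[R]_(k, m) -> R) i V a b u v :
  multilinear f ->
  f (replace_row i (a *: u + b *: v) V) =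
    a * f (replace_row i u V) + b * f (replace_row i v V).
Proof.
move=> fl; apply: (fl i); rewrite ?row_replace_row ?eqxx //.
- by move=> j ji; rewrite !row_replace_row (negPf ji).
- by move=> j ji; rewrite !row_replace_row (negPf ji).
Qed.

Lemma multilinear_replace_sum (k l : nat) (f : 'M[R]_(k, m) -> R) i V
    (a : 'I_l -> R) (u : 'I_l -> 'rV[R]_m) :
  multilinear f ->
  f (replace_row i (\sum_j a j *: u j) V) =
    \sum_j a j * f (replace_row i (u j) V).
Proof.
move=> fl; elim: l a u => [|l ih] a u.
  rewrite !big_ord0 -[0 in LHS](scale0r 0) -[X in replace_row i X](addr0 _).
  by rewrite -[X in _ + X](scale0r 0) multilinear_replace // !mul0r addr0.
rewrite !big_ord_recl /= -ih -[X in _ = _ + X]mul1r -multilinear_replace //.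
by rewrite scale1r.
Qed.

(** A multilinear alternating function vanishes on linearly dependent rows:
    in a relation [c *m V = 0] with [c i != 0], substituting the left-hand
    side for the row [i] leaves the multiple [c i] of the value at [V]. *)
Lemma alternating_dependent0 (k : nat) (f : 'M[R]_(k, m) -> R) V :
  multilinear f ->
  (forall W (i j : 'I_k), i != j -> row i W = row j W -> f W = 0) ->
  ~~ row_free V -> f V = 0.
Proof.
move=> fl fa; rewrite -kermx_eq0 => /rowV0Pn[c /sub_kermxP cV c0].
have [i ci] : exists i, c 0 i != 0.
  apply/existsP; apply: contraR c0 => /existsPn c0; apply/eqP/rowP => i.
  by rewrite mxE; apply/eqP; rewrite -[_ == _]negbK.
apply/eqP; rewrite -(mulrI_eq0 _ (lregP ci)); apply/eqP.
have := multilinear_replace_sum i V (fun j => c 0 j) (fun j => row j V) fl.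
rewrite -mulmx_sum_row cV (bigD1 i) //= replace_row_id big1 ?addr0.
  move=> <-; rewrite -[0 in LHS](scale0r 0) -[X in replace_row i X](addr0 _).
  by rewrite -[X in _ + X](scale0r 0) multilinear_replace // !mul0r addr0.
move=> j ji; rewrite (fa _ i j) ?mulr0 // 1?eq_sym //.
by rewrite !row_replace_row eqxx (negPf ji).
Qed.

End Alternation.

Section Wedge.
Variables (R : realType).

Lemma wedgeE (m k l : nat) (w : form R m k) (e : form R m l) x V :
  wedge w e x V = (k`! * l`!)%:R^-1 *
    alternate (fun W => w x (usubmx W) * e x (dsubmx W)) V.
Proof.
rewrite /wedge /alternate; congr (_ * _); apply: eq_bigr => s _.
by rewrite mulrA.
Qed.

Lemma scale_multilinear (m k : nat) (c : R) (f : 'M[R]_(k, m) -> R) :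
  multilinear f -> multilinear (fun V => c * f V).
Proof. by move=> fl i a b A B C /fl h /h {}h /h ->; ring. Qed.

Lemma wedge_multilinear (m k l : nat) (w : form R m k) (e : form R m l) x :
  multilinear (w x) -> multilinear (e x) -> multilinear (wedge w e x).
Proof.
move=> wl el; have -> : wedge w e x = fun V => wedge w e x V by [].
under eq_fun do rewrite wedgeE.
by apply/scale_multilinear/alternate_multilinear/tensor_multilinear.
Qed.

Lemma wedge_pow_multilinear (m k : nat) (w : form R m k) x j :
  multilinear (w x) -> multilinear (wedge_pow w j x).
Proof.
move=> wl; elim: j => [|j ih]; last exact: wedge_multilinear.
by move=> [].
Qed.

Lemma wedge_eq_rows0 (m k l : nat) (w : form R m k) (e : form R m l) x V i j :
  i != j -> row i V = row j V -> wedge w e x V = 0.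
Proof. by move=> ij eV; rewrite wedgeE (alternate_eq_rows0 _ ij eV) mulr0. Qed.

Definition map_rows (m m' k : nat) (h : 'rV[R]_m -> 'rV[R]_m')
  (V : 'M[R]_(k, m)) : 'M[R]_(k, m') := \matrix_i h (row i V).

Lemma row_map_rows (m m' k : nat) (h : 'rV[R]_m -> 'rV[R]_m')
  (V : 'M[R]_(k, m)) i : row i (map_rows h V) = h (row i V).
Proof. by rewrite rowK. Qed.

(** Wedge products are natural under every map of vectors, linear or not,
    since their values only involve permutations of the rows. *)
Lemma wedge_map_rows (m m' k l : nat) (h : 'rV[R]_m -> 'rV[R]_m')
    (w : form R m' k) (e : form R m' l) (w' : form R m k) (e' : form R m l)
    x x' :
  (forall V, w x (map_rows h V) = w' x' V) ->
  (forall V, e x (map_rows h V) = e' x' V) ->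
  forall V, wedge w e x (map_rows h V) = wedge w' e' x' V.
Proof.
move=> hw he V; rewrite /wedge; congr (_ * _); apply: eq_bigr => s _.
rewrite -hw -he; congr (_ * w x _ * e x _);
  by apply/row_matrixP => i; apply/rowP => j; rewrite !mxE; congr (h _ _ _);
    apply/rowP => c; rewrite !mxE.
Qed.

Lemma wedge_pow_map_rows (m m' k j : nat) (h : 'rV[R]_m -> 'rV[R]_m')
    (w : form R m' k) (w' : form R m k) x x' :
  (forall V, w x (map_rows h V) = w' x' V) ->
  forall V, wedge_pow w j x (map_rows h V) = wedge_pow w' j x' V.
Proof. by move=> hw; elim: j => [//|j ih] V; exact: wedge_map_rows. Qed.

Lemma eq_wedge (m k l : nat) (w w' : form R m k) (e e' : form R m l) x :
  w x =1 w' x -> e x =1 e' x -> wedge w e x =1 wedge w' e' x.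
Proof.
by move=> hw he V; rewrite /wedge; under eq_bigr do rewrite hw he.
Qed.

Lemma eq_wedge_pow (m k j : nat) (w w' : form R m k) x :
  w x =1 w' x -> wedge_pow w j x =1 wedge_pow w' j x.
Proof. by move=> hw; elim: j => [//|j ih] V; exact: eq_wedge. Qed.

Lemma wedge_scale (m k l : nat) (c d : R) (w : form R m k) (e : form R m l)
    x V :
  wedge (fun y U => c * w y U) (fun y U => d * e y U) x V =
  c * d * wedge w e x V.
Proof.
rewrite /wedge mulrCA; congr (_ * _); rewrite mulr_sumr.
apply: eq_bigr => s _; move: ((-1) ^+ _ : R) (w _ _) (e _ _) => p q r; ring.
Qed.

Lemma wedge_pow_scale (m k j : nat) (c : R) (w : form R m k) x V :
  wedge_pow (fun y U => c * w y U) j x V = c ^+ j * wedge_pow w j x V.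
Proof.
elim: j V => [|j ih] V /=; first by rewrite mul1r.
rewrite exprS -(wedge_scale c (c ^+ j)); exact: eq_wedge.
Qed.

Lemma wedge_addl (m k l : nat) (w w' : form R m k) (e : form R m l) x V :
  wedge (fun y U => w y U + w' y U) e x V = wedge w e x V + wedge w' e x V.
Proof.
rewrite /wedge -mulrDr -big_split /=; congr (_ * _).
by apply: eq_bigr => s _; rewrite mulrDr mulrDl.
Qed.

End Wedge.

(** * Linear algebra of contact forms at a point *)

Section PointwiseContact.
Variables (R : realType) (m : nat).
Implicit Types (a : form R m 1) (A : form R m 2) (b : 'rV[R]_m -> 'rV[R]_m -> R).

Definition bilinear_form (b : 'rV[R]_m -> 'rV[R]_m -> R) : Prop :=
  (forall v, scalar (b^~ v)) /\ (forall u, scalar (b u)).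

Lemma scalar_fun0 (f : 'rV[R]_m -> R) : scalar f -> f 0 = 0.
Proof.
by move=> fl; have := fl (-1) 0 0; rewrite scaler0 addr0 mulN1r addNr.
Qed.

Lemma scalar_funZ (f : 'rV[R]_m -> R) c u : scalar f -> f (c *: u) = c * f u.
Proof.
by move=> fl; have := fl c u 0; rewrite addr0 (scalar_fun0 fl) addr0.
Qed.

Lemma scalar_funD (f : 'rV[R]_m -> R) u v : scalar f -> f (u + v) = f u + f v.
Proof. by move=> fl; have := fl 1 u v; rewrite scale1r mul1r. Qed.

Lemma scalar_fun_sum (f : 'rV[R]_m -> R) v : scalar f ->
  f v = \sum_j v 0 j * f (delta_mx 0 j).
Proof.
move=> fl; rewrite {1}[v]row_sum_delta.
elim/big_ind2: _ => [|u c v' d <- <-|j _]; first exact: scalar_fun0.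
  exact: scalar_funD.
exact: scalar_funZ.
Qed.

Lemma scalar_multilinear (f : 'M[R]_(1, m) -> R) : scalar f -> multilinear f.
Proof.
move=> fl i a b A B C; rewrite !ord1 => rA _ _.
have row0E (D : 'M[R]_(1, m)) : D = row 0 D.
  by apply/rowP => j; rewrite mxE.
rewrite (row0E A) rA -!row0E scalar_funD // !scalar_funZ //.
Qed.

Lemma bilinear_multilinear b : bilinear_form b ->
  multilinear (fun V : 'M[R]_(2, m) => b (row 0 V) (row 1 V)).
Proof.
move=> [bl br] i c d A B C; have [->|i0] := eqVneq i 0.
  move=> -> /(_ 1 isT) -> /(_ 1 isT) ->.
  by rewrite (scalar_funD _ _ (bl _)) !(scalar_funZ _ _ (bl _)).
have -> : i = 1 by apply/val_inj; case: i i0 => [[|[]]].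
move=> -> /(_ 0 isT) -> /(_ 0 isT) ->.
by rewrite (scalar_funD _ _ (br _)) !(scalar_funZ _ _ (br _)).
Qed.

(** If [r] lies in the kernels of [a] and [b], the projection along [r] onto a
    coordinate hyperplane leaves [a] and [b] unchanged, and turns any family of
    vectors into one that does not span. *)
Lemma wedge_top_kernel0 (n : nat) a A x b (r : 'rV[R]_m) V :
  m = (1 + n * 2)%N -> scalar (a x) ->
  (forall U, A x U = b (row 0 U) (row 1 U)) -> bilinear_form b ->
  r != 0 -> a x r = 0 -> (forall v, b r v = 0) -> (forall v, b v r = 0) ->
  wedge a (wedge_pow A n) x V = 0.
Proof.
move=> mn al AE bb r0 ar br0 b0r.
have [j rj] : exists j, r 0 j != 0.
  apply/existsP; apply: contraR r0 => /existsPn r0; apply/eqP/rowP => i.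
  by rewrite mxE; apply/eqP; rewrite -[_ == _]negbK.
pose h (v : 'rV[R]_m) := (- (v 0 j / r 0 j)) *: r + v.
have [bl br] := bb.
have hV k (W : 'M[R]_(k, m)) i : row i (map_rows h W) = h (row i W).
  exact: row_map_rows.
have row0E (D : 'M[R]_(1, m)) : D = row 0 D.
  by apply/rowP => c; rewrite mxE.
have bh u v : b (h u) (h v) = b u v.
  by rewrite /h bl br0 mulr0 add0r br b0r mulr0 add0r.
have ha W : a x (map_rows h W) = a x W.
  by rewrite [in LHS](row0E (map_rows _ _)) hV /h al ar mulr0 add0r -row0E.
have hA W : A x (map_rows h W) = A x W by rewrite !AE !hV bh.
rewrite -(wedge_map_rows ha (wedge_pow_map_rows hA)).
have Al : multilinear (A x).
  rewrite (_ : A x = fun U => b (row 0 U) (row 1 U)); last exact/funext.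
  exact: bilinear_multilinear.
apply: alternating_dependent0.
- apply: wedge_multilinear; first exact: scalar_multilinear.
  exact: wedge_pow_multilinear.
- by move=> W i i' ii' /(wedge_eq_rows0 _ _ _ ii').
apply/negP => /eqP rk.
have /row_fullP[B /matrixP/(_ j j)] : row_full (map_rows h V).
  by rewrite /row_full rk mn.
rewrite !mxE eqxx big1 => [/esym/eqP|i _]; first by rewrite oner_eq0.
rewrite -[map_rows h V i j]/(map_rows h V i j) (_ : map_rows h V i j = 0) ?mulr0 //.
by rewrite !mxE mulNr divfK // addNr.
Qed.

(** If [a' r] were non-zero, the map [v |-> v + ((a v - a' v) / a' r) r] would
    pull [a'] back to [a] while preserving [b], and the vanishing of the second
    product would force that of the first. *)
Lemma wedge_top_reeb0 (n : nat) a a' A x b (r : 'rV[R]_m) :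
  scalar (a' x) ->
  (forall U, A x U = b (row 0 U) (row 1 U)) -> bilinear_form b ->
  (forall v, b r v = 0) -> (forall v, b v r = 0) ->
  (exists V, wedge a (wedge_pow A n) x V <> 0) ->
  (forall V, wedge a' (wedge_pow A n) x V = 0) -> a' x r = 0.
Proof.
move=> al' AE [bl br] br0 b0r [V V0] a'0; apply: contrapT => /eqP a'r.
apply: V0; pose h (v : 'rV[R]_m) := ((a x v - a' x v) / a' x r) *: r + v.
rewrite -(a'0 (map_rows h V)); apply/esym/wedge_map_rows => [W|].
  have -> : map_rows h W = h W.
    by apply/rowP => c; rewrite !mxE; congr (_ * _ + _); rewrite row_id.
  by rewrite /h al' divfK // subrK.
apply: wedge_pow_map_rows => W; rewrite !AE !row_map_rows /h.
by rewrite bl br0 mulr0 add0r br b0r mulr0 add0r.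
Qed.

(** In odd order, the determinant of an antisymmetric matrix equals its opposite. *)
Lemma antisymmetric_odd_kernel b : odd m -> bilinear_form b ->
  (forall u v, b u v = - b v u) ->
  exists2 r : 'rV[R]_m, r != 0 & forall v, b r v = 0.
Proof.
move=> om [bl br] bN; pose B := \matrix_(i, j) b (delta_mx 0 i) (delta_mx 0 j).
have : \det B = 0.
  have BT : B^T = -1 *: B.
    by apply/matrixP => i j; rewrite !mxE bN mulN1r.
  have := det_tr B; rewrite BT detZ -signr_odd om expr1 mulN1r => /eqP.
  by rewrite eq_sym -addr_eq0 -mulr2n mulrn_eq0 /= => /eqP.
move/eqP/det0P => [r r0 rB]; exists r => // v.
rewrite (scalar_fun_sum v (br r)) big1 // => j _.
rewrite (scalar_fun_sum r (bl _)).
have /matrixP/(_ 0 j) := rB; rewrite !mxE => rBj.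
rewrite (eq_bigr (fun i => r 0 i * B i j)) => [|i _]; last by rewrite mxE.
by rewrite rBj mulr0.
Qed.

(** In the product of [p mu + e de] with [de /\ mu] each monomial repeats a
    factor, so that a transposition leaves it unchanged. *)
Lemma wedge_plane0 a A x (mu de : 'rV[R]_m -> R) p q e V :
  (forall v, a x v = p * mu v + e * de v) ->
  (forall U, A x U = q * (de (row 0 U) * mu (row 1 U) -
                          de (row 1 U) * mu (row 0 U))) ->
  wedge a A x V = 0.
Proof.
move=> aE AE; rewrite wedgeE.
pose i0 : 'I_(1 + 2) := @Ordinal 3 0 isT.
pose i1 : 'I_(1 + 2) := @Ordinal 3 1 isT.
pose i2 : 'I_(1 + 2) := @Ordinal 3 2 isT.
pose T (f g h : 'rV[R]_m -> R) (W : 'M[R]_(1 + 2, m)) :=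
  f (row i0 W) * g (row i1 W) * h (row i2 W).
have row_s t j W : row j (row_perm t W) = row (t j) W.
  by apply/rowP => c; rewrite !mxE.
have T02 f g : alternate (T f g f) V = 0.
  apply: (@alternate_sym0 _ _ _ (tperm i0 i2)) => [|W]; first by rewrite odd_tperm.
  by rewrite /T !row_s tpermL tpermR tpermD // mulrC mulrA mulrAC.
have T01 f g : alternate (T f f g) V = 0.
  apply: (@alternate_sym0 _ _ _ (tperm i0 i1)) => [|W]; first by rewrite odd_tperm.
  by rewrite /T !row_s tpermL tpermR tpermD // [f _ * _]mulrC.
set S := alternate _ _.
suff -> : S = p * q * alternate (T mu de mu) V - p * q * alternate (T mu mu de) V
   + (e * q * alternate (T de de mu) V - e * q * alternate (T de mu de) V).
  by rewrite !T02 !T01 !mulr0 subr0 addr0 mulr0.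
rewrite /S /alternate !mulr_sumr -!sumrN -!big_split /=; apply: eq_bigr => s _.
rewrite /T; move: (row_perm s V) ((-1) ^+ s : R) => W sg.
have -> : usubmx W = row i0 W.
  by apply/rowP => c; rewrite !mxE; congr (W _ _); apply/val_inj.
rewrite aE AE.
have -> : row 0 (dsubmx W) = row i1 W.
  by apply/rowP => c; rewrite !mxE; congr (W _ _); apply/val_inj.
have -> : row 1 (dsubmx W) = row i2 W.
  by apply/rowP => c; rewrite !mxE; congr (W _ _); apply/val_inj.
ring.
Qed.

(** Changing the sign of one row changes the sign of the value. *)
Lemma multilinear_positive (k : nat) (f : 'M[R]_(k.+1, m) -> R) V :
  multilinear f -> f V <> 0 -> exists W, 0 < f W.
Proof.
move=> fl /eqP; rewrite neq_lt => /orP[fV|]; last by exists V.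
exists (replace_row 0 (-1 *: row 0 V + 0 *: row 0 V) V).
by rewrite multilinear_replace // replace_row_id mul0r addr0 mulN1r oppr_gt0.
Qed.

End PointwiseContact.

(** * Smooth functions on open sets *)

Section NearEq.
Variables (R : realType) (V W : normedModType R).

Lemma near_eq_differentiable (f g : V -> W) (x : V) :
  (\near x, f x = g x) -> differentiable f x -> differentiable g x.
Proof.
move=> fg df; have fgx : f x = g x := nbhs_singleton fg.
have dg : g \o shift x = cst (g x) + 'd f x +o_ 0 id.
  apply/eqaddoP => e e0.
  have /eqaddoP/(_ e e0) := diff_locally df; apply: filter_app.
  move: fg; rewrite (near_shift 0) subr0; apply: filterS => y /= fgy.
  by rewrite /cst !fctE /= fgy fgx.
have dE : 'd g x = 'd f x :> (V -> W).
  by apply: diff_unique => //; exact: diff_continuous.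
apply/diff_locallyP; split; last by rewrite dE.
by rewrite dE; exact: diff_continuous.
Qed.

Lemma near_eq_diff (f g : V -> W) (x v : V) :
  (\near x, f x = g x) -> differentiable f x -> 'd f x v = 'd g x v.
Proof.
move=> fg df; rewrite -!deriveE //; first exact: near_eq_derive.
exact: near_eq_differentiable df.
Qed.

Lemma derive_eq_on (U : set V) (f g : V -> W) (x v : V) :
  open U -> U x -> (forall y, U y -> f y = g y) -> 'D_v f x = 'D_v g x.
Proof.
move=> oU Ux fg; apply: near_eq_derive.
by near=> y; apply: fg; near: y; exact: open_nbhs_nbhs.
Unshelve. all: by end_near. Qed.

Lemma differentiable_eq_on (U : set V) (f g : V -> W) (x : V) :
  open U -> U x -> (forall y, U y -> f y = g y) ->
  differentiable f x -> differentiable g x.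
Proof.
move=> oU Ux fg; apply: near_eq_differentiable.
by near=> y; apply: fg; near: y; exact: open_nbhs_nbhs.
Unshelve. all: by end_near. Qed.

End NearEq.

Section SmoothOn.
Variables (R : realType) (m : nat).
Implicit Types (U : set 'rV[R]_m).

Lemma smooth_on_sub (W : normedModType R) U U' (f : 'rV[R]_m -> W) :
  U' `<=` U -> smooth_on U f -> smooth_on U' f.
Proof. by move=> sU fs x /sU; exact: fs. Qed.

Lemma smooth_on_differentiable (W : normedModType R) U (f : 'rV[R]_m -> W) x :
  smooth_on U f -> U x -> differentiable f x.
Proof. by move=> fs Ux; exact: (fs x Ux [::]). Qed.

Lemma smooth_on_partial (W : normedModType R) U (f : 'rV[R]_m -> W) i :
  smooth_on U f -> smooth_on U ('D_(delta_mx 0 i) f).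
Proof.
move=> fs x Ux s; have := fs x Ux (rcons s i).
suff -> : iter_partial (rcons s i) f = iter_partial s ('D_(delta_mx 0 i) f) by [].
by elim: s => //= j s ->.
Qed.

Lemma iter_partial_eq_on (W : normedModType R) U (f g : 'rV[R]_m -> W) s :
  open U -> (forall x, U x -> f x = g x) ->
  forall x, U x -> iter_partial s f x = iter_partial s g x.
Proof.
by move=> oU fg; elim: s => //= i s ih x Ux; exact: derive_eq_on ih.
Qed.

Lemma smooth_on_eq (W : normedModType R) U (f g : 'rV[R]_m -> W) :
  open U -> (forall x, U x -> f x = g x) -> smooth_on U f -> smooth_on U g.
Proof.
move=> oU fg fs x Ux s.
apply: (@differentiable_eq_on _ _ _ U (iter_partial s f)) => //; last exact: fs.
exact: iter_partial_eq_on.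
Qed.

(** Coinduction: a class of differentiable functions that is stable, up to
    equality on [U], under partial derivatives consists of smooth functions. *)
Lemma smooth_on_coind (W : normedModType R) U
    (P : ('rV[R]_m -> W) -> Prop) : open U ->
  (forall f, P f -> forall x, U x -> differentiable f x) ->
  (forall f, P f -> forall i, exists2 g, P g &
     forall x, U x -> 'D_(delta_mx 0 i) f x = g x) ->
  forall f, P f -> smooth_on U f.
Proof.
move=> oU Pd PD f Pf x Ux s.
have [g Pg fg] : exists2 g, P g & forall y, U y -> iter_partial s f y = g y.
  elim: s => [|i s [g Pg fg]]; first by exists f.
  have [g' Pg' gg'] := PD g Pg i; exists g' => //= y Uy.
  by rewrite (derive_eq_on _ oU Uy fg) gg'.
apply: (@differentiable_eq_on _ _ _ U g) => //; first by move=> y /fg.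
exact: Pd.
Qed.

Lemma smooth_on_cst (W : normedModType R) U (c : W) :
  open U -> smooth_on U (fun _ => c).
Proof.
move=> oU; apply: (@smooth_on_coind _ U (fun f => exists d, f = fun _ => d)) => //.
- by move=> f [d ->] x _; exact: differentiable_cst.
- move=> f [d ->] i; exists (fun _ => 0); first by exists 0.
  by move=> x _; rewrite derive_cst.
- by exists c.
Qed.

Lemma smooth_on_linear (W : normedModType R) U (L : {linear 'rV[R]_m -> W}) :
  open U -> continuous L -> smooth_on U L.
Proof.
move=> oU Lc; have Ld x : differentiable L x by exact: linear_differentiable.
apply: (@smooth_on_coind _ U
  (fun f => f = L \/ exists d, f = fun _ => d)) => //; last by left.
- by move=> f [->|[d ->]] x _ //; exact: differentiable_cst.
- move=> f [->|[d ->]] i.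
  + exists (fun _ => L (delta_mx 0 i)); first by right; exists (L (delta_mx 0 i)).
    by move=> x _; rewrite deriveE // diff_lin.
  + exists (fun _ => 0); first by right; exists 0.
    by move=> x _; rewrite derive_cst.
Qed.

Lemma smooth_on_postlinear (W W' : normedModType R) U (L : {linear W -> W'})
    (f : 'rV[R]_m -> W) :
  open U -> continuous L -> smooth_on U f -> smooth_on U (L \o f).
Proof.
move=> oU Lc fs; have Ld x : differentiable L x by exact: linear_differentiable.
apply: (@smooth_on_coind _ U
  (fun h => exists2 g, smooth_on U g & h = L \o g)) => //; last by exists f.
- move=> h [g gs ->] x Ux; apply: differentiable_comp => //.
  exact: smooth_on_differentiable Ux.
- move=> h [g gs ->] i; exists (L \o 'D_(delta_mx 0 i) g).
    by exists ('D_(delta_mx 0 i) g) => //; exact: smooth_on_partial.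
  move=> x Ux; have gd := smooth_on_differentiable gs Ux.
  rewrite deriveE; last exact: differentiable_comp.
  by rewrite diff_comp //= diff_lin // deriveE.
Qed.

End SmoothOn.

(** * Stability of smoothness and symmetry of second derivatives *)

Section SmoothAlgebra.
Variables (R : realType) (m : nat).
Implicit Types (U : set 'rV[R]_m).

(** Expressions built from smooth data; their partial derivatives are again
    such expressions, so that they are smooth by coinduction. *)
Inductive smooth_expr U : ('rV[R]_m -> R^o) -> Prop :=
| SmoothBase f : smooth_on U f -> smooth_expr U f
| SmoothComp l (V : set 'rV[R]_l) (g : 'rV[R]_m -> 'rV[R]_l)
    (f : 'rV[R]_l -> R^o) :
    smooth_on U g -> (forall x, U x -> V (g x)) -> smooth_on V f ->
    smooth_expr U (f \o g)
| SmoothFun (h : R -> R) (f : 'rV[R]_m -> R^o) : smooth_fun h -> smooth_on U f -> smooth_expr U (h \o f)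
| SmoothInv (f : 'rV[R]_m -> R^o) : smooth_on U f -> (forall x, U x -> f x != 0) ->
    smooth_expr U (fun x => (f x : R)^-1)
| SmoothAdd (f g : 'rV[R]_m -> R^o) : smooth_expr U f -> smooth_expr U g ->
    smooth_expr U (fun x => f x + g x)
| SmoothMul (f g : 'rV[R]_m -> R^o) : smooth_expr U f -> smooth_expr U g ->
    smooth_expr U (fun x => (f x : R) * g x).

Lemma smooth_fun_derive1 (h : R -> R) : smooth_fun h -> smooth_fun (derive1 h).
Proof. by move=> hs k x; rewrite -derive1Sn; exact: hs. Qed.

Lemma smooth_on_coord U l (g : 'rV[R]_m -> 'rV[R]_l) j :
  open U -> smooth_on U g -> smooth_on U (fun x => g x 0 j : R^o).
Proof.
move=> oU gs.
have coordP : linear (fun N : 'rV[R]_l => N 0 j : R^o).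
  by move=> c u v; rewrite !mxE.
pose L : {linear 'rV[R]_l -> R^o} := HB.pack (fun N : 'rV[R]_l => N 0 j : R^o)
  (GRing.isLinear.Build _ _ _ _ _ coordP).
apply: (@smooth_on_postlinear R m _ _ U L g) => //.
exact: (@coord_continuous R 1 l 0 j).
Qed.

Lemma diff_sum_partial k (W : normedModType R) (f : 'rV[R]_k -> W) x v :
  differentiable f x -> 'd f x v = \sum_j v 0 j *: 'D_(delta_mx 0 j) f x.
Proof.
move=> fd; rewrite {1}[v]row_sum_delta linear_sum; apply: eq_bigr => j _.
by rewrite linearZ deriveE.
Qed.

Lemma derive_coord l (g : 'rV[R]_m -> 'rV[R]_l) x v j :
  differentiable g x -> ('d g x v) 0 j = 'D_v (fun y => g y 0 j : R^o) x.
Proof.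
move=> gd; rewrite -deriveE // derive_mx ?mxE //.
exact: diff_derivable.
Qed.

Lemma differentiable_fun_coord l (g : 'rV[R]_m -> 'rV[R]_l) x j :
  differentiable g x -> differentiable (fun y => g y 0 j : R^o) x.
Proof.
move=> gd; apply: (@differentiable_comp _ _ _ _ g (fun N : 'rV[R]_l => N 0 j)) => //.
exact: differentiable_coord.
Qed.

Lemma derive_fun_comp (V : normedModType R) (h : R -> R) (f : V -> R^o) x v :
  derivable (h : R -> R^o) (f x) 1 -> differentiable f x ->
  differentiable (h \o f : V -> R^o) x /\
  'D_v (h \o f : V -> R^o) x = derive1 (h : R -> R^o) (f x) * 'D_v f x.
Proof.
move=> /derivable1_diffP hd fd.
have hfd : differentiable (h \o f : V -> R^o) x by exact: differentiable_comp.
split => //; rewrite (deriveE _ hfd) diff_comp //= -[X in 'd _ _ X = _]mulr1.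
rewrite -[X in 'd _ _ X]/('d f x v *: (1 : R^o)) linearZ /=.
by rewrite derive1E' // (deriveE _ fd) mulrC.
Qed.

Lemma smooth_expr_differentiable U f x :
  smooth_expr U f -> U x -> differentiable f x.
Proof.
move=> fs Ux; elim: fs => {f} [f fs|l V g f gs gV fs|h f hs fs|f fs f0|
  f g _ fd _ gd|f g _ fd _ gd].
- exact: smooth_on_differentiable Ux.
- apply: differentiable_comp; first exact: smooth_on_differentiable Ux.
  exact: (smooth_on_differentiable fs (gV _ Ux)).
- apply: differentiable_comp; first exact: smooth_on_differentiable Ux.
  by apply/derivable1_diffP; exact: (hs 0%N).
- apply: (@differentiableV _ _ (f : _ -> R)); last exact: f0.
  exact: smooth_on_differentiable Ux.
- exact: differentiableD.
- exact: (@differentiableM _ _ (f : _ -> R) (g : _ -> R)).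
Qed.

Lemma smooth_expr_sum U l (f : 'I_l -> 'rV[R]_m -> R^o) : open U ->
  (forall j, smooth_expr U (f j)) -> smooth_expr U (fun x => \sum_j f j x).
Proof.
move=> oU; elim: l f => [|l ih] f fs.
  under eq_fun do rewrite big_ord0.
  exact/SmoothBase/smooth_on_cst.
under eq_fun do rewrite big_ord_recl.
by apply: SmoothAdd => //; exact: ih.
Qed.

Lemma smooth_expr_partial U f i : open U -> smooth_expr U f ->
  exists2 g, smooth_expr U g &
    forall x, U x -> 'D_(delta_mx 0 i) f x = g x.
Proof.
move=> oU; elim=> {f} [f fs|l V g f gs gV fs|h f hs fs|f fs f0|
  f g fs [df dfs fE] gs [dg dgs gE]|f g fs [df dfs fE] gs [dg dgs gE]].
- by exists ('D_(delta_mx 0 i) f) => //; exact/SmoothBase/smooth_on_partial.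
- exists (fun x => \sum_j ('D_(delta_mx 0 i) g x) 0 j
                     * ('D_(delta_mx 0 j) f \o g) x).
    apply: smooth_expr_sum => // j; apply: SmoothMul.
      exact/SmoothBase/smooth_on_coord/smooth_on_partial.
    by apply: (SmoothComp gs gV); exact: smooth_on_partial.
  move=> x Ux; have gd := smooth_on_differentiable gs Ux.
  have fd := smooth_on_differentiable fs (gV _ Ux).
  rewrite deriveE; last exact: differentiable_comp.
  rewrite diff_comp //= (diff_sum_partial _ fd); apply: eq_bigr => j _.
  by rewrite (deriveE _ gd).
- exists (fun x => (derive1 h \o f) x * 'D_(delta_mx 0 i) f x).
    apply: SmoothMul; last exact/SmoothBase/smooth_on_partial.
    by apply: SmoothFun => //; exact: smooth_fun_derive1.
  move=> x Ux; have fd := smooth_on_differentiable fs Ux.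
  by have [] := derive_fun_comp (delta_mx 0 i) (hs 0%N (f x)) fd.
- exists (fun x => ((f x)^-1 * (f x)^-1) * (-1 * 'D_(delta_mx 0 i) f x)).
    by apply: SmoothMul; apply: SmoothMul; first [exact: SmoothInv
      | exact/SmoothBase/smooth_on_cst | exact/SmoothBase/smooth_on_partial].
  move=> x Ux; have fd := smooth_on_differentiable fs Ux.
  rewrite (@deriveV _ _ (f : _ -> R)) ?f0 //; last exact: diff_derivable.
  by rewrite expr2 invfM mulN1r mulrN -mulNr.
- exists (fun x => df x + dg x); first exact: SmoothAdd.
  move=> x Ux; rewrite deriveD ?fE ?gE //; apply: diff_derivable;
    exact: smooth_expr_differentiable Ux.
- exists (fun x => f x * dg x + g x * df x).
    by apply: SmoothAdd; exact: SmoothMul.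
  move=> x Ux; rewrite (@deriveM _ _ (f : _ -> R) (g : _ -> R)) ?fE ?gE //;
    apply: diff_derivable; exact: smooth_expr_differentiable Ux.
Qed.

Lemma smooth_exprP U f : open U -> smooth_expr U f -> smooth_on U f.
Proof.
move=> oU; apply: (smooth_on_coind oU).
  by move=> g gs x; exact: smooth_expr_differentiable.
by move=> g gs i; exact: smooth_expr_partial.
Qed.

End SmoothAlgebra.

Section Schwarz.
Variables (R : realType) (V : normedModType R).

Lemma differentiable_bound (g : V -> R^o) (x : V) (e : R) :
  differentiable g x -> 0 < e ->
  \forall h \near (0 : V), `|g (h + x) - (g x + 'd g x h)| <= e * `|h|.
Proof. by move=> /diff_locally/eqaddoP/(_ e) + e0 => /(_ e0). Qed.

(** The mean value theorem for [s |-> f (x + s u + t v) - f (x + s u)] on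
    [[0, t]], combined with the first order expansion of ['D_u f] at [x]. *)
Lemma second_difference (f : V -> R^o) (x u v : V) (e : R) :
  (\forall y \near x, differentiable f y) -> differentiable ('D_u f) x -> 0 < e ->
  \forall t \near 0^'+,
    `|f (x + t *: u + t *: v) - f (x + t *: u) - f (x + t *: v) + f x
      - t ^+ 2 * 'D_v ('D_u f) x| <= e * t ^+ 2.
Proof.
move=> fd gd e0; pose C : R := 1 + `|u| + `|v|.
have C0 : 0 < C by rewrite /C -addrA ltr_pwDl // addr_ge0.
have e1 : 0 < e / (2 * C) by rewrite divr_gt0 // mulr_gt0.
have /nbhs_ballP[r1 /= r10 fdr] := fd.
have /nbhs_ballP[r2 /= r20 gr] := differentiable_bound gd e1.
have r0 : 0 < Num.min r1 r2 by rewrite lt_min r10 r20.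
near=> t; have t0 : 0 < t by near: t; exact: nbhs_right_gt.
have tr : t * C < Num.min r1 r2.
  rewrite -ltr_pdivlMr //; near: t; apply: nbhs_right_lt.
  by rewrite divr_gt0.
have small s q : 0 <= s <= t -> 0 <= q <= t -> `|s *: u + q *: v| <= t * C.
  move=> /andP[s0 st] /andP[q0 qt]; rewrite (le_trans (ler_normD _ _)) //.
  rewrite !normrZ !ger0_norm // /C -addrA mulrDr mulr1 mulrDr.
  by apply: ler_wpDl; [exact: ltW|apply: lerD; exact: ler_wpM2r].
have in1 s q : 0 <= s <= t -> 0 <= q <= t ->
    differentiable f (x + s *: u + q *: v).
  move=> st qt; apply: fdr; rewrite -ball_normE /ball_ /= -addrA opprD addrA subrr.
  rewrite add0r normrN (le_lt_trans (small _ _ st qt)) //.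
  by move: tr; rewrite lt_min => /andP[].
have gE s q : 0 <= s <= t -> 0 <= q <= t ->
    `|'D_u f (x + s *: u + q *: v) - ('D_u f x + 'd ('D_u f) x (s *: u + q *: v))|
      <= e / 2 * t.
  move=> st qt; rewrite -addrA [x + _]addrC.
  apply: (le_trans (gr _ _)).
    rewrite /= -ball_normE /ball_ /= sub0r normrN (le_lt_trans (small _ _ st qt)) //.
    by move: tr; rewrite lt_min => /andP[].
  rewrite (le_trans (ler_wpM2l (ltW e1) (small _ _ st qt))) //.
  by rewrite le_eqVlt; apply/orP; left; apply/eqP; field; exact: lt0r_neq0.
pose phi (s : R) : R^o := f (x + s *: u + t *: v) - f (x + s *: u).
have tt0 : 0 <= t <= t by rewrite lexx ltW.
have t00 : (0 : R) <= 0 <= t by rewrite lexx ltW.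
have fline q s : 0 <= s <= t -> 0 <= q <= t ->
    is_derive s 1 (fun s : R => f (x + s *: u + q *: v) : R^o)
      ('D_u f (x + s *: u + q *: v)).
  move=> st qt; set y := x + s *: u + q *: v.
  have yd : derivable f y u by apply: diff_derivable; exact: in1.
  have eqg : (fun h : R => h^-1 *: (f (x + (h *: (1 : R) + s) *: u + q *: v)
               - f (x + s *: u + q *: v)))
           = (fun h : R => h^-1 *: (f (h *: u + y) - f y)).
    apply/funext => h; congr (_ *: (f _ - _)).
    have -> : h *: (1 : R) = h by exact: mulr1.
    by rewrite /y scalerDl addrCA -[LHS]addrA.
  by split; rewrite /derivable /derive eqg.
have phiD s : 0 <= s <= t -> is_derive s 1 phi
    ('D_u f (x + s *: u + t *: v) - 'D_u f (x + s *: u)).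
  move=> st; apply: is_deriveB; first exact: fline.
  by have := fline 0 s st t00; rewrite scale0r addr0; under eq_fun do
     rewrite addr0.
have [c] : exists2 c, c \in `[0, t] & phi t - phi 0 =
    ('D_u f (x + c *: u + t *: v) - 'D_u f (x + c *: u)) * (t - 0).
  apply: MVT_segment; first exact: ltW.
    by move=> s; rewrite in_itv /= => /andP[s0 st]; apply: phiD; rewrite !ltW.
  apply: derivable_within_continuous => s; rewrite in_itv /= => st.
  by have [] := phiD s st.
rewrite in_itv /= subr0 => ct; rewrite /phi scale0r addr0 => phiE.
have -> : f (x + t *: u + t *: v) - f (x + t *: u) - f (x + t *: v) + f x
    = ('D_u f (x + c *: u + t *: v) - 'D_u f (x + c *: u)) * t.
  by rewrite -phiE; ring.
have dE q : 'd ('D_u f) x (c *: u + q *: v) =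
    'd ('D_u f) x (c *: u) + q * 'd ('D_u f) x v.
  by rewrite linearD [X in _ + X]linearZ.
have := gE c t ct tt0; have := gE c 0 ct t00.
rewrite !dE scale0r mul0r !addr0 (deriveE _ gd).
set A := 'D_u f (_ + _ + _); set B := 'D_u f (_ + _); set D := 'D_u f x.
set p := 'd _ _ _; set q := 'd _ _ v => G2 G1.
have -> : (A - B) * t - t ^+ 2 * q =
   t * ((A - (D + (p + t * q))) - (B - (D + p))).
  by ring.
rewrite normrM (gtr0_norm t0) expr2 mulrCA ler_pM2l //.
by rewrite (le_trans (ler_normB _ _)) // [e]splitr mulrDl lerD.
Unshelve. all: by end_near. Qed.

(** Both mixed derivatives are limits of the same second difference, which is
    symmetric in [u] and [v], divided by [t ^+ 2]. *)
Lemma derive_comm (f : V -> R^o) (x u v : V) :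
  (\forall y \near x, differentiable f y) ->
  differentiable ('D_u f) x -> differentiable ('D_v f) x ->
  'D_v ('D_u f) x = 'D_u ('D_v f) x.
Proof.
move=> fd ud vd; apply/eqP; rewrite -subr_eq0 -normr_le0.
apply/ler_addgt0Pl => e e0; rewrite addr0.
have e2 : 0 < e / 2 by rewrite divr_gt0.
have H1 := second_difference v fd ud e2.
have H2 := second_difference u fd vd e2.
have [t [[E1 +] t0]] := filter_ex (filterI (filterI H1 H2) (nbhs_right_gt 0)).
rewrite /= in E1 t0 *; rewrite [x + t *: v + _]addrAC => E2.
rewrite -(ler_pM2r (exprn_gt0 2 t0)) -[X in _ * X <= _](gtr0_norm (exprn_gt0 2 t0)).
rewrite -normrM; set A := 'D_v _ _ in E1 *; set B := 'D_u _ _ in E2 *.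
set p := f _ in E1 E2; set q := f _ in E1 E2; set r := f _ in E1 E2.
have -> : (A - B) * t ^+ 2 = (p - r - q + f x - t ^+ 2 * B)
   - (p - q - r + f x - t ^+ 2 * A) by ring.
apply: (le_trans (ler_normB _ _)); rewrite [e]splitr mulrDl.
exact: (lerD E2 E1).
Qed.

End Schwarz.

(** * Exterior derivative and pull-back of 1-forms *)

Section Calculus.
Variables (R : realType) (m : nat).

Lemma derive_bigsum (V : normedModType R) k (f : 'I_k -> V -> R^o) x v :
  (forall j, derivable (f j) x v) ->
  derivable (fun y => \sum_j f j y) x v /\
  'D_v (fun y => \sum_j f j y) x = \sum_j 'D_v (f j) x.
Proof.
elim: k f => [|k ih] f fd.
  under eq_fun do rewrite big_ord0.
  by rewrite big_ord0 derive_cst; split => //; exact: derivable_cst.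
under eq_fun do rewrite big_ord_recl.
have [d e] := ih (fun j => f (lift ord0 j)) (fun j => fd (lift ord0 j)).
by rewrite big_ord_recl -e; split; [exact: derivableD|rewrite deriveD].
Qed.

Lemma smooth_onD U (f g : 'rV[R]_m -> R^o) : open U ->
  smooth_on U f -> smooth_on U g -> smooth_on U (fun x => f x + g x).
Proof.
by move=> oU fs gs; apply: smooth_exprP => //; apply: SmoothAdd;
  exact: SmoothBase.
Qed.

Lemma smooth_onM U (f g : 'rV[R]_m -> R^o) : open U ->
  smooth_on U f -> smooth_on U g -> smooth_on U (fun x => (f x : R) * g x).
Proof.
by move=> oU fs gs; apply: smooth_exprP => //; apply: SmoothMul;
  exact: SmoothBase.
Qed.

Lemma smooth_onV U (f : 'rV[R]_m -> R^o) : open U -> smooth_on U f ->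
  (forall x, U x -> f x != 0) -> smooth_on U (fun x => (f x : R)^-1).
Proof. by move=> oU fs f0; apply: smooth_exprP => //; exact: SmoothInv. Qed.

Lemma smooth_on_sum U k (f : 'I_k -> 'rV[R]_m -> R^o) : open U ->
  (forall j, smooth_on U (f j)) -> smooth_on U (fun x => \sum_j f j x).
Proof.
move=> oU fs; apply: smooth_exprP => //; apply: smooth_expr_sum => // j.
exact: SmoothBase.
Qed.

Lemma smooth_on_comp U k (V : set 'rV[R]_k) (g : 'rV[R]_m -> 'rV[R]_k)
    (f : 'rV[R]_k -> R^o) : open U -> smooth_on U g ->
  (forall x, U x -> V (g x)) -> smooth_on V f -> smooth_on U (f \o g).
Proof.
by move=> oU gs gV fs; apply: smooth_exprP => //; exact: (SmoothComp gs gV).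
Qed.

Lemma smooth_on_fun U (h : R -> R) (f : 'rV[R]_m -> R^o) : open U ->
  smooth_fun h -> smooth_on U f -> smooth_on U (h \o f : _ -> R^o).
Proof. by move=> oU hs fs; apply: smooth_exprP => //; exact: SmoothFun. Qed.

Lemma smooth_on_derive U (f : 'rV[R]_m -> R^o) v : open U ->
  smooth_on U f -> smooth_on U ('D_v f).
Proof.
move=> oU fs.
apply: (@smooth_on_eq _ _ _ _
  (fun x => \sum_j (v 0 j : R) * 'D_(delta_mx 0 j) f x)) => //.
  move=> x Ux; have fd := smooth_on_differentiable fs Ux.
  by rewrite (deriveE _ fd) (diff_sum_partial _ fd).
apply: smooth_on_sum => // j; apply: smooth_onM => //; first exact: smooth_on_cst.
exact: smooth_on_partial.
Qed.

End Calculus.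

Section OneForms.
Variables (R : realType).

(** The exterior derivative of a 1-form, with its two vectors as separate
    arguments instead of the rows of a matrix. *)
Definition ext_d m (w : form R m 1) (x u v : 'rV[R]_m) : R :=
  'D_u (fun y => w y v : R^o) x - 'D_v (fun y => w y u : R^o) x.

Lemma dformE m (w : form R m 1) x V :
  dform w x V = ext_d w x (row 0 V) (row 1 V).
Proof.
rewrite /dform big_ord_recl big_ord1 /= expr0 mul1r expr1 mulN1r /ext_d.
have -> : row' 0 V = row 1 V.
  by apply/rowP => c; rewrite !mxE; congr (V _ _); apply/val_inj.
have -> : row' (lift ord0 ord0) V = row 0 V.
  by apply/rowP => c; rewrite !mxE; congr (V _ _); apply/val_inj.
by have -> : lift ord0 ord0 = 1 :> 'I_2 by apply/val_inj.
Qed.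

Lemma pullE m l (F : 'rV[R]_m -> 'rV[R]_l) (w : form R l 1) x v :
  pull F w x v = w (F x) ('d F x v).
Proof. by rewrite /pull /jacobian mul_rV_lin1. Qed.

Definition smooth_form m (U : set 'rV[R]_m) (w : form R m 1) : Prop :=
  (forall x, U x -> scalar (w x)) /\
  (forall v, smooth_on U (fun x => w x v : R^o)).

(** Linearity is required on a neighbourhood because the derivative of [w _ v]
    has to be linear in [v]. *)
Definition differentiable_form m (w : form R m 1) x : Prop :=
  (\forall y \near x, scalar (w y)) /\
  (forall v, differentiable (fun y => w y v : R^o) x).

Lemma smooth_form_differentiable m (U : set 'rV[R]_m) w x :
  open U -> smooth_form U w -> U x -> differentiable_form w x.
Proof.
move=> oU [wl ws] Ux; split; last by move=> v; exact: smooth_on_differentiable Ux.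
by near=> y; apply: wl; near: y; exact: open_nbhs_nbhs.
Unshelve. all: by end_near. Qed.

Lemma smooth_form_sub m (U U' : set 'rV[R]_m) w :
  U' `<=` U -> smooth_form U w -> smooth_form U' w.
Proof.
move=> sU [wl ws]; split=> [x /sU|v]; first exact: wl.
exact: smooth_on_sub (ws v).
Qed.

Lemma smooth_form_eq m (U : set 'rV[R]_m) w w' : open U ->
  (forall x, U x -> forall v, w x v = w' x v) -> smooth_form U w ->
  smooth_form U w'.
Proof.
move=> oU ww [wl ws]; split=> [x Ux c u v|v]; first by rewrite -!ww // wl.
by apply: smooth_on_eq (ws v) => // x Ux; exact: ww.
Qed.

Lemma smooth_formD m (U : set 'rV[R]_m) (w w' : form R m 1) : open U ->
  smooth_form U w -> smooth_form U w' ->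
  smooth_form U (fun x v => w x v + w' x v).
Proof.
move=> oU [wl ws] [wl' ws']; split=> [x Ux c u v|v].
  by rewrite wl // wl' //; ring.
exact: smooth_onD.
Qed.

Lemma smooth_formM m (U : set 'rV[R]_m) f (w : form R m 1) : open U ->
  smooth_on U (f : _ -> R^o) -> smooth_form U w ->
  smooth_form U (fun x v => f x * w x v).
Proof.
move=> oU fs [wl ws]; split=> [x Ux c u v|v]; first by rewrite wl //; ring.
exact: smooth_onM.
Qed.

Lemma smooth_form_pull m l (U : set 'rV[R]_m) (V : set 'rV[R]_l) F w :
  open U -> smooth_on U F -> (forall x, U x -> V (F x)) -> smooth_form V w ->
  smooth_form U (pull F w).
Proof.
move=> oU Fs UV [wl ws]; split=> [x Ux c u v|v].
  by rewrite !pullE linearP wl //; exact: UV.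
apply: (@smooth_on_eq _ _ _ _ (fun x => \sum_j
   ('D_v (fun y => F y 0 j : R^o) x : R) * ((fun y => w y (delta_mx 0 j)) \o F) x)) => //.
  move=> x Ux; have Fd := smooth_on_differentiable Fs Ux.
  rewrite pullE (scalar_fun_sum _ (wl _ (UV _ Ux))).
  by apply: eq_bigr => j _; rewrite derive_coord.
apply: smooth_on_sum => // j; apply: smooth_onM => //.
  by apply: smooth_on_derive => //; exact: smooth_on_coord.
exact: (smooth_on_comp oU Fs UV).
Qed.

Lemma ext_d_eq_on m (U : set 'rV[R]_m) w w' x u v : open U -> U x ->
  (forall y, U y -> forall v, w y v = w' y v) ->
  ext_d w x u v = ext_d w' x u v.
Proof.
move=> oU Ux ww; rewrite /ext_d.
by congr (_ - _); apply: (derive_eq_on _ oU Ux) => y Uy; rewrite ww.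
Qed.

Lemma ext_d_anti m (w : form R m 1) x u v : ext_d w x u v = - ext_d w x v u.
Proof. by rewrite /ext_d opprB. Qed.

Lemma ext_d0l m (w : form R m 1) x v :
  (\forall y \near x, scalar (w y)) -> ext_d w x 0 v = 0.
Proof.
move=> wl; rewrite /ext_d derive0 sub0r.
rewrite (near_eq_derive (g := fun _ => 0)) ?derive_cst ?oppr0 //.
by near=> y; apply: scalar_fun0; near: y.
Unshelve. all: by end_near. Qed.

Lemma ext_d_bilinear m (w : form R m 1) x :
  differentiable_form w x -> bilinear_form (ext_d w x).
Proof.
move=> [wl wd].
have dlin u : scalar (fun v => 'D_u (fun y => w y v : R^o) x).
  move=> c v v'.
  rewrite (near_eq_derive (g := fun y => c *: (w y v : R^o) + w y v')).
    rewrite deriveD ?deriveZ //; try exact: diff_derivable.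
    by apply: derivableZ; exact: diff_derivable.
  near=> y; have wly : scalar (w y) by near: y.
  exact: wly.
have vlin v : scalar (fun u => 'D_u (fun y => w y v : R^o) x).
  by move=> c u u'; rewrite !deriveE // linearP.
split=> u c v v'.
  by rewrite /ext_d (dlin u) (vlin u); ring.
by rewrite /ext_d (dlin u) (vlin u); ring.
Unshelve. all: by end_near. Qed.

Lemma ext_dD m (w w' : form R m 1) x u v :
  differentiable_form w x -> differentiable_form w' x ->
  ext_d (fun y v => w y v + w' y v) x u v = ext_d w x u v + ext_d w' x u v.
Proof.
move=> [_ wd] [_ wd']; rewrite /ext_d !deriveD; try exact: diff_derivable.
by ring.
Qed.

Lemma ext_dM m f (w : form R m 1) x u v :
  differentiable (f : _ -> R^o) x -> differentiable_form w x ->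
  ext_d (fun y v => f y * w y v) x u v =
  'D_u (f : _ -> R^o) x * w x v - 'D_v (f : _ -> R^o) x * w x u
  + f x * ext_d w x u v.
Proof.
move=> fd [_ wd]; rewrite /ext_d.
rewrite !(@deriveM _ _ (f : _ -> R)); try exact: diff_derivable.
rewrite /GRing.scale /=; ring.
Qed.

Lemma ext_dZ m c (w : form R m 1) x u v :
  differentiable_form w x ->
  ext_d (fun y v => c * w y v) x u v = c * ext_d w x u v.
Proof.
move=> wd; rewrite (@ext_dM _ (fun _ => c)) ?derive_cst //.
by rewrite !mul0r subrr add0r.
Qed.

(** Exterior differentiation commutes with pull-backs: the terms involving the
    second derivatives of [F] cancel by symmetry. *)
Lemma ext_d_pull m l (U : set 'rV[R]_m) (F : 'rV[R]_m -> 'rV[R]_l) w x u v :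
  open U -> smooth_on U F -> U x -> differentiable_form w (F x) ->
  ext_d (pull F w) x u v = ext_d w (F x) ('d F x u) ('d F x v).
Proof.
move=> oU Fs Ux [wl wd]; have Fd := smooth_on_differentiable Fs Ux.
pose Fc j y : R^o := F y 0 j.
have Fcs j : smooth_on U (Fc j) by exact: smooth_on_coord.
have Fdir j a : differentiable ('D_a (Fc j)) x.
  exact: (smooth_on_differentiable (smooth_on_derive a oU (Fcs j)) Ux).
have wFd j : differentiable (fun y => w (F y) (delta_mx 0 j) : R^o) x.
  by apply: (@differentiable_comp _ _ _ _ F (fun z => w z (delta_mx 0 j) : R^o)).
have lin_near : \forall y \near x, U y /\ scalar (w (F y)).
  apply: filterI; first exact: open_nbhs_nbhs.
  exact: (differentiable_continuous Fd wl).
have expand a b : 'D_a (fun y => pull F w y b : R^o) x =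
    \sum_j ('D_a ('D_b (Fc j)) x * w (F x) (delta_mx 0 j)
            + 'D_b (Fc j) x * 'D_('d F x a) (fun z => w z (delta_mx 0 j) : R^o) (F x)).
  rewrite (near_eq_derive (g := fun y => \sum_j
      ('D_b (Fc j) y : R) * w (F y) (delta_mx 0 j))); last first.
    apply: filterS lin_near => y [Uy wly].
    rewrite pullE (scalar_fun_sum _ wly); apply: eq_bigr => j _.
    by rewrite derive_coord //; exact: smooth_on_differentiable Uy.
  have [j|_ ->] := @derive_bigsum _ _ _ (fun j y =>
      ('D_b (Fc j) y : R) * w (F y) (delta_mx 0 j)) x a.
    apply: (@derivableM _ _ ('D_b (Fc j) : _ -> R)); exact: diff_derivable.
  apply: eq_bigr => j _.
  rewrite (@deriveM _ _ ('D_b (Fc j) : _ -> R)); try exact: diff_derivable.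
  rewrite addrC [X in X + _]mulrC; congr (_ * _ + _ * _).
  rewrite deriveE // (@diff_comp _ _ _ _ F (fun z => w z (delta_mx 0 j) : R^o)) //=.
  by rewrite deriveE.
have recombine a b : 'D_a (fun z => w z ('d F x b) : R^o) (F x) =
    \sum_j 'D_b (Fc j) x * 'D_a (fun z => w z (delta_mx 0 j) : R^o) (F x).
  rewrite (near_eq_derive (g := fun z => \sum_j
      (('d F x b) 0 j : R) * w z (delta_mx 0 j))); last first.
    by apply: filterS wl => z wlz; exact: scalar_fun_sum.
  have [j|_ ->] := @derive_bigsum _ _ _ (fun j z =>
      (('d F x b) 0 j : R) * w z (delta_mx 0 j)) (F x) a.
    by apply: derivableZ; exact: diff_derivable.
  apply: eq_bigr => j _; rewrite deriveZ; last exact: diff_derivable.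
  by rewrite derive_coord.
rewrite /ext_d !expand !recombine !big_split /= opprD addrACA.
rewrite -[RHS]add0r; congr (_ + _); apply/eqP; rewrite subr_eq0; apply/eqP.
apply: eq_bigr => j _.
have Fcd : \forall y \near x, differentiable (Fc j) y.
  apply: filterS lin_near => y [Uy _].
  exact: (smooth_on_differentiable (Fcs j) Uy).
by rewrite (derive_comm Fcd (Fdir j v) (Fdir j u)).
Qed.

End OneForms.

(** * Flat functions and the profiles of the limit form *)

Section FlatFunctions.
Variable R : realType.
Implicit Types (p : {poly R}) (x : R).

(** The functions [p(1/x) exp(-1/x)], extended by 0 to the negative axis. The
    family is stable under derivation, hence consists of smooth functions. *)
Definition flat p x : R := if 0 < x then p.[x^-1] * expR (- x^-1) else 0.

Lemma flat_gt0E p x : 0 < x -> flat p x = p.[x^-1] * expR (- x^-1).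
Proof. by rewrite /flat => ->. Qed.

Lemma flat_le0E p x : x <= 0 -> flat p x = 0.
Proof. by rewrite /flat leNgt => /negPf ->. Qed.

Lemma pow_expRN_le (k : nat) (y : R) : 0 < y ->
  y ^+ k * expR (- y) <= (k.+1)`!%:R / y.
Proof.
move=> y0; rewrite expRN ler_pdivrMr ?expR_gt0 // mulrAC ler_pdivlMr // -exprSr.
rewrite mulrC -ler_pdivrMr ?ltr0n ?fact_gt0 //.
by apply: le_trans (expR_ge1Dxn k (ltW y0)); rewrite lerDr.
Qed.

(** The derivative of [flat p] at 0 is the limit of [flat ('X * p)], which this
    bound shows to be 0. *)
Lemma flat_bound p : exists C : R, forall x, `|flat p x| <= C * `|x|.
Proof.
pose C := \sum_(i < size p) `|p`_i| * (i.+1)`!%:R.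
have C0 : 0 <= C by apply: sumr_ge0 => i _; rewrite mulr_ge0.
exists C => x; rewrite /flat; case: ifPn => x0; last first.
  by rewrite normr0 mulr_ge0.
rewrite (gtr0_norm x0) horner_coef mulr_suml (le_trans (ler_norm_sum _ _ _)) //.
rewrite /C mulr_suml; apply: ler_sum => i _.
rewrite !normrM -!mulrA ler_wpM2l // (ger0_norm (expR_ge0 _)).
rewrite ger0_norm ?exprn_ge0 ?invr_ge0 ?(ltW x0) //.
by have := pow_expRN_le i (eqbRL (invr_gt0 _) x0); rewrite invrK.
Qed.

Definition flat_deriv p : {poly R} := 'X^2 * (p - p^`()).

Lemma is_derive_flat p x : is_derive x 1 (flat p : R -> R^o) (flat (flat_deriv p) x).
Proof.
have [x0|x0|->] := ltgtP x 0.
- rewrite (flat_le0E (flat_deriv p) (ltW x0)).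
  apply: (@near_eq_is_derive _ _ _ (fun _ => 0 : R^o)).
  near=> y; rewrite flat_le0E // ltW //; near: y.
  exact: (open_nbhs_nbhs (conj (@open_lt R 0) x0)).
- apply: (@near_eq_is_derive _ _ _
    (fun y : R => (p.[y^-1] : R) * expR (- y^-1) : R^o)).
    near=> y; rewrite flat_gt0E //; near: y.
    exact: (open_nbhs_nbhs (conj (@open_gt R 0) x0)).
  have xn0 : x != 0 by rewrite gt_eqF.
  have invD : is_derive x 1 (fun y : R => y^-1 : R^o) (- x ^- 2).
    split; first by apply: derivableV => //; exact: derivable_id.
    rewrite (@deriveV _ _ (id : R -> R)) //.
      by rewrite derive_id /GRing.scale /= mulr1.
  have invNd : is_derive x 1 (fun y : R => - y^-1 : R^o) (x ^- 2).
    by rewrite -[x ^- 2]opprK; exact: is_deriveN.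
  have pD : is_derive x 1 (fun y => p.[y^-1] : R^o) (p^`().[x^-1] * - x ^- 2).
    have := @is_derive1_comp _ (horner p) (fun y => y^-1) x _ _
      (is_derive_poly p x^-1) invD.
    by move=> H; apply: (is_derive_eq H); rewrite mulrC.
  have eD : is_derive x 1 (fun y => expR (- y^-1) : R^o) (expR (- x^-1) * x ^- 2).
    have := @is_derive1_comp _ expR (fun y => - y^-1) x _ _
      (is_derive_expR (- x^-1)) invNd.
    by move=> H; apply: (is_derive_eq H).
  have H := is_deriveM pD eD; apply: (is_derive_eq H).
  rewrite flat_gt0E // /flat_deriv hornerM hornerXn hornerD hornerN /GRing.scale /=.
  by rewrite -exprVn; ring.
- have [C hC] := flat_bound ('X * p).
  rewrite (flat_le0E (flat_deriv p) (lexx 0)).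
  have lim0 : (fun h : R => h^-1 *: ((flat p (h *: 1 + 0) : R^o) - flat p 0)) @ 0^'
      --> (0 : R^o).
    apply/cvgrPdist_le => e e0; have C1 : 0 < `|C| + 1 by rewrite ltr_wpDl.
    near=> h; rewrite sub0r normrN (flat_le0E p (lexx 0)) subr0 addr0.
    have -> : h *: (1 : R) = h by exact: mulr1.
    have -> : h^-1 *: (flat p h : R^o) = flat ('X * p) h.
      rewrite /flat; case: ifP; last by rewrite scaler0.
      by move=> _; rewrite hornerM hornerX; exact: mulrA.
    apply: le_trans (hC h) _.
    have hs : `|h| <= e / (`|C| + 1).
      by near: h; apply: dnbhs0_le; exact: divr_gt0.
    have C2 : C <= `|C| + 1 by rewrite (le_trans (ler_norm C)) // lerDl.
    apply: (le_trans (ler_wpM2r (normr_ge0 h) C2)).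
    by rewrite mulrC -ler_pdivlMr.
  split; first by apply/cvg_ex; exists 0.
  exact: cvg_lim lim0.
Unshelve. all: by end_near. Qed.

Lemma flat_derive1 p : derive1 (flat p : R -> R^o) = flat (flat_deriv p).
Proof.
apply/funext => x; rewrite derive1E.
by have [_ ->] := is_derive_flat p x.
Qed.

Lemma flat_smooth p : smooth_fun (flat p).
Proof.
move=> k x; have [q ->] : exists q, derive1n k (flat p) = flat q.
  elim: k => [|k [q IH]]; first by exists p.
  by exists (flat_deriv q); rewrite derive1nS IH flat_derive1.
by have [] := is_derive_flat q x.
Qed.

Definition cutoff : R -> R := flat 1.

Lemma cutoff_gt0 x : 0 < x -> 0 < cutoff x.
Proof. by move=> x0; rewrite /cutoff flat_gt0E // hornerC mul1r expR_gt0. Qed.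

Lemma cutoff_ge0 x : 0 <= cutoff x.
Proof. by have [/cutoff_gt0/ltW //|x0] := ltP 0 x; rewrite /cutoff flat_le0E. Qed.

Lemma cutoff_le0 x : x <= 0 -> cutoff x = 0.
Proof. exact: flat_le0E. Qed.

Lemma cutoff_homo x y : x <= y -> cutoff x <= cutoff y.
Proof.
have [x0|x0 xy] := leP x 0; first by rewrite (cutoff_le0 x0) cutoff_ge0.
have y0 := lt_le_trans x0 xy.
rewrite /cutoff !flat_gt0E // !hornerC !mul1r ler_expR lerN2 lef_pV2 //.
Qed.

Definition cutoff' : R -> R := flat (flat_deriv 1).

Lemma is_derive_cutoff x : is_derive x 1 (cutoff : R -> R^o) (cutoff' x).
Proof. exact: is_derive_flat. Qed.

Lemma cutoff'_le0 x : x <= 0 -> cutoff' x = 0.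
Proof. exact: flat_le0E. Qed.

Lemma cutoff'_ge0 x : 0 <= cutoff' x.
Proof.
have [x0|x0] := ltP 0 x; last by rewrite cutoff'_le0.
rewrite /cutoff' flat_gt0E // mulr_ge0 ?expR_ge0 //.
by rewrite /flat_deriv derivC subr0 mulr1 hornerXn exprn_ge0 // invr_ge0 ltW.
Qed.

(** The coefficients of nu, of d rho and of d theta in the limit form. The first
    lives on [rho < 1/2] and the last on [rho > 1/2], where it reaches the
    plateau 1 at [rho = 3/4]; the second is positive across their common zero. *)
Definition nu_profile (r : R) : R := cutoff (2^-1 - r).
Definition rho_profile (r : R) : R := cutoff (3 / 4 - r).
(* The inner cutoff vanishes for [3/4 <= r], and is at least [cutoff 4^-1] for
   [r <= 1/2] because [3/4 - 1/2 = 1/4]. *)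
Definition theta_profile (r : R) : R :=
  cutoff (cutoff 4^-1 - cutoff (3 / 4 - r)) / cutoff (cutoff 4^-1).

Lemma is_derive_cutoff_sub (a r : R) :
  is_derive r 1 (fun r : R => cutoff (a - r) : R^o) (- cutoff' (a - r)).
Proof.
have := @is_derive1_comp _ cutoff (fun r : R => a - r) r _ _
  (is_derive_cutoff _) (is_deriveB (is_derive_cst (a : R^o) r 1) (is_derive_id r 1)).
by move=> H; apply: (is_derive_eq H); rewrite sub0r mulrN1.
Qed.

Lemma is_derive_theta_profile (r : R) :
  exists2 d, is_derive r 1 (theta_profile : R -> R^o) d &
    0 <= d /\ (r <= 2^-1 -> d = 0).
Proof.
set c := cutoff (cutoff 4^-1); pose q := cutoff 4^-1 - cutoff (3 / 4 - r).
exists (c^-1 * (cutoff' q * cutoff' (3 / 4 - r))).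
  have D1 : is_derive r 1 (fun r : R => cutoff 4^-1 - cutoff (3 / 4 - r) : R^o)
      (cutoff' (3 / 4 - r)).
    have := is_deriveB (is_derive_cst (cutoff 4^-1 : R^o) r 1)
      (is_derive_cutoff_sub (3 / 4) r).
    by move=> H; apply: (is_derive_eq H); rewrite sub0r opprK.
  have D2 := @is_derive1_comp _ cutoff
    (fun r : R => cutoff 4^-1 - cutoff (3 / 4 - r)) r _ _ (is_derive_cutoff _) D1.
  have := @is_deriveZ _ _ _ _ c^-1 r 1 _ D2.
  rewrite (_ : _ \*: _ = theta_profile) //.
  by apply/funext => s; rewrite /theta_profile; exact: mulrC.
have c0 : 0 < c by apply/cutoff_gt0/cutoff_gt0; rewrite invr_gt0.
split=> [|r2]; first by rewrite !mulr_ge0 ?cutoff'_ge0 // invr_ge0 ltW.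
rewrite (@cutoff'_le0 q) ?mul0r ?mulr0 // /q subr_le0 cutoff_homo //.
lra.
Qed.

Lemma theta_profile_ge0 r : 0 <= theta_profile r.
Proof. by rewrite /theta_profile divr_ge0 // cutoff_ge0. Qed.

Lemma theta_profile0 r : r <= 2^-1 -> theta_profile r = 0.
Proof.
move=> r2; rewrite /theta_profile cutoff_le0 ?mul0r // subr_le0 cutoff_homo //.
lra.
Qed.

Lemma theta_profile1 r : 3 / 4 <= r -> theta_profile r = 1.
Proof.
move=> r2; rewrite /theta_profile (@cutoff_le0 (3 / 4 - r)) ?subr_le0 // subr0.
by rewrite divff // gt_eqF //; apply/cutoff_gt0/cutoff_gt0; rewrite invr_gt0.
Qed.

(** Adding [e * x] with [e > 0] makes the function strictly increasing. *)
Lemma nondecreasing_derive1_ge0 (f : R -> R) (a b z : R) :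
  (forall x, derivable (f : R -> R^o) x 1) ->
  (forall x y, a <= x -> x <= y -> y <= b -> f x <= f y) ->
  a < z < b -> 0 <= derive1 (f : R -> R^o) z.
Proof.
move=> fd fi zab; apply/ler_addgt0Pr => e e0.
have eD (x : R) : is_derive x 1 (fun x : R => e * x : R^o) e.
  have H := @is_deriveZ _ _ _ (id : R -> R^o) e x 1 1 (is_derive_id x 1).
  by apply: (is_derive_eq H); exact: mulr1.
have fD (x : R) : is_derive x 1 (fun x : R => f x + e * x : R^o)
    (derive1 (f : R -> R^o) x + e).
  by rewrite derive1E; apply: (is_deriveD (derivableP (fd x)) (eD x)).
have dE : derive1 (fun x => f x + e * x : R^o) z = derive1 (f : R -> R^o) z + e.
  by rewrite derive1E; have [_ ->] := fD z.
rewrite -dE; apply: (@incr_derive1_ge0_itv _ _ true false a b) => //.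
move=> x y; rewrite !in_itv /= => /andP[ax xb] /andP[ay yb] xy.
by rewrite ler_ltD ?fi ?(ltW xy) // ltr_pM2l.
Qed.

End FlatFunctions.

(** * The contact condition in the normal form, at a point *)

Lemma contact_volume_multilinear (R : realType) (m n : nat) (w : form R m 1) x :
  differentiable_form w x -> multilinear (wedge w (wedge_pow (dform w) n) x).
Proof.
move=> wd; apply: wedge_multilinear.
  exact: scalar_multilinear (nbhs_singleton wd.1).
apply: wedge_pow_multilinear.
rewrite (_ : dform w x = fun V => ext_d w x (row 0 V) (row 1 V)).
  exact/bilinear_multilinear/ext_d_bilinear.
exact/funext/dformE.
Qed.

Section PointwiseModel.
Variables (R : realType) (m n : nat) (x : 'rV[R]_m).
Variables (a a1 eta : form R m 1).
(* The values at [x] of the pull-backs of beta, nu, d rho, d theta, d beta. *)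
Variables (B N de ta : 'rV[R]_m -> R) (dB : 'rV[R]_m -> 'rV[R]_m -> R).
(* The values at [x] of the profile functions and of their derivatives. *)
Variables (f f' g g' h h' k k' e c t : R).
Variables (Rv Tv : 'rV[R]_m).

Hypotheses (Bl : scalar B) (Nl : scalar N) (del : scalar de) (tal : scalar ta).
Hypothesis dBl : bilinear_form dB.
Hypotheses (BR : B Rv = 1) (NR : N Rv = 0) (deR : de Rv = 0) (taR : ta Rv = 0).
Hypotheses (dBR : forall v, dB Rv v = 0) (dBR' : forall v, dB v Rv = 0).
Hypotheses (BT : B Tv = 0) (NT : N Tv = 0) (deT : de Tv = 0) (taT : ta Tv = 1).
Hypotheses (dBT : forall v, dB Tv v = 0) (dBT' : forall v, dB v Tv = 0).

Hypothesis aE : forall v, a x v = f * B v + g * ta v.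
Hypothesis daE : forall u v, ext_d a x u v =
  f' * (de u * B v - de v * B u) + f * dB u v
  + g' * (de u * ta v - de v * ta u).

(** If [f g' = f' g], the vector [f d/dtheta - g R], [R] the Reeb field of
    beta, lies in the kernels of [a] and [da]. *)
Lemma model_wronskian_neq0 :
  m = (1 + n * 2)%N -> f != 0 ->
  (exists V, wedge a (wedge_pow (dform a) n) x V <> 0) ->
  f * g' - f' * g != 0.
Proof.
move=> mn f0 [V V0]; apply/negP => /eqP W0; apply: V0.
pose r := (- g) *: Rv + f *: Tv.
have Br : B r = - g by rewrite Bl (scalar_funZ _ _ Bl) BR BT mulr0 addr0 mulr1.
have der : de r = 0 by rewrite del (scalar_funZ _ _ del) deR deT !mulr0 addr0.
have tar : ta r = f by rewrite tal (scalar_funZ _ _ tal) taR taT mulr0 add0r mulr1.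
have [dBl1 dBl2] := dBl.
have dBr v : dB r v = 0.
  by rewrite dBl1 (scalar_funZ _ _ (dBl1 v)) dBR dBT !mulr0 addr0.
have dBr' v : dB v r = 0.
  by rewrite dBl2 (scalar_funZ _ _ (dBl2 v)) dBR' dBT' !mulr0 addr0.
apply: (@wedge_top_kernel0 _ _ _ _ _ _ (ext_d a x) r) => //.
- by move=> d u v; rewrite !aE Bl tal; ring.
- by move=> U; exact: dformE.
- split=> u d v v'; rewrite !daE del Bl tal; first by rewrite dBl1; ring.
  by rewrite dBl2; ring.
- by apply: contraNneq f0 => r0; rewrite -tar r0 scalar_fun0.
- by rewrite aE Br tar; ring.
- by move=> v; rewrite daE dBr der Br tar; transitivity (- de v * (f * g' - f' * g));
    [ring|rewrite W0 mulr0].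
- by move=> v; rewrite daE dBr' der Br tar; transitivity (de v * (f * g' - f' * g));
    [ring|rewrite W0 mulr0].
Qed.

Hypothesis a1E : forall v, a1 x v = h * N v + k * ta v + e * de v.
Hypothesis da1E : forall u v, ext_d a1 x u v =
  h' * (de u * N v - de v * N u) + k' * (de u * ta v - de v * ta u).

Hypothesis etaE : forall v, eta x v = c * a x v + t * a1 x v.
Hypothesis detaE : forall u v, ext_d eta x u v =
  c * ext_d a x u v + t * ext_d a1 x u v.

Let w := c * f * (c * g' + t * k') - c * f' * (c * g + t * k).

(** Adding to each vector [v] a combination of the Reeb field and of
    [d/dtheta] turns [eta] into [c a] and [d eta] into [c da]; the two
    coefficients solve a linear system of determinant [w]. *)
Lemma model_contact V :
  w != 0 -> exists Phi : 'rV[R]_m -> 'rV[R]_m,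
  wedge eta (wedge_pow (dform eta) n) x (map_rows Phi V) =
  c * c ^+ n * wedge a (wedge_pow (dform a) n) x V.
Proof.
move=> w0.
pose p v := - (t * (k * ta v + h * N v + e * de v)).
pose q v := - (t * (k' * ta v + h' * N v)).
pose X v := (p v * (c * g' + t * k') - q v * (c * g + t * k)) / w.
pose Y v := (c * f * q v - c * f' * p v) / w.
have eq1 v : c * f * X v + (c * g + t * k) * Y v = p v.
  rewrite -[RHS]mulr1 -(divff w0) /X /Y; move: w^-1 => wi; rewrite /w; ring.
have eq2 v : c * f' * X v + (c * g' + t * k') * Y v = q v.
  rewrite -[RHS]mulr1 -(divff w0) /X /Y; move: w^-1 => wi; rewrite /w; ring.
pose Phi v := X v *: Rv + (Y v *: Tv + v).
exists Phi.
have BP v : B (Phi v) = B v + X v by rewrite /Phi !Bl BR BT; ring.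
have NP v : N (Phi v) = N v by rewrite /Phi !Nl NR NT; ring.
have deP v : de (Phi v) = de v by rewrite /Phi !del deR deT; ring.
have taP v : ta (Phi v) = ta v + Y v by rewrite /Phi !tal taR taT; ring.
have [dBl1 dBl2] := dBl.
have dBP u v : dB (Phi u) (Phi v) = dB u v.
  rewrite {1}/Phi !dBl1 dBR dBT /Phi !dBl2 dBR' dBT'; ring.
rewrite -(wedge_scale c (c ^+ n) a).
transitivity (wedge (fun y U => c * a y U)
    (wedge_pow (fun y U => c * dform a y U) n) x V); last first.
  by apply: eq_wedge => // W; exact: wedge_pow_scale.
have aP v : eta x (Phi v) = c * a x v.
  rewrite etaE aE a1E BP NP deP taP aE.
  transitivity (c * f * B v + c * g * ta v + (c * f * X v + (c * g + t * k) * Y v)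
     + t * (k * ta v + h * N v + e * de v)); first by ring.
  by rewrite eq1 /p; ring.
have daP u v : ext_d eta x (Phi u) (Phi v) = c * ext_d a x u v.
  rewrite detaE !daE da1E !BP !NP !deP !taP dBP.
  transitivity (c * (f' * (de u * B v - de v * B u) + f * dB u v
     + g' * (de u * ta v - de v * ta u))
    + de u * (c * f' * X v + (c * g' + t * k') * Y v)
    - de v * (c * f' * X u + (c * g' + t * k') * Y u)
    + t * (h' * (de u * N v - de v * N u) + k' * (de u * ta v - de v * ta u))).
    by ring.
  by rewrite !eq2 /q; ring.
apply: wedge_map_rows => [W|].
  have row0 (D : 'M[R]_(1, m)) : D = row 0 D by apply/rowP => i; rewrite mxE.
  by rewrite (row0 (map_rows _ _)) row_map_rows aP -row0.
apply: wedge_pow_map_rows => W.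
by rewrite !dformE !row_map_rows daP.
Qed.

End PointwiseModel.

(** * Forms on the plane *)

Section PlanarForms.
Variable R : realType.
Implicit Types (z v a b : 'rV[R]_2).

Lemma smooth_on_local m (W : normedModType R) (U : set 'rV[R]_m)
    (f : 'rV[R]_m -> W) :
  (forall x, U x -> exists2 U', U' x & smooth_on U' f) -> smooth_on U f.
Proof. by move=> loc x /loc[U' U'x fs]; exact: fs. Qed.

Lemma smooth_on_id_coord m (U : set 'rV[R]_m) j : open U ->
  smooth_on U (fun z : 'rV[R]_m => z 0 j : R^o).
Proof.
move=> oU; apply: (@smooth_on_coord _ _ _ _ id) => //.
by apply: (smooth_on_linear (L := idfun)) => // x; exact: cvg_id.
Qed.

Lemma is_derive_coord m (z v : 'rV[R]_m) j :
  is_derive z v (fun y : 'rV[R]_m => y 0 j : R^o) (v 0 j).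
Proof.
have cd : differentiable (fun y : 'rV[R]_m => y 0 j : R^o) z.
  exact: differentiable_coord.
split; first exact: diff_derivable.
have idd : differentiable (id : 'rV[R]_m -> 'rV[R]_m) z by exact: ex_diff.
by rewrite -(derive_coord v j idd) -deriveE // derive_id.
Qed.

Definition drho_form : form R 2 1 :=
  fun z v => 2 * (z 0 0 * v 0 0 + z 0 1 * v 0 1).

(** The smooth form [rho d theta]. *)
Definition cross_form : form R 2 1 := fun z v => z 0 0 * v 0 1 - z 0 1 * v 0 0.

Lemma sqr_radius_smooth U : open U -> smooth_on U (@sqr_radius R : _ -> R^o).
Proof.
move=> oU; have c j := smooth_on_id_coord j oU.
by apply: (smooth_onD oU (smooth_onM oU (c 0) (c 0)) (smooth_onM oU (c 1) (c 1))).
Qed.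

Lemma sqr_radius_differentiable z : differentiable (@sqr_radius R : _ -> R^o) z.
Proof. exact: (smooth_on_differentiable (sqr_radius_smooth openT)). Qed.

Lemma derive_sqr_radius z v :
  'D_v (@sqr_radius R : _ -> R^o) z = drho_form z v.
Proof.
have c j := @is_derive_coord 2 z v j.
have [_ +] := is_deriveD (is_deriveM (c 0) (c 0)) (is_deriveM (c 1) (c 1)).
move=> H; transitivity (z 0 0 *: v 0 0 + z 0 0 *: v 0 0
  + (z 0 1 *: v 0 1 + z 0 1 *: v 0 1)).
  by rewrite -H; congr ('D_v _ z).
by rewrite /drho_form /GRing.scale /=; ring.
Qed.

Lemma scalar_plane (p q : R) : scalar (fun v : 'rV[R]_2 => p * v 0 0 + q * v 0 1).
Proof. by move=> c u v; rewrite !mxE; ring. Qed.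

Lemma smooth_form_plane U (p q : 'rV[R]_2 -> R) w : open U ->
  smooth_on U (p : _ -> R^o) -> smooth_on U (q : _ -> R^o) ->
  (forall z v, w z v = p z * v 0 0 + q z * v 0 1) -> smooth_form U w.
Proof.
move=> oU ps qs wE; split=> [z Uz c u v|v]; first by rewrite !wE scalar_plane.
have -> : (fun z => w z v : R^o) = fun z => p z * v 0 0 + q z * v 0 1.
  by apply/funext => z; exact: wE.
by apply: smooth_onD => //; apply: smooth_onM => //; exact: smooth_on_cst.
Qed.

Lemma drho_smooth U : open U -> smooth_form U drho_form.
Proof.
move=> oU; have c j := smooth_on_id_coord j oU.
have k : smooth_on U (fun _ => 2 : R^o) by exact: smooth_on_cst.
apply: (smooth_form_plane oU (smooth_onM oU k (c 0)) (smooth_onM oU k (c 1))).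
by move=> z v; rewrite /drho_form; ring.
Qed.

Lemma cross_smooth U : open U -> smooth_form U cross_form.
Proof.
move=> oU; have c j := smooth_on_id_coord j oU.
have k : smooth_on U (fun _ => -1 : R^o) by exact: smooth_on_cst.
apply: (smooth_form_plane oU (smooth_onM oU k (c 1)) (c 0)).
by move=> z v; rewrite /cross_form; ring.
Qed.

Lemma ext_d_drho z a b : ext_d drho_form z a b = 0.
Proof.
have D u v : 'D_u (fun y => drho_form y v : R^o) z =
    2 * (u 0 0 * v 0 0 + u 0 1 * v 0 1).
  have c j := @is_derive_coord 2 z u j.
  have [_ +] := is_deriveZ 2 (is_deriveD (is_deriveZ (v 0 0) (c 0)) (is_deriveZ (v 0 1) (c 1))).
  rewrite /GRing.scale /= => H; rewrite [u 0 0 * _]mulrC [u 0 1 * _]mulrC -H.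
  congr ('D_u _ z); apply/funext => y; rewrite /drho_form /=.
  by rewrite [y 0 0 * _]mulrC [y 0 1 * _]mulrC.
by rewrite /ext_d !D; ring.
Qed.

Lemma ext_d_cross z a b :
  ext_d cross_form z a b = 2 * (a 0 0 * b 0 1 - a 0 1 * b 0 0).
Proof.
have D u v : 'D_u (fun y => cross_form y v : R^o) z =
    u 0 0 * v 0 1 - u 0 1 * v 0 0.
  have c j := @is_derive_coord 2 z u j.
  have [_ +] := is_deriveB (is_deriveZ (v 0 1) (c 0)) (is_deriveZ (v 0 0) (c 1)).
  rewrite /GRing.scale /= => H; rewrite [u 0 0 * _]mulrC [u 0 1 * _]mulrC -H.
  congr ('D_u _ z); apply/funext => y; rewrite /cross_form /=.
  by rewrite [y 0 0 * _]mulrC [y 0 1 * _]mulrC.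
by rewrite /ext_d !D; ring.
Qed.

Lemma open_sqr_radius_neq0 : open [set z : 'rV[R]_2 | sqr_radius z != 0].
Proof.
apply: (@open_comp _ _ (@sqr_radius R) [set r | r != 0]).
  move=> z _; exact: (differentiable_continuous (sqr_radius_differentiable z)).
exact: open_neq.
Qed.

Lemma sqr_radius_ge0 z : 0 <= sqr_radius z.
Proof. by rewrite addr_ge0 ?sqr_ge0. Qed.

Lemma sqr_radius_eq0 z : sqr_radius z = 0 -> z = 0.
Proof.
move/eqP; rewrite paddr_eq0 ?sqr_ge0 // !sqrf_eq0 => /andP[/eqP z0 /eqP z1].
apply/rowP => j; rewrite mxE; case: j => [[|[|//]] j] /=.
- by rewrite -[RHS]z0; congr (z _ _); apply/val_inj.
- by rewrite -[RHS]z1; congr (z _ _); apply/val_inj.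
Qed.

Lemma angle_smooth (U : set 'rV[R]_2) : open U ->
  (forall z, U z -> sqr_radius z != 0) -> smooth_form U (@angle_form R).
Proof.
move=> oU U0; apply: (@smooth_form_eq _ _ _
  (fun z v => (sqr_radius z)^-1 * cross_form z v)) => //.
  by move=> z _ v; rewrite mulrC.
apply: smooth_formM => //; last exact: cross_smooth.
by apply: smooth_onV => //; exact: sqr_radius_smooth.
Qed.

Lemma ext_d_angle z a b : sqr_radius z != 0 -> ext_d (@angle_form R) z a b = 0.
Proof.
move=> z0; have rd := sqr_radius_differentiable z.
rewrite (@ext_d_eq_on _ _ _ _
  (fun z v => (sqr_radius z)^-1 * cross_form z v) _ _ _ openT I); last first.
  by move=> y _ v; rewrite mulrC.
have Vd : differentiable (fun z => (sqr_radius z)^-1 : R^o) z.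
  exact: (@differentiableV _ _ (@sqr_radius R)).
have DV v : 'D_v (fun z => (sqr_radius z)^-1 : R^o) z =
    - (sqr_radius z)^-2 * drho_form z v.
  rewrite (@deriveV _ _ (@sqr_radius R)) //; last exact: diff_derivable.
  by rewrite derive_sqr_radius.
rewrite ext_dM //; last exact: (smooth_form_differentiable openT (cross_smooth openT)).
rewrite !DV ext_d_cross /drho_form /cross_form; move: z0.
by rewrite /sqr_radius => z0; field.
Qed.

Lemma open_sqr_radius_lt (r : R) : open [set z : 'rV[R]_2 | sqr_radius z < r].
Proof.
apply: (@open_comp _ _ (@sqr_radius R) [set s | s < r]); last exact: open_lt.
move=> z _; exact: (differentiable_continuous (sqr_radius_differentiable z)).
Qed.

(** The angular part [g d theta] of an axisymmetric form. *)
Definition twist_form (g : R -> R) : form R 2 1 :=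
  fun z v => g (sqr_radius z) * angle_form z v.

Lemma ext_d_twist (g : R -> R) z a b : sqr_radius z != 0 ->
  derivable (g : R -> R^o) (sqr_radius z) 1 ->
  ext_d (twist_form g) z a b = derive1 (g : R -> R^o) (sqr_radius z) *
    (drho_form z a * angle_form z b - drho_form z b * angle_form z a).
Proof.
move=> z0 gd; have rd := sqr_radius_differentiable z.
have [hd _] := derive_fun_comp a gd rd.
have Dg v := (derive_fun_comp v gd rd).2.
have ad : differentiable_form (@angle_form R) z.
  exact: (smooth_form_differentiable open_sqr_radius_neq0
    (angle_smooth open_sqr_radius_neq0 (fun _ => id))).
rewrite (@ext_dM _ _ (g \o @sqr_radius R) _ _ _ _ hd ad) ext_d_angle // !Dg.
by rewrite !derive_sqr_radius; ring.
Qed.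

(** The planar part of the limit form. *)
Definition planar_form : form R 2 1 := fun z v =>
  twist_form (@theta_profile R) z v + rho_profile (sqr_radius z) * drho_form z v.

Lemma cutoff_comp_smooth (U : set 'rV[R]_2) (f : 'rV[R]_2 -> R^o) : open U ->
  smooth_on U f -> smooth_on U (fun z => cutoff (f z) : R^o).
Proof. by move=> oU; apply: smooth_on_fun => //; exact: flat_smooth. Qed.

Lemma cst_sub_smooth (U : set 'rV[R]_2) (c : R) (f : 'rV[R]_2 -> R^o) : open U ->
  smooth_on U f -> smooth_on U (fun z => c - f z : R^o).
Proof.
move=> oU fs; apply: (@smooth_on_eq _ _ _ _ (fun z => c + (-1) * f z : R^o)) => //.
  by move=> z _; rewrite mulN1r.
apply: smooth_onD => //; first exact: smooth_on_cst.
by apply: smooth_onM => //; exact: smooth_on_cst.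
Qed.

Lemma nu_profile_smooth U : open U ->
  smooth_on U (fun z : 'rV[R]_2 => nu_profile (sqr_radius z) : R^o).
Proof.
by move=> oU; apply: cutoff_comp_smooth => //; apply: cst_sub_smooth => //;
  exact: sqr_radius_smooth.
Qed.

Lemma rho_profile_smooth U : open U ->
  smooth_on U (fun z : 'rV[R]_2 => rho_profile (sqr_radius z) : R^o).
Proof.
by move=> oU; apply: cutoff_comp_smooth => //; apply: cst_sub_smooth => //;
  exact: sqr_radius_smooth.
Qed.

Lemma theta_profile_smooth U : open U ->
  smooth_on U (fun z : 'rV[R]_2 => theta_profile (sqr_radius z) : R^o).
Proof.
move=> oU; apply: smooth_onM => //; last exact: smooth_on_cst.
apply: cutoff_comp_smooth => //; apply: cst_sub_smooth => //.
exact: rho_profile_smooth.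
Qed.

(** Near the origin, where the angular form is singular, [theta_profile]
    vanishes identically. *)
Lemma twist_theta_smooth :
  smooth_form setT (twist_form (@theta_profile R)).
Proof.
pose U1 := [set z : 'rV[R]_2 | sqr_radius z < 2^-1].
have oU1 : open U1 by exact: open_sqr_radius_lt.
have s1 : smooth_form U1 (twist_form (@theta_profile R)).
  apply: (@smooth_form_eq _ _ _ (fun _ _ => 0)) => //.
    by move=> z /ltW zr v; rewrite /twist_form theta_profile0 // mul0r.
  split=> [z _ c u v|v]; first by rewrite mulr0 addr0.
  exact: smooth_on_cst.
have s2 : smooth_form [set z : 'rV[R]_2 | sqr_radius z != 0]
    (twist_form (@theta_profile R)).
  apply: smooth_formM; first exact: open_sqr_radius_neq0.
    by apply: theta_profile_smooth; exact: open_sqr_radius_neq0.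
  by apply: angle_smooth => //; exact: open_sqr_radius_neq0.
have cover z : U1 z \/ sqr_radius z != 0.
  have [z0|] := eqVneq (sqr_radius z) 0; last by right.
  by left; rewrite /U1 /= z0 invr_gt0.
split=> [z _|v]; first by case: (cover z); [exact: s1.1|exact: s2.1].
apply: smooth_on_local => z _; case: (cover z) => Uz.
  by exists U1 => //; exact: s1.2.
by exists [set z | sqr_radius z != 0] => //; exact: s2.2.
Qed.

Lemma planar_smooth : smooth_form setT planar_form.
Proof.
apply: smooth_formD; [exact: openT|exact: twist_theta_smooth|].
apply: smooth_formM; [exact: openT| |exact: drho_smooth openT].
exact: rho_profile_smooth openT.
Qed.

(** The radial part is closed; at the origin both sides vanish, since
    [theta_profile] is locally 0. *)
Lemma ext_d_planar z a b :
  ext_d planar_form z a b = derive1 (@theta_profile R : R -> R^o) (sqr_radius z) *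
    (drho_form z a * angle_form z b - drho_form z b * angle_form z a).
Proof.
have rd := sqr_radius_differentiable z.
have td := smooth_form_differentiable openT twist_theta_smooth (I : setT z).
have dd := smooth_form_differentiable openT (drho_smooth openT) (I : setT z).
have pdd : derivable (@rho_profile R : R -> R^o) (sqr_radius z) 1.
  by have [] := is_derive_cutoff_sub (3 / 4) (sqr_radius z).
have [hd _] := derive_fun_comp a pdd rd.
have Dr v := (derive_fun_comp v pdd rd).2.
have rdd : differentiable_form (fun z v =>
    rho_profile (sqr_radius z) * drho_form z v) z.
  apply: (smooth_form_differentiable openT) => //.
  apply: smooth_formM; [exact: openT| |exact: drho_smooth openT].
  exact: rho_profile_smooth openT.
rewrite (ext_dD _ _ td rdd).
rewrite (@ext_dM _ _ (@rho_profile R \o @sqr_radius R) _ _ _ _ hd dd) ext_d_drho.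
rewrite !Dr !derive_sqr_radius.
set S := _ * drho_form z a * _ - _ + _.
have -> : S = 0 by rewrite /S; ring.
rewrite addr0; have [d dE [_ d0]] := is_derive_theta_profile (sqr_radius z).
have [z0|z0] := eqVneq (sqr_radius z) 0; last first.
  by rewrite ext_d_twist //; have [] := dE.
rewrite derive1E; have [_ ->] := dE; rewrite d0 ?z0 ?invr_ge0 // mul0r.
have Uz : [set z : 'rV[R]_2 | sqr_radius z < 2^-1] z by rewrite /= z0 invr_gt0.
rewrite (ext_d_eq_on (w' := fun _ _ => 0) _ _ (open_sqr_radius_lt (r := 2^-1)) Uz).
  by rewrite /ext_d !derive_cst subrr.
by move=> y /ltW yr v; rewrite /twist_form theta_profile0 // mul0r.
Qed.

(** A radial component of the vector does not contribute, and the form is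
    homogeneous of degree 0. *)
Lemma angle_scale c (s : R) z v : c != 0 ->
  angle_form (c *: z) (s *: z + c *: v) = angle_form z v.
Proof.
move=> c0; rewrite /angle_form /sqr_radius !mxE.
have -> : (c * z 0 0) ^+ 2 + (c * z 0 1) ^+ 2 =
  c ^+ 2 * (z 0 0 ^+ 2 + z 0 1 ^+ 2) by ring.
have [->|r0] := eqVneq (z 0 0 ^+ 2 + z 0 1 ^+ 2) 0.
  by rewrite mulr0 invr0 !mulr0.
by field; rewrite r0.
Qed.

(** The vector d/dtheta. *)
Definition quarter_turn z : 'rV[R]_2 := \row_j (if j == 0 then - z 0 1 else z 0 0).

Lemma drho_quarter_turn z : drho_form z (quarter_turn z) = 0.
Proof. by rewrite /drho_form !mxE /=; ring. Qed.

Lemma angle_quarter_turn z : sqr_radius z != 0 -> angle_form z (quarter_turn z) = 1.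
Proof.
by move=> z0; rewrite /angle_form !mxE /= mulrN opprK -!expr2; exact: divff.
Qed.

Lemma drho_self z : drho_form z z = 2 * sqr_radius z.
Proof. by rewrite /drho_form /sqr_radius; ring. Qed.

Lemma angle_self z : angle_form z z = 0.
Proof. by rewrite /angle_form [z 0 1 * _]mulrC subrr mul0r. Qed.

Lemma drho_form0 v : drho_form 0 v = 0.
Proof. by rewrite /drho_form !mxE !mul0r addr0 mulr0. Qed.

Lemma angle_scalar z : scalar (@angle_form R z).
Proof. by move=> c u v; rewrite /angle_form !mxE; ring. Qed.

Lemma drho_scalar z : scalar (drho_form z).
Proof. by move=> c u v; rewrite /drho_form !mxE; ring. Qed.

End PlanarForms.

(** * The tube in a chart *)

Lemma row_mx1E (R : realType) m (D : 'M[R]_(1, m)) : D = row 0 D.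
Proof. by apply/rowP => i; rewrite mxE. Qed.

(** Where [da1] vanishes and [Rv] spans a Reeb direction of [a] in the kernel
    of [a1], a multiple of [Rv] corrects [c a + t a1] into [c a]. *)
Lemma binding_contact (R : realType) (m n : nat) (x : 'rV[R]_m)
    (a a1 eta : form R m 1) (f c t : R) (Rv : 'rV[R]_m) V :
  scalar (a x) -> scalar (a1 x) -> bilinear_form (ext_d a x) ->
  c * f != 0 -> a x Rv = f -> a1 x Rv = 0 -> (forall v, ext_d a x Rv v = 0) ->
  (forall v, eta x v = c * a x v + t * a1 x v) ->
  (forall u v, ext_d eta x u v = c * ext_d a x u v) ->
  exists Phi : 'rV[R]_m -> 'rV[R]_m,
  wedge eta (wedge_pow (dform eta) n) x (map_rows Phi V) =
  c * c ^+ n * wedge a (wedge_pow (dform a) n) x V.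
Proof.
move=> al a1l [dal dar] f0 aR a1R daR etaE detaE.
have daR' v : ext_d a x v Rv = 0 by rewrite ext_d_anti daR oppr0.
pose Phi v := (- (t * a1 x v) / (c * f)) *: Rv + v.
exists Phi.
rewrite -(wedge_scale c (c ^+ n) a).
transitivity (wedge (fun y U => c * a y U)
    (wedge_pow (fun y U => c * dform a y U) n) x V); last first.
  by apply: eq_wedge => // W; exact: wedge_pow_scale.
apply: wedge_map_rows => [W|].
  rewrite (row_mx1E (map_rows _ _)) row_map_rows {2}(row_mx1E W).
  rewrite etaE /Phi al a1l aR a1R mulr0 add0r mulrDr mulrCA.
  rewrite [X in _ * X]mulrC mulrCA -!mulrA (mulrCA f) mulrA.
  rewrite -[X in X + _ + _](_ : - (t * a1 x (row 0 W)) / (c * f) * (c * f) = _).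
    by rewrite divfK //; ring.
  by ring.
apply: wedge_pow_map_rows => W.
rewrite !dformE !row_map_rows detaE /Phi.
by rewrite dal daR mulr0 add0r dar daR' mulr0 add0r.
Qed.

(** The tubular neighbourhood read in a chart of the manifold: [F] gives the
    coordinates in N, through [FX], and in the disk, through [FZ]; [lift] is a
    right inverse of the differential of [F] at [x]. The form [a] is the axisymmetric
    normal form and [a1] is the candidate for the limit. *)
Section LocalModel.
Variables (R : realType) (n m k : nat).
Hypothesis mn : m = (1 + n * 2)%N.
Variables (U : set 'rV[R]_m) (V : set 'rV[R]_k) (F : 'rV[R]_m -> 'rV[R]_(k + 2)).
Variables (x : 'rV[R]_m) (lift : 'rV[R]_(k + 2) -> 'rV[R]_m).
Hypotheses (oU : open U) (oV : open V) (Ux : U x) (Fs : smooth_on U F).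
Hypothesis liftK : forall w, 'd F x (lift w) = w.

Let FX y := lsubmx (F y).
Let FZ y := rsubmx (F y).
Hypothesis FV : forall y, U y -> V (FX y).

Variables (beta nu : form R k 1) (a a1 : form R m 1) (f0 g0 : R -> R).
Hypotheses (betas : smooth_form V beta) (nus : smooth_form V nu).
Hypothesis as_ : smooth_form U a.
Hypothesis aE : forall y, U y -> forall v,
  a y v = f0 (sqr_radius (FZ y)) * pull FX beta y v
          + pull FZ (twist_form g0) y v.
Hypothesis a1E : forall y, U y -> forall v,
  a1 y v = nu_profile (sqr_radius (FZ y)) * pull FX nu y v
           + pull FZ (@planar_form R) y v.
Hypothesis twist_diff : forall w,
  differentiable (fun z => twist_form g0 z w : R^o) (FZ x).

Let z := FZ x.
Let r := sqr_radius z.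
Hypothesis r_lt1 : r < 1.

Hypothesis f0s : smooth_fun f0.
Hypothesis f0_gt0 : forall r, 0 <= r <= 1 -> 0 < f0 r.
Hypothesis f0_decr : forall r s, 0 <= r -> r < s -> s <= 1 -> f0 s < f0 r.
Hypothesis g0s : smooth_fun g0.
Hypothesis g0_ge0 : forall r, 0 <= r <= 1 -> 0 <= g0 r.
Hypothesis g0_incr : forall r s, 0 <= r -> r <= s -> s <= 1 -> g0 r <= g0 s.

Variable rv : 'rV[R]_k.
Hypotheses (beta_rv : beta (FX x) rv = 1) (nu_rv : nu (FX x) rv = 0).
Hypothesis dbeta_rv : forall v, ext_d beta (FX x) rv v = 0.
Hypothesis nu_neq0 : exists v, nu (FX x) v != 0.
Hypothesis dnu0 : forall u v, ext_d nu (FX x) u v = 0.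
Hypothesis a_contact : exists V, wedge a (wedge_pow (dform a) n) x V <> 0.

Let Fd : differentiable F x := smooth_on_differentiable Fs Ux.

Lemma lsubmx_smooth : smooth_on U FX.
Proof.
apply: (@smooth_on_postlinear _ _ _ _ U (lsubmx : {linear _ -> _})) => //.
exact: continuous_lsubmx.
Qed.

Lemma rsubmx_smooth : smooth_on U FZ.
Proof.
apply: (@smooth_on_postlinear _ _ _ _ U (rsubmx : {linear _ -> _})) => //.
exact: continuous_rsubmx.
Qed.

Let dX v := lsubmx ('d F x v).
Let dZ v := rsubmx ('d F x v).

Lemma diff_lsubmx v : 'd FX x v = dX v.
Proof.
rewrite (@diff_comp _ _ _ _ F lsubmx) //; last exact: differentiable_lsubmx.
by rewrite /= (@diff_lin _ _ _ lsubmx) //; exact: continuous_lsubmx.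
Qed.

Lemma diff_rsubmx v : 'd FZ x v = dZ v.
Proof.
rewrite (@diff_comp _ _ _ _ F rsubmx) //; last exact: differentiable_rsubmx.
by rewrite /= (@diff_lin _ _ _ rsubmx) //; exact: continuous_rsubmx.
Qed.

(* The pull-backs to the tangent space at [x] of beta, nu, d rho, d theta and
   d beta. *)
Let B v := beta (FX x) (dX v).
Let N v := nu (FX x) (dX v).
Let de v := drho_form z (dZ v).
Let ta v := angle_form z (dZ v).
Let dB u v := ext_d beta (FX x) (dX u) (dX v).

Lemma dX_linear : linear dX.
Proof. by move=> c u v; rewrite /dX linearP linearP. Qed.

Lemma dZ_linear : linear dZ.
Proof. by move=> c u v; rewrite /dZ linearP linearP. Qed.

Lemma B_scalar : scalar B.
Proof. by move=> c u v; rewrite /B dX_linear (betas.1 _ (FV Ux)). Qed.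

Lemma N_scalar : scalar N.
Proof. by move=> c u v; rewrite /N dX_linear (nus.1 _ (FV Ux)). Qed.

Lemma de_scalar : scalar de.
Proof. by move=> c u v; rewrite /de dZ_linear drho_scalar. Qed.

Lemma ta_scalar : scalar ta.
Proof. by move=> c u v; rewrite /ta dZ_linear angle_scalar. Qed.

Let beta_diff := smooth_form_differentiable oV betas (FV Ux).
Let nu_diff := smooth_form_differentiable oV nus (FV Ux).

Lemma dB_bilinear : bilinear_form dB.
Proof.
have [l1 l2] := ext_d_bilinear beta_diff.
by split=> v c u u'; rewrite /dB dX_linear ?l1 ?l2.
Qed.

(* Lifts of the Reeb vector of beta and of d/dtheta. *)
Let Rv := lift (row_mx rv 0).
Let Tv := lift (row_mx 0 (quarter_turn z)).

Lemma dXR : dX Rv = rv. Proof. by rewrite /dX liftK row_mxKl. Qed.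
Lemma dZR : dZ Rv = 0. Proof. by rewrite /dZ liftK row_mxKr. Qed.
Lemma dXT : dX Tv = 0. Proof. by rewrite /dX liftK row_mxKl. Qed.

Lemma B_R : B Rv = 1. Proof. by rewrite /B dXR. Qed.
Lemma N_R : N Rv = 0. Proof. by rewrite /N dXR. Qed.
Lemma de_R : de Rv = 0.
Proof. by rewrite /de dZR (scalar_fun0 (drho_scalar z)). Qed.
Lemma ta_R : ta Rv = 0.
Proof. by rewrite /ta dZR (scalar_fun0 (angle_scalar z)). Qed.
Lemma dB_R v : dB Rv v = 0. Proof. by rewrite /dB dXR. Qed.
Lemma dB_R' v : dB v Rv = 0.
Proof. by rewrite /dB ext_d_anti dXR dbeta_rv oppr0. Qed.
Lemma B_T : B Tv = 0.
Proof. by rewrite /B dXT (scalar_fun0 (betas.1 _ (FV Ux))). Qed.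
Lemma N_T : N Tv = 0.
Proof. by rewrite /N dXT (scalar_fun0 (nus.1 _ (FV Ux))). Qed.
Lemma de_T : de Tv = 0.
Proof. by rewrite /de /dZ liftK row_mxKr drho_quarter_turn. Qed.
Lemma ta_T : r != 0 -> ta Tv = 1.
Proof.
by move=> r0; rewrite /ta /dZ liftK row_mxKr; exact: angle_quarter_turn.
Qed.
Lemma dB_T v : dB Tv v = 0.
Proof. by rewrite /dB dXT (scalar_fun0 ((ext_d_bilinear beta_diff).1 _)). Qed.
Lemma dB_T' v : dB v Tv = 0.
Proof. by rewrite /dB ext_d_anti -/(dB Tv v) dB_T oppr0. Qed.

Lemma a_at v : a x v = f0 r * B v + g0 r * ta v.
Proof. by rewrite aE // !pullE diff_lsubmx diff_rsubmx. Qed.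

Lemma a1_at v : a1 x v =
  nu_profile r * N v + theta_profile r * ta v + rho_profile r * de v.
Proof. by rewrite a1E // !pullE diff_lsubmx diff_rsubmx /planar_form addrA. Qed.

Lemma radial_derive (h : R -> R) v : derivable (h : R -> R^o) r 1 ->
  differentiable (fun y => h (sqr_radius (FZ y)) : R^o) x /\
  'D_v (fun y => h (sqr_radius (FZ y)) : R^o) x = derive1 (h : R -> R^o) r * de v.
Proof.
move=> hd; have Zd := smooth_on_differentiable rsubmx_smooth Ux.
have rd := sqr_radius_differentiable z.
have rZd : differentiable (@sqr_radius R \o FZ : _ -> R^o) x.
  exact: differentiable_comp.
have [d ->] := derive_fun_comp v (hd : derivable _ ((@sqr_radius R \o FZ) x) _) rZd.
split => //; congr (_ * _); rewrite deriveE // diff_comp //= diff_rsubmx.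
by rewrite -deriveE // derive_sqr_radius.
Qed.

Lemma smooth_fun_derivable (h : R -> R) s :
  smooth_fun h -> derivable (h : R -> R^o) s 1.
Proof. by move=> hs; exact: (hs 0%N). Qed.

Let pull_beta_smooth : smooth_form U (pull FX beta).
Proof. exact: smooth_form_pull lsubmx_smooth FV betas. Qed.

Let pull_nu_smooth : smooth_form U (pull FX nu).
Proof. exact: smooth_form_pull lsubmx_smooth FV nus. Qed.

Lemma radial_smooth h : smooth_fun h ->
  smooth_on U (fun y => h (sqr_radius (FZ y)) : R^o).
Proof.
move=> hs; apply: (smooth_on_comp (V := setT)
  (f := fun z => h (sqr_radius z) : R^o) oU rsubmx_smooth (fun _ _ => I)).
by apply: (smooth_on_fun openT hs); exact: sqr_radius_smooth openT.
Qed.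

Lemma local_smooth : smooth_form U a1.
Proof.
apply: (@smooth_form_eq _ _ _ (fun y v =>
    nu_profile (sqr_radius (FZ y)) * pull FX nu y v
           + pull FZ (@planar_form R) y v)) => //.
  by move=> y Uy v; rewrite a1E.
apply: smooth_formD => //.
  apply: smooth_formM => //.
  exact: (smooth_on_comp (V := setT) oU rsubmx_smooth (fun _ _ => I) (@nu_profile_smooth R setT openT)).
exact: (smooth_form_pull (V := setT) oU rsubmx_smooth (fun _ _ => I) (planar_smooth R)).
Qed.

Lemma ext_d_a u v : ext_d a x u v =
  derive1 (f0 : R -> R^o) r * (de u * B v - de v * B u) + f0 r * dB u v
  + ext_d (twist_form g0) z (dZ u) (dZ v).
Proof.
have f0d := fun v => radial_derive v (@smooth_fun_derivable f0 r f0s).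
have bd := smooth_form_differentiable oU pull_beta_smooth Ux.
have fbs : smooth_form U (fun y v =>
    f0 (sqr_radius (FZ y)) * pull FX beta y v).
  by apply: smooth_formM => //; exact: radial_smooth.
have ts : smooth_form U (pull FZ (twist_form g0)).
  apply: (@smooth_form_eq _ _ _ (fun y v => a y v +
      -1 * (f0 (sqr_radius (FZ y)) * pull FX beta y v))) => //.
    by move=> y Uy w; rewrite aE //; ring.
  apply: smooth_formD => //.
  by apply: smooth_formM => //; exact: smooth_on_cst.
rewrite (ext_d_eq_on _ _ oU Ux aE).
rewrite (ext_dD _ _ (smooth_form_differentiable oU fbs Ux)
  (smooth_form_differentiable oU ts Ux)).
rewrite (ext_dM _ _ (f0d u).1 bd) !(f0d _).2.
rewrite (ext_d_pull _ _ oU lsubmx_smooth Ux beta_diff).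
rewrite (@ext_d_pull _ _ _ _ FZ _ _ _ _ oU rsubmx_smooth Ux); last first.
  split; last exact: twist_diff.
  by near=> y; move=> c w w'; rewrite /twist_form angle_scalar; ring.
rewrite !pullE !diff_lsubmx !diff_rsubmx -/(B u) -/(B v) -/(dB u v) -/r -/z; ring.
Unshelve. all: by end_near. Qed.

Lemma ext_d_a1 u v : ext_d a1 x u v =
  derive1 (@nu_profile R : R -> R^o) r * (de u * N v - de v * N u)
  + derive1 (@theta_profile R : R -> R^o) r * (de u * ta v - de v * ta u).
Proof.
have nd : derivable (@nu_profile R : R -> R^o) r 1.
  by have [] := is_derive_cutoff_sub 2^-1 r.
have f0d := fun v => radial_derive v nd.
have bd := smooth_form_differentiable oU pull_nu_smooth Ux.
have fbs : smooth_form U (fun y v =>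
    nu_profile (sqr_radius (FZ y)) * pull FX nu y v).
  apply: smooth_formM => //.
  exact: (smooth_on_comp (V := setT) oU rsubmx_smooth (fun _ _ => I) (@nu_profile_smooth R setT openT)).
have ps := smooth_form_pull (V := setT) oU rsubmx_smooth (fun _ _ => I) (planar_smooth R).
have pd := smooth_form_differentiable openT (planar_smooth R) (I : setT (FZ x)).
rewrite (ext_d_eq_on _ _ oU Ux a1E).
rewrite (ext_dD _ _ (smooth_form_differentiable oU fbs Ux)
  (smooth_form_differentiable oU ps Ux)).
rewrite (ext_dM _ _ (f0d u).1 bd) !(f0d _).2.
rewrite (ext_d_pull _ _ oU lsubmx_smooth Ux nu_diff) dnu0.
rewrite (ext_d_pull _ _ oU rsubmx_smooth Ux pd) ext_d_planar.
rewrite !pullE !diff_lsubmx !diff_rsubmx -/(N u) -/(N v) -/r -/z.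
by rewrite -/(de u) -/(de v) -/(ta u) -/(ta v); ring.
Qed.

(** The determinant required by [model_contact] is
    [c ^ 2 (f0 g0' - f0' g0) + c t (f0 h' - f0' h)], [h] being [theta_profile].
    All the terms are non-negative by monotonicity, and the first one is non-zero
    because [a] is contact. On the binding d rho vanishes and [binding_contact]
    applies. *)
Lemma local_contact c t (eta : form R m 1) : 0 < c -> 0 <= t ->
  (forall y v, eta y v = c * a y v + t * a1 y v) ->
  exists V, wedge eta (wedge_pow (dform eta) n) x V <> 0.
Proof.
move=> c0 t0 etaE; have [W W0] := a_contact.
have ad := smooth_form_differentiable oU as_ Ux.
have a1d := smooth_form_differentiable oU local_smooth Ux.
have scal (s : R) (w : form R m 1) : smooth_form U w ->
    differentiable_form (fun y v => s * w y v) x.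
  move=> ws; apply: (smooth_form_differentiable oU) => //.
  by apply: smooth_formM => //; exact: smooth_on_cst.
have detaE u v : ext_d eta x u v = c * ext_d a x u v + t * ext_d a1 x u v.
  rewrite (@ext_d_eq_on _ _ _ _ (fun y v => c * a y v + t * a1 y v) _ _ _ oU Ux).
    by rewrite (ext_dD _ _ (scal c _ as_) (scal t _ local_smooth)) !ext_dZ.
  by move=> y _ w; exact: etaE.
have r01 : 0 <= r <= 1 by rewrite sqr_radius_ge0 ltW.
have f0r := f0_gt0 r01.
suff [Phi PhiE] : exists Phi : 'rV[R]_m -> 'rV[R]_m,
    wedge eta (wedge_pow (dform eta) n) x (map_rows Phi W) =
    c * c ^+ n * wedge a (wedge_pow (dform a) n) x W.
  exists (map_rows Phi W); rewrite PhiE; apply/eqP.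
  apply: mulf_neq0; last exact/eqP.
  by rewrite mulf_neq0 ?expf_neq0 // gt_eqF.
have [r0|r0] := eqVneq r 0.
- have z0 : z = 0 by exact: sqr_radius_eq0.
  have de0 v : de v = 0 by rewrite /de z0 drho_form0.
  apply: (@binding_contact _ _ _ _ _ _ _ (f0 r) _ t Rv).
  + exact: as_.1.
  + exact: local_smooth.1.
  + exact: ext_d_bilinear.
  + by rewrite mulf_neq0 // gt_eqF.
  + by rewrite a_at B_R ta_R mulr1 mulr0 addr0.
  + by rewrite a1_at N_R ta_R de_R !mulr0 !addr0.
  + move=> v; rewrite ext_d_a de_R de0 dB_R dZR.
    rewrite ext_d0l; first by ring.
    by near=> y; move=> d w w'; rewrite /twist_form angle_scalar; ring.
  + by move=> v; exact: etaE.
  + by move=> u v; rewrite detaE ext_d_a1 !de0; ring.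
have r_gt0 : 0 < r by rewrite lt_neqAle eq_sym r0 sqr_radius_ge0.
have f0' : derive1 (f0 : R -> R^o) r <= 0.
  apply: (@decr_derive1_le0_itv _ _ true false 0 1) => //.
  - by move=> s _; exact: smooth_fun_derivable.
  - move=> s s'; rewrite !in_itv /= => /andP[s0 s1] /andP[s0' s1'] ss.
    exact: f0_decr.
  - by rewrite in_itv /= r_gt0.
have g0' : 0 <= derive1 (g0 : R -> R^o) r.
  apply: (@nondecreasing_derive1_ge0 _ _ 0 1) => //; last by rewrite r_gt0.
  by move=> s; exact: smooth_fun_derivable.
have daE u v : ext_d a x u v =
    derive1 (f0 : R -> R^o) r * (de u * B v - de v * B u) + f0 r * dB u v
    + derive1 (g0 : R -> R^o) r * (de u * ta v - de v * ta u).
  by rewrite ext_d_a ext_d_twist //; exact: smooth_fun_derivable.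
have := model_wronskian_neq0 B_scalar de_scalar ta_scalar dB_bilinear B_R
  de_R ta_R dB_R dB_R' B_T de_T (ta_T r0) dB_T dB_T' a_at daE mn
  (lt0r_neq0 f0r) a_contact.
set w := _ - _ => w0.
have w_gt0 : 0 < w.
  rewrite lt_neqAle eq_sym w0 /w subr_ge0.
  apply: (@le_trans _ _ 0); last by rewrite mulr_ge0 // ltW.
  by rewrite mulr_le0_ge0 // g0_ge0.
apply: (model_contact B_scalar N_scalar de_scalar ta_scalar dB_bilinear B_R N_R
  de_R ta_R dB_R dB_R' B_T N_T de_T (ta_T r0) dB_T dB_T' a_at daE a1_at ext_d_a1
  (etaE x) detaE W).
have th' : 0 <= derive1 (@theta_profile R : R -> R^o) r.
  have [d dE [d0 _]] := is_derive_theta_profile r.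
  by rewrite derive1E; have [_ ->] := dE.
have th := theta_profile_ge0 r.
rewrite gt_eqF //; move: w_gt0; rewrite /w.
move: (derive1 (f0 : R -> R^o) r) (derive1 (g0 : R -> R^o) r)
  (derive1 (@theta_profile R : R -> R^o) r) (theta_profile r) f0' g0' th' th.
move: (f0 r) (g0 r) f0r => f g fp f' g' h' h f'n g'n h'p hp wp.
have -> : c * f * (c * g' + t * h') - c * f' * (c * g + t * h) =
  c * c * (f * g' - f' * g) + c * t * (f * h' - f' * h) by ring.
rewrite ltr_wpDr ?mulr_gt0 // mulr_ge0 ?mulr_ge0 ?(ltW c0) // subr_ge0.
by apply: (@le_trans _ _ 0); [rewrite mulr_le0_ge0|rewrite mulr_ge0 // ltW].
Unshelve. all: by end_near. Qed.

(** The form is tested on a vector where nu is non-zero for [rho < 1/2], on the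
    radial vector for [1/2 <= rho < 3/4], and on d/dtheta for [rho = 3/4]. *)
Lemma local_nonzero : r <= 3 / 4 -> exists v, a1 x v <> 0.
Proof.
move=> r34; have r0 := sqr_radius_ge0 z; rewrite -/r in r0.
have [r2|r2] := ltP r 2^-1.
  have [v v0] := nu_neq0; exists (lift (row_mx v 0)); apply/eqP.
  have dZ0 : dZ (lift (row_mx v 0)) = 0 by rewrite /dZ liftK row_mxKr.
  rewrite a1_at /ta /de dZ0 (scalar_fun0 (drho_scalar z)).
  rewrite (scalar_fun0 (angle_scalar z)) !mulr0 !addr0 mulf_neq0 //.
    by rewrite gt_eqF // cutoff_gt0 // subr_gt0.
  by rewrite /N /dX liftK row_mxKl.
have r_neq0 : r != 0 by rewrite gt_eqF // (lt_le_trans _ r2) // invr_gt0.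
have [r3|r3] := ltP r (3 / 4).
  exists (lift (row_mx 0 z)); apply/eqP.
  have dZz : dZ (lift (row_mx 0 z)) = z by rewrite /dZ liftK row_mxKr.
  have -> : a1 x (lift (row_mx 0 z)) = rho_profile r * (2 * r).
    rewrite a1_at /N /ta /de dZz /dX liftK row_mxKl.
    rewrite (scalar_fun0 (nus.1 _ (FV Ux))) angle_self drho_self.
    by rewrite !mulr0 !add0r.
  rewrite !mulf_neq0 // gt_eqF // cutoff_gt0 // subr_gt0 //.
exists Tv; apply/eqP; rewrite a1_at N_T de_T (ta_T r_neq0) theta_profile1 //.
by rewrite !mulr0 add0r addr0 mul1r oner_eq0.
Qed.

(** On either side of [rho = 1/2] one of [nu_profile] and [theta_profile] vanishes
    together with its derivative, so that [a1] and [d a1] only involve d rho and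
    one more closed form. *)
Lemma local_integrable W : wedge a1 (dform a1) x W = 0.
Proof.
have [r2|r2] := leP r 2^-1.
  have [d dE [_ d0]] := is_derive_theta_profile r.
  have th' : derive1 (@theta_profile R : R -> R^o) r = 0.
    by rewrite derive1E; have [_ ->] := dE; exact: d0.
  apply: (@wedge_plane0 _ _ _ _ _ N de (nu_profile r)
    (derive1 (@nu_profile R : R -> R^o) r) (rho_profile r)).
  - by move=> v; rewrite a1_at theta_profile0 // mul0r addr0.
  - by move=> V'; rewrite dformE ext_d_a1 th' mul0r addr0.
have nu0 : nu_profile r = 0 by rewrite /nu_profile cutoff_le0 // subr_le0 ltW.
have nu' : derive1 (@nu_profile R : R -> R^o) r = 0.
  rewrite derive1E; have [_ ->] := is_derive_cutoff_sub 2^-1 r.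
  by rewrite cutoff'_le0 ?oppr0 // subr_le0 ltW.
apply: (@wedge_plane0 _ _ _ _ _ ta de (theta_profile r)
  (derive1 (@theta_profile R : R -> R^o) r) (rho_profile r)).
- by move=> v; rewrite a1_at nu0 mul0r add0r.
- by move=> V'; rewrite dformE ext_d_a1 nu' mul0r add0r.
Qed.

End LocalModel.

(** * Charts and pull-backs *)

Section Charts.
Variable R : realType.

Lemma open_preimage_on (S T : topologicalType) (A : set S) (D : set T)
    (f : S -> T) :
  open A -> (forall p, A p -> {for p, continuous f}) -> open D ->
  open (A `&` f @^-1` D).
Proof.
move=> oA fc oD; rewrite openE => p [Ap fDp].
apply: filterI; first exact: open_nbhs_nbhs.
by apply: (fc p Ap); exact: open_nbhs_nbhs.
Qed.

Lemma open_chart_image m (M : charted_space R m) (i : cs_index M) (W : set M) :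
  open (cs_image i) ->
  (forall p, cs_dom i p -> cs_inv i (cs_chart i p) = p) ->
  (forall x, cs_image i x -> {for x, continuous (cs_inv i)}) ->
  open W -> open (cs_chart i @` (W `&` cs_dom i)).
Proof.
move=> oi iK ic oW.
rewrite (_ : _ @` _ = cs_image i `&` cs_inv i @^-1` W); last first.
  apply/seteqP; split=> x [].
    by move=> p [Wp ip] <-; split; [exists p|rewrite /= iK].
  by move=> [p ip <-]; rewrite /= iK // => Wp; exists p.
exact: open_preimage_on.
Qed.

Lemma open_chart_imageM m (M : manifold R m) (i : cs_index M) (W : set M) :
  open W -> open (cs_chart i @` (W `&` cs_dom i)).
Proof.
apply: open_chart_image; first exact: (mfd_open_image (mfd_axioms M)).
- exact: (mfd_chartK (mfd_axioms M)).
- exact: (mfd_inv_continuous (mfd_axioms M)).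
Qed.

Lemma chart_imageT m (M : manifold R m) (i : cs_index M) p :
  cs_dom i p -> cs_image i (cs_chart i p).
Proof. by exists p. Qed.

Lemma chartK m (M : manifold R m) (i : cs_index M) p :
  cs_dom i p -> cs_inv i (cs_chart i p) = p.
Proof. exact: (mfd_chartK (mfd_axioms M)). Qed.

Lemma smooth_map_chart m k (M : charted_space R m) (A : set M)
    (f : M -> euclid R k) (i : cs_index M) : smooth_map A f ->
  smooth_on (cs_chart i @` (A `&` cs_dom i)) (f \o cs_inv i).
Proof.
by move=> [_ _ /(_ i tt)]; apply: smooth_on_sub => _ [p [Ap ip] <-]; exists p.
Qed.

Lemma chart_change_near m (M : manifold R m) (i i' : cs_index M) p :
  cs_dom i p -> cs_dom i' p ->
  \forall y \near cs_chart i p,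
    cs_inv i' ((cs_chart i' \o id \o cs_inv i) y) = cs_inv i y.
Proof.
move=> ip ip'; have o := open_chart_imageM (i := i)
    (mfd_open_dom (mfd_axioms M) i').
have : nbhs (cs_chart i p) (cs_chart i @` (cs_dom i' `&` cs_dom i)).
  by apply: open_nbhs_nbhs; split => //; exists p.
by apply: filterS => _ [q [iq' iq] <-]; rewrite /= chartK // chartK.
Qed.

Lemma chart_change_differentiable m (M : manifold R m) (i i' : cs_index M) p :
  cs_dom i p -> cs_dom i' p ->
  differentiable (cs_chart i' \o id \o cs_inv i) (cs_chart i p).
Proof.
move=> ip ip'.
have tr : (cs_chart i @` (cs_dom i `&` cs_dom i')) (cs_chart i p) by exists p.
exact: (smooth_on_differentiable (@mfd_transition _ _ _ (mfd_axioms M) i i') tr).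
Qed.

Lemma diff_chart_change m l (M : manifold R m) (h : M -> 'rV[R]_l)
    (i i' : cs_index M) p v : cs_dom i p -> cs_dom i' p ->
  differentiable (h \o cs_inv i') (cs_chart i' p) ->
  'd (h \o cs_inv i) (cs_chart i p) v =
  'd (h \o cs_inv i') (cs_chart i' p)
    ('d (cs_chart i' \o id \o cs_inv i) (cs_chart i p) v).
Proof.
move=> ip ip' hd; have td := chart_change_differentiable ip ip'.
have tp : (cs_chart i' \o id \o cs_inv i) (cs_chart i p) = cs_chart i' p.
  by rewrite /= chartK.
have nE : \forall y \near cs_chart i p,
    ((h \o cs_inv i') \o (cs_chart i' \o id \o cs_inv i)) y = (h \o cs_inv i) y.
  by apply: filterS (chart_change_near ip ip') => y /= ->.
have hd' : differentiable (h \o cs_inv i')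
    ((cs_chart i' \o id \o cs_inv i) (cs_chart i p)) by rewrite tp.
have cd := differentiable_comp td hd'.
have E1 := @near_eq_diff _ _ _ _ (h \o cs_inv i) _ v nE cd.
have E2 := congr1 (fun f => f v) (diff_comp td hd').
have E3 := congr1 (fun q => 'd (h \o cs_inv i') q
  ('d (cs_chart i' \o id \o cs_inv i) (cs_chart i p) v)) tp.
exact: (etrans (esym E1) (etrans E2 E3)).
Qed.

Lemma pull_chart_change m l (M : manifold R m) (h : M -> 'rV[R]_l)
    (w : form R l 1) (i i' : cs_index M) p v : cs_dom i p -> cs_dom i' p ->
  differentiable (h \o cs_inv i') (cs_chart i' p) ->
  pull (h \o cs_inv i) w (cs_chart i p) v =
  pull (h \o cs_inv i') w (cs_chart i' p)
    ('d (cs_chart i' \o id \o cs_inv i) (cs_chart i p) v).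
Proof.
move=> ip ip' hd; have E := diff_chart_change v ip ip' hd.
have pE : (h \o cs_inv i) (cs_chart i p) = (h \o cs_inv i') (cs_chart i' p).
  by rewrite /= !chartK.
have := congr2 (w : _ -> _ -> R) pE E.
by rewrite -!pullE.
Qed.

Lemma smooth_1form_chart m (M : manifold R m) (w : mform M 1) (i : cs_index M) :
  smooth_1form w -> smooth_form (cs_image i) (w i).
Proof. by move=> [_ wl ws]; split=> [x|v]; [exact: wl|exact: ws]. Qed.

Lemma smooth_1form_change m (M : manifold R m) (w : mform M 1)
    (i i' : cs_index M) p v : smooth_1form w -> cs_dom i p -> cs_dom i' p ->
  w i (cs_chart i p) v =
  w i' (cs_chart i' p) ('d (cs_chart i' \o id \o cs_inv i) (cs_chart i p) v).
Proof.
by move=> [wc _ _] ip ip'; rewrite (wc i i' p I ip ip' v) pullE /= chartK.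
Qed.

(** The compatibility of the local expressions of [w] absorbs the differential
    of the change of charts at the target. *)
Lemma pull_target_change m k (N : manifold R k) (w : mform N 1)
    (X : 'rV[R]_m -> N) (j j' : cs_index N) y v : smooth_1form w ->
  cs_dom j (X y) -> cs_dom j' (X y) ->
  (\forall y' \near y, cs_dom j (X y')) ->
  differentiable (cs_chart j \o X) y ->
  pull (cs_chart j \o X) (w j) y v = pull (cs_chart j' \o X) (w j') y v.
Proof.
move=> ws jy jy' jn Xd; rewrite !pullE /= (smooth_1form_change _ ws jy jy').
have td := chart_change_differentiable jy jy'.
have nE : \forall y' \near y,
    ((cs_chart j' \o id \o cs_inv j) \o (cs_chart j \o X)) y' = (cs_chart j' \o X) y'.
  by apply: filterS jn => y' /= jy1; rewrite chartK.
have cE := congr1 (fun f => f v) (diff_comp Xd td).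
have dE := near_eq_diff v nE (differentiable_comp Xd td).
exact: (congr1 (w j' (cs_chart j' (X y)) : _ -> R) (etrans (esym cE) dE)).
Qed.

End Charts.

(** * The tubular neighbourhood *)

Lemma diff_inverse (R : realType) (V W : normedModType R) (F : V -> W) (G : W -> V)
    y w : differentiable G y -> differentiable F (G y) ->
  (\forall y' \near y, F (G y') = y') -> 'd F (G y) ('d G y w) = w.
Proof.
move=> Gd Fd FG; have cd := differentiable_comp Gd Fd.
have nE : \forall y' \near y, (F \o G) y' = id y' by [].
have E1 := near_eq_diff w nE cd.
have E2 := congr1 (fun f => f w) (diff_comp Gd Fd).
have E3 : 'd (id : W -> W) y w = w.
  by have idd : differentiable (id : W -> W) y by []; rewrite -deriveE // derive_id.
exact: (etrans (esym E2) (etrans E1 E3)).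
Qed.

Section Tube.
Variables (R : realType) (m k : nat) (M : manifold R m) (N : manifold R k).
Let P := prod_space N (euclid R 2).
Variables (phi : N * 'rV[R]_2 -> M) (psi : M -> N * 'rV[R]_2) (s : R).
Let A := [set q : N * 'rV[R]_2 | sqr_radius q.2 < s].
Hypotheses (phis : @smooth_map R (k + 2) m P M A phi)
           (psis : @smooth_map R m (k + 2) M P (phi @` A) psi).
Hypothesis phiK : forall q, A q -> psi (phi q) = q.

Definition inside (d : R) : set M :=
  [set p | (phi @` A) p /\ sqr_radius (psi p).2 < d].

Lemma inside_psi d p : inside d p -> phi (psi p) = p.
Proof. by move=> [[q Aq <-] _]; rewrite phiK. Qed.

Lemma inside_A d p : inside d p -> A (psi p).
Proof. by move=> [[q Aq <-] _]; rewrite phiK. Qed.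

Lemma open_tube (D : set (N * 'rV[R]_2)) (d : R) : open D ->
  open (inside d `&` psi @^-1` D).
Proof.
move=> oD; have [oB psic _] := psis.
pose D' := [set q : N * 'rV[R]_2 | sqr_radius q.2 < d] `&` D.
have oD' : open D'.
  apply: openI => //; apply: (@open_comp _ _ (snd : N * 'rV[R]_2 -> _)
    [set z | sqr_radius z < d]); last exact: open_sqr_radius_lt.
  by move=> q _; exact: cvg_snd.
rewrite (_ : _ `&` _ = phi @` A `&` psi @^-1` D').
  exact: open_preimage_on.
by apply/seteqP; split=> p; [move=> [[? ?] ?]|move=> [? [? ?]]]; split.
Qed.

Section Chart.
Variables (i : cs_index M) (j : cs_index N).

(* In the chart [i] of M, the points of the tube over the chart [j] of N; then
   the change of coordinates from this chart to the product chart, its inverse,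
   and the domain of the latter. *)
Definition tube_chart (d : R) : set 'rV[R]_m :=
  cs_chart i @` ((inside d `&` [set p | cs_dom j (psi p).1]) `&` cs_dom i).

Definition tube_map : 'rV[R]_m -> 'rV[R]_(k + 2) :=
  fun y => row_mx (cs_chart j (psi (cs_inv i y)).1) (psi (cs_inv i y)).2.

Definition tube_inv : 'rV[R]_(k + 2) -> 'rV[R]_m :=
  fun y => cs_chart i (phi (cs_inv j (lsubmx y), rsubmx y)).

Lemma open_dom_fst (N' : manifold R k) (j' : cs_index N') :
  open [set q : N' * 'rV[R]_2 | cs_dom j' q.1].
Proof.
apply: (@open_comp _ _ (fst : N' * 'rV[R]_2 -> _) (cs_dom j')).
  by move=> q _; exact: cvg_fst.
exact: (mfd_open_dom (mfd_axioms N')).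
Qed.

Lemma open_tube_chart d : open (tube_chart d).
Proof. by apply: open_chart_imageM; exact: (open_tube d (@open_dom_fst N j)). Qed.

Lemma tube_map_smooth d : smooth_on (tube_chart d) tube_map.
Proof.
have [_ _ /(_ i (j, tt))] := psis; apply: smooth_on_sub.
by move=> _ [p [[pd jp] ip] <-]; exists p => //; split; [split => //; exact: pd.1|].
Qed.

Definition cotube_chart (d : R) : set 'rV[R]_(k + 2) :=
  [set y | cs_image j (lsubmx y) /\
    let q := (cs_inv j (lsubmx y), rsubmx y) in
    [/\ A q, sqr_radius q.2 < d & cs_dom i (phi q)]].

Lemma open_cotube_chart d : open (cotube_chart d).
Proof.
have [oA phic _] := phis.
pose D := (A `&` phi @^-1` cs_dom i) `&`
  [set q : N * 'rV[R]_2 | sqr_radius q.2 < d].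
have oD : open D.
  apply: openI; first exact: (open_preimage_on oA phic (mfd_open_dom (mfd_axioms M) i)).
  apply: (@open_comp _ _ (snd : N * 'rV[R]_2 -> _)
    [set z | sqr_radius z < d]); last exact: open_sqr_radius_lt.
  by move=> q _; exact: cvg_snd.
have lc : continuous (lsubmx : 'rV[R]_(k + 2) -> 'rV[R]_k) by exact: continuous_lsubmx.
have rc : continuous (rsubmx : 'rV[R]_(k + 2) -> 'rV[R]_2) by exact: continuous_rsubmx.
rewrite (_ : cotube_chart d = lsubmx @^-1` cs_image j `&`
    (fun y => (cs_inv j (lsubmx y), rsubmx y)) @^-1` D).
  apply: open_preimage_on => //.
    by apply: open_comp => //; exact: (mfd_open_image (mfd_axioms N)).
  move=> y jy.
  have c1 : {for y, continuous (cs_inv j \o (lsubmx : 'rV[R]_(k + 2) -> 'rV[R]_k))}.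
    apply: continuous_comp; first exact: lc.
    exact: (mfd_inv_continuous (mfd_axioms N)).
  exact: (cvg_pair c1 (rc y)).
apply/seteqP; split=> y /=.
  by move=> [jy [Ay dy iy]]; split => //; split.
by move=> [jy [[Ay iy] dy]]; split => //; split.
Qed.

Lemma tube_inv_smooth d : smooth_on (cotube_chart d) tube_inv.
Proof.
have [_ _ /(_ (j, tt) i)] := phis; apply: smooth_on_sub.
move=> y [[n jn yn] [Ay dy iy]].
have nE : cs_inv j (lsubmx y) = n by rewrite -yn chartK.
exists (n, rsubmx y); last by rewrite /= yn hsubmxK.
by rewrite nE in Ay iy; split; [split|].
Qed.

Lemma tube_mapK d y : tube_chart d y -> tube_inv (tube_map y) = y.
Proof.
move=> [p [[pd jp] ip] <-]; rewrite /tube_inv /tube_map row_mxKl row_mxKr.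
rewrite chartK // chartK // -surjective_pairing.
by rewrite (inside_psi pd).
Qed.

Lemma tube_invK d y : cotube_chart d y -> tube_map (tube_inv y) = y.
Proof.
move=> [[n jn yn] [Ay dy iy]]; rewrite /tube_inv /tube_map chartK // phiK //=.
by rewrite -yn chartK // yn hsubmxK.
Qed.

Lemma tube_map_cotube d y : tube_chart d y -> cotube_chart d (tube_map y).
Proof.
move=> [p [[pd jp] ip] <-]; rewrite /cotube_chart /tube_map /= row_mxKl row_mxKr.
rewrite chartK //; split; first by exists (psi p).1.
rewrite chartK // -surjective_pairing (inside_psi pd).
by split; [exact: inside_A pd|exact: pd.2|].
Qed.

(* The chain rule is applied at [tube_inv (tube_map y)], which equals [y]. *)
Lemma diff_tube_mapK d y w : tube_chart d y ->
  'd tube_map y ('d tube_inv (tube_map y) w) = w.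
Proof.
move=> dy; have cy := tube_map_cotube dy.
have yE := tube_mapK dy.
have Gd := smooth_on_differentiable (@tube_inv_smooth d) cy.
have Fd : differentiable tube_map (tube_inv (tube_map y)).
  by rewrite yE; exact: (smooth_on_differentiable (@tube_map_smooth d) dy).
have nE : \forall y' \near tube_map y, tube_map (tube_inv y') = y'.
  have : nbhs (tube_map y) (cotube_chart d).
    by apply: open_nbhs_nbhs; split => //; exact: open_cotube_chart.
  by apply: filterS => y'; exact: tube_invK.
have E := congr1 (fun q => 'd tube_map q ('d tube_inv (tube_map y) w)) yE.
exact: (etrans (esym E) (diff_inverse w Gd Fd nE)).
Qed.

Lemma diff_tube_invK d y v : tube_chart d y ->
  'd tube_inv (tube_map y) ('d tube_map y v) = v.
Proof.
move=> dy; have cy := tube_map_cotube dy.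
have Gd := smooth_on_differentiable (@tube_inv_smooth d) cy.
have Fd := smooth_on_differentiable (@tube_map_smooth d) dy.
have nE : \forall y' \near y, tube_inv (tube_map y') = y'.
  have : nbhs y (tube_chart d).
    by apply: open_nbhs_nbhs; split => //; exact: open_tube_chart.
  by apply: filterS => y'; exact: tube_mapK.
exact: (diff_inverse v Fd Gd nE).
Qed.

Variables (alpha : mform M 1) (beta : mform N 1) (f0 g0 : R -> R).
Hypothesis alphas : smooth_1form alpha.
Hypothesis betas : smooth_1form beta.
Hypothesis axisym : @is_pullback R (k + 2) m 1 P M
  [set q : N * 'rV[R]_2 | sqr_radius q.2 <= 1] phi alpha (axisym_form f0 g0 beta).

Lemma axisym_cotube y w : cotube_chart 1 y ->
  pull tube_inv (alpha i) y w =
  f0 (sqr_radius (rsubmx y)) * beta j (lsubmx y) (lsubmx w)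
  + twist_form g0 (rsubmx y) (rsubmx w).
Proof.
move=> [[n jn yn] [Ay dy iy]].
have nE : cs_inv j (lsubmx y) = n by rewrite -yn chartK.
rewrite nE /= in iy dy.
have := @axisym (j, tt) i (n, rsubmx y) (ltW dy) (conj jn I) iy w.
by rewrite /= yn hsubmxK => <-.
Qed.

Lemma axisym_tube y v : tube_chart 1 y ->
  alpha i y v =
  f0 (sqr_radius (rsubmx (tube_map y))) *
     pull (fun y => lsubmx (tube_map y)) (beta j) y v
  + pull (fun y => rsubmx (tube_map y)) (twist_form g0) y v.
Proof.
move=> dy; have Fs := @tube_map_smooth 1.
have oU := @open_tube_chart 1.
rewrite !pullE (@diff_lsubmx _ _ _ _ _ _ dy Fs) (@diff_rsubmx _ _ _ _ _ _ dy Fs).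
rewrite -(axisym_cotube _ (tube_map_cotube dy)) pullE.
by rewrite (diff_tube_invK _ dy) (tube_mapK dy).
Qed.

(** At the origin the angular form is singular. Differentiability is inherited
    from [alpha], whose pull-back to the slice of the tube over a point of N is
    [g0 d theta]. *)
Lemma twist_differentiable y w : tube_chart 1 y ->
  differentiable (fun z => twist_form g0 z w : R^o) (rsubmx (tube_map y)).
Proof.
move=> dy; have cy := tube_map_cotube dy; set x0 := lsubmx (tube_map y).
pose e (z : 'rV[R]_2) := row_mx x0 z.
have ed z : differentiable e z.
  pose E l : 'rV[R]_(k + 2) := row_mx 0 (delta_mx 0 l).
  have -> : e = fun z => row_mx x0 0 + (z 0 0 *: E 0 + z 0 1 *: E 1).
    apply/funext => z'; rewrite !scale_row_mx !add_row_mx !scaler0 !addr0 add0r.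
    rewrite /e {1}[z']row_sum_delta !big_ord_recl big_ord0 addr0.
    by congr (row_mx _ (_ + z' _ _ *: delta_mx _ _)); exact: val_inj.
  have cd l : differentiable (fun z : 'rV[R]_2 => z 0 l *: E l) z.
    by apply: differentiableZl; exact: differentiable_coord.
  by apply: differentiableD => //; exact: differentiableD.
have oC := @open_cotube_chart 1.
have ai_s : smooth_form (cs_image i) (alpha i) by exact: smooth_1form_chart.
have CV y' : cotube_chart 1 y' -> cs_image i (tube_inv y').
  by move=> [_ [_ _ iy]]; exact: chart_imageT.
have ps := smooth_form_pull oC (@tube_inv_smooth 1) CV ai_s.
have pd := smooth_on_differentiable (ps.2 (row_mx 0 w)) cy.
have eE : e (rsubmx (tube_map y)) = tube_map y by rewrite /e hsubmxK.
apply: (@near_eq_differentiable _ _ _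
  ((fun y => pull tube_inv (alpha i) y (row_mx 0 w) : R^o) \o e)); last first.
  by apply: differentiable_comp => //; rewrite eE.
have ec : {for rsubmx (tube_map y), continuous e}.
  exact: differentiable_continuous.
have : nbhs (e (rsubmx (tube_map y))) (cotube_chart 1).
  by rewrite eE; apply: open_nbhs_nbhs.
move=> /ec en; have {}en : \forall z' \near rsubmx (tube_map y), cotube_chart 1 (e z').
  exact: en.
apply: filterS en => z' cz /=.
rewrite (axisym_cotube _ cz) /e !row_mxKl !row_mxKr.
have bl : scalar (beta j x0) by apply: (smooth_1form_chart j betas).1; case: cy.
by rewrite (scalar_fun0 bl) mulr0 add0r.
Qed.

End Chart.
End Tube.

(** * The limit form *)

(** In odd dimension d beta has a kernel, on which beta cannot vanish if it is
    contact; the condition [nu /\ (d beta)^n = 0] puts this kernel in that of nu. *)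
Lemma reeb_vector (R : realType) (k n : nat) (beta nu : form R k 1) y :
  k = (1 + n * 2)%N -> scalar (beta y) -> scalar (nu y) ->
  bilinear_form (ext_d beta y) ->
  (exists V, wedge beta (wedge_pow (dform beta) n) y V <> 0) ->
  (forall V, wedge nu (wedge_pow (dform beta) n) y V = 0) ->
  exists rv, [/\ beta y rv = 1, nu y rv = 0 &
                 forall v, ext_d beta y rv v = 0].
Proof.
move=> kn bl nl db [V V0] nub.
have [|r r0 dbr] := antisymmetric_odd_kernel _ db (ext_d_anti beta y).
  by rewrite kn oddD oddM andbF.
have dbr' v : ext_d beta y v r = 0 by rewrite ext_d_anti dbr oppr0.
have br : beta y r != 0.
  apply/eqP => br; apply: V0.
  by apply: (wedge_top_kernel0 _ kn bl (dformE beta y) db r0 br).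
have nr : nu y r = 0.
  apply: (wedge_top_reeb0 (n := n) (a := beta) nl (dformE beta y) db dbr dbr') => //.
  by exists V.
exists ((beta y r)^-1 *: r); split.
- by rewrite scalar_funZ // mulVf.
- by rewrite scalar_funZ // nr mulr0.
- by move=> v; rewrite (scalar_funZ _ _ (db.1 v)) dbr mulr0.
Qed.

Lemma wedge0l (R : realType) (m k l : nat) (w : form R m k) (e : form R m l) x V :
  (forall U, w x U = 0) -> wedge w e x V = 0.
Proof.
move=> w0; rewrite (@eq_wedge _ _ _ _ w (fun y U => 0 * w y U) e
  (fun y U => 1 * e y U)) ?wedge_scale ?mul0r //.
- by move=> U; rewrite w0 mul0r.
- by move=> U; rewrite mul1r.
Qed.

Lemma wedge0r (R : realType) (m k l : nat) (w : form R m k) (e : form R m l) x V :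
  (forall U, e x U = 0) -> wedge w e x V = 0.
Proof.
move=> w0; rewrite (@eq_wedge _ _ _ _ w (fun y U => 1 * w y U) e
  (fun y U => 0 * e y U)) ?wedge_scale ?mulr0 ?mul0r //.
- by move=> U; rewrite mul1r.
- by move=> U; rewrite w0 mul0r.
Qed.

Lemma sqr_radius_disk_compact (R : realType) (d : R) :
  compact [set z : 'rV[R]_2 | sqr_radius z <= d].
Proof.
apply: bounded_closed_compact.
  exists (d + 1); split; first exact: num_real.
  move=> r dr z /= zd.
  rewrite /Num.norm /= mx_normrE; apply: bigmax_le => [|[a b] _ /=].
    by rewrite (le_trans _ (ltW dr)) // addr_ge0 // (le_trans (sqr_radius_ge0 z)).
  have zab : z a b ^+ 2 <= d.
    apply: le_trans zd; rewrite ord1 /sqr_radius; case: b => [[|[|//]] b].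
      by rewrite (_ : Ordinal b = 0) ?lerDl ?sqr_ge0 //; exact: val_inj.
    by rewrite (_ : Ordinal b = 1) ?lerDr ?sqr_ge0 //; exact: val_inj.
  apply: le_trans (ltW dr).
  have : 0 <= (`|z a b| - 1) ^+ 2 by exact: sqr_ge0.
  rewrite sqrrB1 -normrX (ger0_norm (sqr_ge0 _)) => h.
  have := normr_ge0 (z a b); lra.
rewrite (_ : [set _ | _] = ~` [set z | d < sqr_radius z]).
  apply: open_closedC; apply: (@open_comp _ _ (@sqr_radius R) [set r | d < r]).
    by move=> z _; exact: (differentiable_continuous (sqr_radius_differentiable z)).
  exact: open_gt.
by apply/seteqP; split=> z /=; rewrite leNgt => /negP.
Qed.

(** The angular form is invariant under radial normalization: the derivative of
    the normalizing factor only contributes a radial vector. *)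
Lemma angle_normalized (R : realType) m (f g : 'rV[R]_m -> 'rV[R]_2) y v :
  differentiable f y -> differentiable g y -> sqr_radius (f y) != 0 ->
  (\forall y \near y, g y = (Num.sqrt (sqr_radius (f y)))^-1 *: f y) ->
  angle_form (g y) ('d g y v) = angle_form (f y) ('d f y v).
Proof.
move=> fd gd r0 gE; have rp : 0 < sqr_radius (f y).
  by rewrite lt_neqAle eq_sym r0 sqr_radius_ge0.
pose h (r : R) : R := (Num.sqrt r)^-1.
have sq0 : Num.sqrt (sqr_radius (f y)) != 0 by rewrite gt_eqF // sqrtr_gt0.
have hd : derivable (h : R -> R^o) ((@sqr_radius R \o f) y) 1.
  have [sd _] := is_derive1_sqrt rp.
  exact: (@derivableV _ _ (@Num.sqrt R : R -> R)).
have rfd : differentiable (@sqr_radius R \o f : _ -> R^o) y.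
  by apply: differentiable_comp => //; exact: sqr_radius_differentiable.
have [cd _] := derive_fun_comp v hd rfd.
pose c : 'rV[R]_m -> R^o := h \o (@sqr_radius R \o f).
have gyE : g y = c y *: f y := nbhs_singleton gE.
have dgE : 'd g y v = 'D_v c y *: f y + c y *: 'd f y v.
  have combE (p q : R) (u w : 'rV[R]_2) l :
    (p *: u + q *: w) 0 l = p * u 0 l + q * w 0 l by rewrite !mxE.
  apply/rowP => l; apply: (etrans (derive_coord v l gd)).
  have E0 : 'D_v (fun y => g y 0 l : R^o) y =
      'D_v (fun y => (c y : R) * (f y 0 l) : R^o) y.
    by apply: near_eq_derive; apply: filterS gE => y' ->; rewrite mxE.
  have fld := @diff_derivable _ _ _ _ y v (differentiable_fun_coord l fd).
  apply: (etrans E0).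
  apply: (etrans (@deriveM _ _ (c : _ -> R) _ _ _ (@diff_derivable _ _ _ _ y v cd) fld)).
  apply: (etrans _ (esym (combE _ _ _ _ l))); apply: (etrans (addrC _ _)).
  exact: (congr2 +%R (mulrC _ _) (congr1 ( *%R (c y)) (esym (derive_coord v l fd)))).
have c0 : c y != 0 by rewrite invr_eq0.
exact: (etrans (congr2 (@angle_form R : _ -> _ -> R) gyE dgE)
  (angle_scale _ _ _ c0)).
Qed.

Section LimitForm.
Variables (R : realType) (n m k : nat) (M : manifold R m) (N : manifold R k).
Let P := prod_space N (euclid R 2).
Variables (phi : N * 'rV[R]_2 -> M) (psi : M -> N * 'rV[R]_2) (s : R).
Let A := [set q : N * 'rV[R]_2 | sqr_radius q.2 < s].
Hypothesis s_gt1 : 1 < s.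
Hypotheses (phis : @smooth_map R (k + 2) m P M A phi)
           (psis : @smooth_map R m (k + 2) M P (phi @` A) psi).
Hypothesis phiK : forall q, A q -> psi (phi q) = q.
Hypothesis N_closed : closed_manifold N.

Variables (E : set M) (theta : M -> 'rV[R]_2).
Hypothesis thetas : @smooth_map R m 2 M (euclid R 2) E theta.
Hypothesis theta1 : forall p, E p -> sqr_radius (theta p) = 1.
Hypothesis theta_tube : forall (x : N) (z : 'rV[R]_2), 0 < sqr_radius z <= 1 ->
  theta (phi (x, z)) = (Num.sqrt (sqr_radius z))^-1 *: z.
(* [E] is the complement of the binding. *)
Hypothesis E_binding : forall p, ~ E p -> exists x, p = phi (x, 0).

Variables (alpha : mform M 1) (beta nu : mform N 1) (f0 g0 : R -> R).
Hypotheses (mn : m = (1 + n * 2)%N) (kn : k = (1 + n.-1 * 2)%N).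
Hypothesis alpha_contact : contact_form n alpha.
Hypothesis beta_contact : contact_form n.-1 beta.
Hypothesis axisym : @is_pullback R (k + 2) m 1 P M
  [set q : N * 'rV[R]_2 | sqr_radius q.2 <= 1] phi alpha (axisym_form f0 g0 beta).
Hypothesis f0s : smooth_fun f0.
Hypothesis f0_gt0 : forall r, 0 <= r <= 1 -> 0 < f0 r.
Hypothesis f0_decr : forall r s, 0 <= r -> r < s -> s <= 1 -> f0 s < f0 r.
Hypothesis g0s : smooth_fun g0.
Hypothesis g0_ge0 : forall r, 0 <= r <= 1 -> 0 <= g0 r.
Hypothesis g0_incr : forall r s, 0 <= r -> r <= s -> s <= 1 -> g0 r <= g0 s.
Hypothesis alpha_adapted : adapted n E theta alpha.
Hypotheses (nus : smooth_1form nu) (nu_neq0 : nowhere_zero nu)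
  (nu_closed : mform_zero (md nu))
  (nu_beta : mform_zero (mwedge nu (mwedge_pow (md beta) n.-1))).

Let X (p : M) : N := (psi p).1.
Let Z (p : M) : 'rV[R]_2 := (psi p).2.
Let In := inside phi psi s.

Definition chart_at (x : N) : cs_index N :=
  projT1 (cid (mfd_cover (mfd_axioms N) x)).

Lemma chart_atP x : cs_dom (chart_at x) x.
Proof. exact: (projT2 (cid (mfd_cover (mfd_axioms N) x))). Qed.

(** The chart of N is an arbitrary one around each point; by
    [pull_target_change] the value does not depend on it. *)
Definition limit_form : mform M 1 := fun i y v =>
  let p := cs_inv i y in
  if `[< In 1 p >] then
    nu_profile (sqr_radius (Z p)) *
      pull ((cs_chart (chart_at (X p)) \o X) \o cs_inv i) (nu (chart_at (X p))) y v
    + pull (Z \o cs_inv i) (@planar_form R) y v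
  else dtheta theta i y v.

Section Inside.
Variables (i : cs_index M) (j : cs_index N).
Let T := tube_chart phi psi s i j.
Let F := tube_map psi i j.

Lemma tube_map_l : (fun y => lsubmx (F y)) = cs_chart j \o (X \o cs_inv i).
Proof. by apply/funext => y; rewrite /F /tube_map row_mxKl. Qed.

Lemma tube_map_r : (fun y => rsubmx (F y)) = Z \o cs_inv i.
Proof. by apply/funext => y; rewrite /F /tube_map row_mxKr. Qed.

Let oT : open (T 1) := open_tube_chart psis (i := i) (j := j) (d := 1).
Let Fs : smooth_on (T 1) F := tube_map_smooth psis (i := i) (j := j) (d := 1).

Lemma limit_inside y v : T 1 y ->
  limit_form i y v =
  nu_profile (sqr_radius (rsubmx (F y))) *
     pull (fun y => lsubmx (F y)) (nu j) y v
  + pull (fun y => rsubmx (F y)) (@planar_form R) y v.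
Proof.
move=> Ty; have [p [[pd jp] ip] yE] := Ty.
have pE : cs_inv i y = p by rewrite -yE chartK.
rewrite tube_map_l tube_map_r.
have rE : rsubmx (F y) = Z (cs_inv i y) by rewrite /F /tube_map row_mxKr.
rewrite rE.
have jn : \forall y' \near y, cs_dom j ((X \o cs_inv i) y').
  have : nbhs y (T 1) by apply: open_nbhs_nbhs.
  by apply: filterS => _ [p' [[_ jp'] ip'] <-]; rewrite /= chartK.
have Xd : differentiable (cs_chart j \o (X \o cs_inv i)) y.
  by rewrite -tube_map_l; exact: (smooth_on_differentiable (lsubmx_smooth oT Fs) Ty).
have jX : cs_dom j ((X \o cs_inv i) y) by rewrite /= pE.
have jX' : cs_dom (chart_at (X (cs_inv i y))) ((X \o cs_inv i) y).
  exact: chart_atP.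
have pullE' := pull_target_change v nus jX jX' jn Xd.
have In1 : In 1 (cs_inv i y) by rewrite pE.
rewrite /limit_form asboolT; last exact: In1.
by rewrite pullE'.
Qed.

Lemma inside_differentiable y : T 1 y ->
  differentiable ((cs_chart j \o X) \o cs_inv i) y /\
  differentiable (Z \o cs_inv i) y.
Proof.
move=> Ty; split.
  rewrite -[_ \o _]tube_map_l.
  exact: (smooth_on_differentiable (lsubmx_smooth oT Fs) Ty).
rewrite -tube_map_r; exact: (smooth_on_differentiable (rsubmx_smooth oT Fs) Ty).
Qed.

Let V := cs_image j.
Let oV : open V := @mfd_open_image _ _ _ (mfd_axioms N) j.

Lemma tube_map_image y : T 1 y -> V (lsubmx (F y)).
Proof.
move=> [p [[pd jp] ip] <-]; rewrite /F /tube_map row_mxKl chartK //.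
exact: chart_imageT.
Qed.

Let betas : smooth_form V (beta j) := smooth_1form_chart j beta_contact.1.
Let nujs : smooth_form V (nu j) := smooth_1form_chart j nus.

Lemma smooth_inside : smooth_form (T 1) (limit_form i).
Proof.
by apply: (local_smooth oT Fs tube_map_image nujs) => y Ty v; exact: limit_inside.
Qed.

Let alphas : smooth_form (T 1) (alpha i).
Proof.
apply: smooth_form_sub (smooth_1form_chart i alpha_contact.1).
by move=> _ [p [_ ip] <-]; exact: chart_imageT.
Qed.

Lemma nu_ext_d0 y u v : V y -> ext_d (nu j) y u v = 0.
Proof.
move=> Vy; have := nu_closed Vy (\matrix_(l < 2) (if l == 0 then u else v)).
by rewrite /md dformE !rowK.
Qed.

Lemma tube_radius y : T 1 y -> sqr_radius (rsubmx (F y)) < 1.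
Proof.
move=> [p [[pd jp] ip] <-]; rewrite /F /tube_map row_mxKr chartK //; exact: pd.2.
Qed.

Lemma contact_inside y c t (eta : form R m 1) : T 1 y -> 0 < c -> 0 <= t ->
  (forall y v, eta y v = c * alpha i y v + t * limit_form i y v) ->
  exists W, wedge eta (wedge_pow (dform eta) n) y W <> 0.
Proof.
move=> Ty c0 t0 etaE; have Vy := tube_map_image Ty.
have bd := smooth_form_differentiable oV betas Vy.
have [rv [rv1 rv2 rv3]] := reeb_vector kn (betas.1 _ Vy) (nujs.1 _ Vy)
  (ext_d_bilinear bd) (beta_contact.2 j _ Vy) (nu_beta Vy).
have yi : cs_image i y by case: Ty => p [_ ip] <-; exact: chart_imageT.
apply: (local_contact mn oT oV Ty Fs
  (lift := fun w => 'd (tube_inv phi i j) (F y) w) _ tube_map_image betas nujs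
  alphas _ _ _ (tube_radius Ty) f0s f0_gt0 f0_decr g0s g0_ge0 g0_incr rv1 rv2 rv3
  _ (alpha_contact.2 i y yi) c0 t0 etaE).
- move=> w; exact: (diff_tube_mapK phis psis phiK w Ty).
- by move=> y' Ty' v; exact: (axisym_tube phis psis phiK axisym v Ty').
- by move=> y' Ty' v; exact: limit_inside.
- move=> w; exact: (twist_differentiable phis phiK alpha_contact.1
    beta_contact.1 axisym w Ty).
- by move=> u v; exact: nu_ext_d0.
Qed.

Lemma nonzero_inside y : T 1 y -> sqr_radius (rsubmx (F y)) <= 3 / 4 ->
  exists v, limit_form i y v <> 0.
Proof.
move=> Ty r34; have Vy := tube_map_image Ty.
apply: (local_nonzero Ty Fs
  (lift := fun w => 'd (tube_inv phi i j) (F y) w) _ tube_map_image nujs _ _ r34).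
- move=> w; exact: (diff_tube_mapK phis psis phiK w Ty).
- by move=> y' Ty' v; exact: limit_inside.
- by have [v v0] := nu_neq0 Vy; exists v; exact/eqP.
Qed.

Lemma integrable_inside y W : T 1 y -> wedge (limit_form i) (dform (limit_form i)) y W = 0.
Proof.
move=> Ty; have Vy := tube_map_image Ty.
apply: (local_integrable oT oV Ty Fs tube_map_image nujs).
- by move=> y' Ty' v; exact: limit_inside.
- by move=> u v; exact: nu_ext_d0.
Qed.

End Inside.

(** The points where only the formula on the tube is available. On the open
    complement the limit form is [d theta]. *)
Definition core : set M := phi @` [set q : N * 'rV[R]_2 | sqr_radius q.2 <= 3 / 4].

Lemma core_closed : closed core.
Proof.
apply: compact_closed; first exact: (mfd_hausdorff (mfd_axioms M)).
apply: continuous_compact.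
  apply: continuous_in_subspaceT => q; rewrite inE /= => qd.
  have [_ phic _] := phis; apply: phic; apply: le_lt_trans qd _.
  by apply: lt_trans s_gt1; lra.
rewrite (_ : [set _ | _] = [set: N] `*` [set z | sqr_radius z <= 3 / 4]).
  have cK : compact ([set: N] `*` [set z : 'rV[R]_2 | sqr_radius z <= 3 / 4]).
    exact: compact_setX N_closed (@sqr_radius_disk_compact R (3 / 4)).
  exact: cK.
by apply/seteqP; split=> q /=; [split|case].
Qed.

Lemma core_inside p : core p -> In 1 p /\ sqr_radius (Z p) <= 3 / 4.
Proof.
move=> [q qd <-]; have q1 : sqr_radius q.2 < 1 by apply: le_lt_trans qd _; lra.
have Aq : A q by exact: lt_trans s_gt1.
by rewrite /In /inside /Z /= phiK //; split => //; split => //; exists q.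
Qed.

Lemma notcore_E p : ~ core p -> E p.
Proof.
move=> pc; apply: contrapT => /E_binding[x pE]; apply: pc.
exists (x, 0); rewrite ?pE //= /sqr_radius !mxE expr0n /= addr0.
by rewrite divr_ge0.
Qed.

Definition fibration_chart (i : cs_index M) : set 'rV[R]_m :=
  cs_chart i @` (E `&` cs_dom i).

Lemma open_fibration_chart i : open (fibration_chart i).
Proof. by have [oE _ _] := thetas; exact: open_chart_imageM. Qed.

Lemma theta_chart_smooth i : smooth_on (fibration_chart i) (theta \o cs_inv i).
Proof. exact: smooth_map_chart. Qed.

Lemma theta_neq0 i y : fibration_chart i y -> sqr_radius ((theta \o cs_inv i) y) != 0.
Proof. by move=> [p [Ep ip] <-]; rewrite /= chartK // theta1 // oner_neq0. Qed.

Lemma dtheta_smooth i : smooth_form (fibration_chart i) (dtheta theta i).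
Proof.
apply: (smooth_form_pull (V := [set z | sqr_radius z != 0])).
- exact: open_fibration_chart.
- exact: theta_chart_smooth.
- exact: theta_neq0.
- by apply: angle_smooth => //; exact: open_sqr_radius_neq0.
Qed.

Lemma dtheta_closed i y u v : fibration_chart i y ->
  ext_d (dtheta theta i) y u v = 0.
Proof.
move=> Ey; have z0 := theta_neq0 Ey.
have ad : differentiable_form (@angle_form R) ((theta \o cs_inv i) y).
  exact: (smooth_form_differentiable (@open_sqr_radius_neq0 R)
    (angle_smooth (@open_sqr_radius_neq0 R) (fun _ => id)) z0).
rewrite /dtheta.
rewrite (ext_d_pull _ _ (@open_fibration_chart i) (@theta_chart_smooth i) Ey ad).
exact: ext_d_angle.
Qed.

(** On the tube [theta] is the normalized disk coordinate. *)
Lemma dtheta_tube i p v : In 1 p -> 0 < sqr_radius (Z p) -> E p -> cs_dom i p ->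
  dtheta theta i (cs_chart i p) v =
  pull (Z \o cs_inv i) (@angle_form R) (cs_chart i p) v.
Proof.
move=> Ip r0 Ep ip.
have piE : cs_inv i (cs_chart i p) = p by rewrite chartK.
have Ty : tube_chart phi psi s i (chart_at (X p)) 1 (cs_chart i p).
  by exists p => //; split => //; split => //; exact: chart_atP.
have [_ Zd] := inside_differentiable Ty.
have Ey : fibration_chart i (cs_chart i p) by exists p.
have thd := smooth_on_differentiable (@theta_chart_smooth i) Ey.
rewrite /dtheta !pullE; apply: angle_normalized => //; first by rewrite /= piE gt_eqF.
have tn : nbhs (cs_chart i p) (tube_chart phi psi s i (chart_at (X p)) 1).
  by apply: open_nbhs_nbhs; split => //; exact: open_tube_chart.
have zn : \forall y \near cs_chart i p, sqr_radius ((Z \o cs_inv i) y) != 0.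
  have zp : nbhs ((Z \o cs_inv i) (cs_chart i p)) [set z | sqr_radius z != 0].
    apply: open_nbhs_nbhs; split; first exact: open_sqr_radius_neq0.
    by rewrite /= piE gt_eqF.
  exact: (differentiable_continuous Zd zp).
apply: filterS (filterI tn zn) => y [[p' [[pd _] ip'] <-]] /=; rewrite chartK // => z0.
rewrite -{1}(inside_psi phiK pd) [psi p']surjective_pairing theta_tube //=.
by rewrite lt_neqAle eq_sym z0 sqr_radius_ge0 ltW //; exact: pd.2.
Qed.

(** Where [3/4 < rho < 1] the two definitions of the limit form agree. *)
Lemma limit_outside i p v : ~ core p -> cs_dom i p ->
  limit_form i (cs_chart i p) v = dtheta theta i (cs_chart i p) v.
Proof.
move=> pc ip; have Ep := notcore_E pc.
rewrite /limit_form chartK //; case: asboolP => // Ip.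
have r34 : 3 / 4 < sqr_radius (Z p).
  rewrite ltNge; apply/negP => r34; apply: pc.
  by exists (psi p) => //; exact: inside_psi Ip.
have r0 : 0 < sqr_radius (Z p) by apply: lt_trans r34; lra.
rewrite dtheta_tube // !pullE /planar_form /twist_form /= chartK //.
rewrite theta_profile1 ?(ltW r34) // mul1r.
rewrite /nu_profile /rho_profile !cutoff_le0 ?mul0r ?add0r ?addr0 //.
  by rewrite subr_le0 ltW.
by rewrite subr_le0 ltW // (lt_trans _ r34) //; lra.
Qed.

Definition outer_chart (i : cs_index M) : set 'rV[R]_m :=
  cs_chart i @` (~` core `&` cs_dom i).

Lemma open_outer_chart i : open (outer_chart i).
Proof. by apply: open_chart_imageM; apply: closed_openC; exact: core_closed. Qed.

Lemma outer_fibration i : outer_chart i `<=` fibration_chart i.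
Proof. by move=> _ [p [pc ip] <-]; exists p => //; split => //; exact: notcore_E. Qed.

Lemma limit_outer i y v : outer_chart i y -> limit_form i y v = dtheta theta i y v.
Proof. by move=> [p [pc ip] <-]; exact: limit_outside. Qed.

Lemma smooth_outer i : smooth_form (outer_chart i) (limit_form i).
Proof.
apply: (smooth_form_eq (w := dtheta theta i)); first exact: open_outer_chart.
  by move=> y oy v; rewrite limit_outer.
exact: smooth_form_sub (@outer_fibration i) (@dtheta_smooth i).
Qed.

Lemma outer_cover i y : cs_image i y ->
  outer_chart i y \/ exists j, tube_chart phi psi s i j 1 y /\
    sqr_radius (rsubmx (tube_map psi i j y)) <= 3 / 4.
Proof.
move=> [p ip <-]; have [pc|pc] := pselect (core p); last by left; exists p.
have [Ip r34] := core_inside pc; right; exists (chart_at (X p)); split.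
  by exists p => //; split => //; split => //; exact: chart_atP.
by rewrite /tube_map row_mxKr chartK.
Qed.

Lemma limit_ext_d0 i y u v : outer_chart i y -> ext_d (limit_form i) y u v = 0.
Proof.
move=> oy; rewrite (ext_d_eq_on u v (@open_outer_chart i) oy (fun y oy v => @limit_outer i y v oy)).
exact: (dtheta_closed u v (outer_fibration oy)).
Qed.

Lemma limit_smooth_1form : smooth_1form limit_form.
Proof.
have loc i x : cs_image i x -> exists2 U, U x & smooth_form U (limit_form i).
  move=> /outer_cover[ox|[j [Tx _]]].
    by exists (outer_chart i) => //; exact: smooth_outer.
  by exists (tube_chart phi psi s i j 1) => //; exact: smooth_inside.
split=> [i i' p _ ip ip' W|i x ix|i v].
- have pE : cs_inv i (cs_chart i p) = p by rewrite chartK.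
  have pE' : cs_inv i' (cs_chart i' p) = p by rewrite chartK.
  rewrite pullE /= pE.
  rewrite {1}/limit_form pE [RHS]/limit_form pE'; case: asboolP => Ip.
    have Ty : tube_chart phi psi s i' (chart_at (X p)) 1 (cs_chart i' p).
      by exists p => //; split => //; split => //; exact: chart_atP.
    have [Xd Zd] := inside_differentiable Ty.
    by rewrite (pull_chart_change _ _ ip ip' Xd) (pull_chart_change _ _ ip ip' Zd).
  have Ep : E p.
    by apply: notcore_E => /core_inside[].
  have Ey : fibration_chart i' (cs_chart i' p) by exists p.
  have thd := smooth_on_differentiable (@theta_chart_smooth i') Ey.
  exact: (pull_chart_change _ _ ip ip' thd).
- by have [U Ux [Ul _]] := loc i x ix; exact: Ul.
- by apply: smooth_on_local => x ix; have [U Ux [_ Us]] := loc i x ix; exists U.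
Qed.

(** Outside the core, [d theta] cannot vanish since [d theta /\ (d alpha)^n]
    is positive. *)
Lemma limit_nowhere_zero : nowhere_zero limit_form.
Proof.
move=> i y iy; have [oy|[j [Ty r34]]] := outer_cover iy; last first.
  exact: nonzero_inside r34.
have [p [pc ip] yE] := oy; have Ep := notcore_E pc.
apply: contrapT => L0; have dth0 W : dtheta theta i y W = 0.
  rewrite -limit_outer //; apply: contrapT => W0; apply: L0.
  by exists W.
have [V V0] := alpha_contact.2 i y iy.
have alphas := smooth_1form_chart i alpha_contact.1.
have oi := @mfd_open_image _ _ _ (mfd_axioms M) i.
have ml := contact_volume_multilinear (n := n)
  (smooth_form_differentiable oi alphas iy).
have [W W0] := multilinear_positive ml V0.
rewrite -yE in W0; have := alpha_adapted Ep ip W0.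
by rewrite /mwedge wedge0l ?ltxx // => U; rewrite yE.
Qed.

Lemma limit_integrable : mform_zero (mwedge limit_form (md limit_form)).
Proof.
move=> i y iy W; have [oy|[j [Ty _]]] := outer_cover iy; last first.
  exact: (integrable_inside W Ty).
by apply: wedge0r => V; rewrite /md dformE; exact: limit_ext_d0.
Qed.

(** Since [d theta] is closed, [eta /\ (d eta)^n] is a combination of
    [alpha /\ (d alpha)^n] and of [d theta /\ (d alpha)^n] with non-negative
    coefficients, the first one positive. *)
Lemma contact_outer i y c t (eta : form R m 1) : outer_chart i y -> 0 < c -> 0 <= t ->
  (forall y v, eta y v = c * alpha i y v + t * limit_form i y v) ->
  exists W, wedge eta (wedge_pow (dform eta) n) y W <> 0.
Proof.
move=> oy c0 t0 etaE; have [p [pc ip] yE] := oy; have Ep := notcore_E pc.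
have iy : cs_image i y by rewrite -yE; exact: chart_imageT.
have [V V0] := alpha_contact.2 i y iy.
have alphas := smooth_1form_chart i alpha_contact.1.
have oi := @mfd_open_image _ _ _ (mfd_axioms M) i.
have ad := smooth_form_differentiable oi alphas iy.
have ld := smooth_form_differentiable (@open_outer_chart i) (@smooth_outer i) oy.
have ml := contact_volume_multilinear (n := n) ad.
have [W W0] := multilinear_positive ml V0.
have dW : 0 < wedge (dtheta theta i) (wedge_pow (dform (alpha i)) n) y W.
  by have := W0; rewrite -yE => /(alpha_adapted Ep ip).
exists W; apply/eqP; rewrite gt_eqF //.
have scal q (w : form R m 1) : differentiable_form w y ->
    differentiable_form (fun y v => q * w y v) y.
  move=> [wl wd]; split=> [|v]; last exact: differentiableZ.
  by apply: filterS wl => y' wl c' u v; rewrite wl; ring.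
have detaE V' : dform eta y V' = c * dform (alpha i) y V'.
  rewrite !dformE (@ext_d_eq_on _ _ _ _
    (fun y v => c * alpha i y v + t * limit_form i y v) _ _ _ openT I).
    by rewrite (ext_dD _ _ (scal c _ ad) (scal t _ ld)) !ext_dZ // limit_ext_d0 //
      mulr0 addr0.
  by move=> y' _ v; exact: etaE.
rewrite (@eq_wedge _ _ _ _ eta (fun y U => c * alpha i y U + t * dtheta theta i y U)
   _ (fun y U => c ^+ n * wedge_pow (dform (alpha i)) n y U)).
- rewrite wedge_addl !wedge_scale ltr_pwDl //.
    by apply: (mulr_gt0 _ W0); rewrite mulr_gt0 ?exprn_gt0.
  apply: (mulr_ge0 _ (ltW dW)).
  by rewrite mulr_ge0 // exprn_ge0 // ltW.
- by move=> U; rewrite etaE limit_outer.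
- move=> U; rewrite -wedge_pow_scale; exact: eq_wedge_pow.
Qed.

Lemma limit_contact i y c t (eta : form R m 1) : cs_image i y -> 0 < c -> 0 <= t ->
  (forall y v, eta y v = c * alpha i y v + t * limit_form i y v) ->
  exists W, wedge eta (wedge_pow (dform eta) n) y W <> 0.
Proof.
move=> iy c0 t0 etaE; have [oy|[j [Ty _]]] := outer_cover iy.
  exact: (contact_outer oy c0 t0 etaE).
exact: (contact_inside Ty c0 t0 etaE).
Qed.

End LimitForm.

(** * The deformation *)

Section LinearFamily.
Variables (R : realType) (m : nat) (M : manifold R m).
Variables (a b : mform M 1).
Hypotheses (as_ : smooth_1form a) (bs : smooth_1form b).

Definition linear_family (t : R) : mform M 1 :=
  fun i y v => (1 - t) * a i y v + t * b i y v.

Lemma linear_family_smooth_1form t : smooth_1form (linear_family t).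
Proof.
have [ac al ass] := as_; have [bc bl bss] := bs.
split=> [i j p _ ip jp v|i x ix c u v|i v].
- rewrite /linear_family (ac i j p I ip jp v) (bc i j p I ip jp v).
  by rewrite /pull.
- by rewrite /linear_family al // bl //; ring.
- have oi := @mfd_open_image _ _ _ (mfd_axioms M) i.
  by apply: smooth_onD => //; apply: smooth_onM => //; exact: smooth_on_cst.
Qed.

Lemma linear_family_smooth : smooth_family linear_family.
Proof.
move=> i v; have oi := @mfd_open_image _ _ _ (mfd_axioms M) i.
set U := [set _ | _]; have oU : open U.
  have -> : U = [set y : 'rV[R]_(1 + m) | lsubmx y 0 0 < 1] `&` rsubmx @^-1` cs_image i.
    by apply/seteqP; split=> y [].
  apply: openI; last first.
    by apply: open_comp => // y _; exact: continuous_rsubmx.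
  apply: (@open_comp _ _ (fun y : 'rV[R]_(1 + m) => lsubmx y 0 0) [set t | t < 1]).
    move=> y _; apply: (@continuous_comp _ _ _ (lsubmx : 'rV[R]_(1 + m) -> 'rV[R]_1)
      (fun z => z 0 0)); first exact: continuous_lsubmx.
    exact: coord_continuous.
  exact: open_lt.
have ts : smooth_on U (fun y => lsubmx y 0 0 : R^o).
  apply: (@smooth_on_eq _ _ _ _ (fun y => y 0 (lshift m 0) : R^o)) => //.
    by move=> y _; rewrite mxE.
  exact: smooth_on_id_coord.
have rs : smooth_on U (rsubmx : 'rV[R]_(1 + m) -> 'rV[R]_m).
  apply: (@smooth_on_linear _ _ _ U (rsubmx : {linear _ -> _})) => //.
  exact: continuous_rsubmx.
have comp (w : mform M 1) : smooth_1form w ->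
    smooth_on U (fun y => w i (rsubmx y) v : R^o).
  move=> [_ _ ws]; apply: (smooth_on_comp (V := cs_image i)
    (f := fun x => w i x v : R^o) oU rs _ (ws i v)).
  by move=> y [].
apply: smooth_onD => //; apply: smooth_onM => //; try exact: comp.
apply: (@smooth_on_eq _ _ _ _ (fun y => 1 + (-1) * lsubmx y 0 0 : R^o)) => //.
  by move=> y _; rewrite mulN1r.
apply: smooth_onD => //; first exact: smooth_on_cst.
by apply: smooth_onM => //; exact: smooth_on_cst.
Qed.

Lemma iter_partial_comb (U : set 'rV[R]_m) (f g : 'rV[R]_m -> R^o) c d s x :
  open U -> smooth_on U f -> smooth_on U g -> U x ->
  iter_partial s (fun y => c * f y + d * g y : R^o) x =
  c * iter_partial s f x + d * iter_partial s g x.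
Proof.
move=> oU fs gs; elim: s x => // j s ih x Ux /=.
rewrite (derive_eq_on _ oU Ux (g := fun y => c *: iter_partial s f y
  + d *: iter_partial s g y)) //.
have fd := @diff_derivable _ _ _ _ x (delta_mx 0 j) (fs x Ux s).
have gd := @diff_derivable _ _ _ _ x (delta_mx 0 j) (gs x Ux s).
rewrite (deriveD (derivableZ fd) (derivableZ gd)).
by rewrite (deriveZ _ fd) (deriveZ _ gd).
Qed.

Lemma linear_family_cvg : cvg_smooth linear_family b.
Proof.
move=> i K v s cK Ki e e0; have oi := @mfd_open_image _ _ _ (mfd_axioms M) i.
have [_ _ ass] := as_; have [_ _ bss] := bs.
pose f := iter_partial s (fun y => a i y v : R^o).
pose g := iter_partial s (fun y => b i y v : R^o).
have hc : {within K, continuous (fun x => f x - g x : R^o)}.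
  apply: continuous_in_subspaceT => x; rewrite inE => /Ki ix.
  apply: (@differentiable_continuous _ _ R^o).
  by apply: differentiableB; [exact: ass|exact: bss].
have /compact_bounded[C [_ hC]] := continuous_compact hc cK.
pose D := `|C| + 1.
have D0 : 0 < D by rewrite ltr_wpDl.
have hD x : K x -> `|f x - g x| <= D.
  move=> Kx; apply: (hC D); last by exists x.
  by rewrite (le_lt_trans (ler_norm C)) // ltrDl.
near=> t => x Kx; have ix := Ki x Kx.
rewrite (iter_partial_comb _ _ _ oi (ass i v) (bss i v) ix) -/(f x) -/(g x).
have -> : (1 - t) * f x + t * g x - g x = (1 - t) * (f x - g x) by ring.
have t1 : t < 1 by near: t; exact: nbhs_left_lt.
rewrite normrM gtr0_norm ?subr_gt0 //.
apply: (@le_lt_trans _ _ ((1 - t) * D)).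
  by rewrite ler_wpM2l ?hD // subr_ge0 ltW.
rewrite -ltr_pdivlMr // ltrBlDr -ltrBlDl.
by near: t; apply: nbhs_left_gt; rewrite gtrBl divr_gt0.
Unshelve. all: by end_near. Qed.

End LinearFamily.

Theorem theorem2p2 (R : realType) (n : nat) (n_gt1 : (1 < n)%N)
  (M : manifold R (2 * n).+1) (M_closed : closed_manifold M)
  (N : manifold R (2 * n).-1) (N_closed : closed_manifold N)
  (alpha : mform M 1) (alpha_contact : contact_form n alpha)
  (iota : N -> M) (phi : N * 'rV[R]_2 -> M) (theta : M -> 'rV[R]_2)
  (ob : open_book iota phi theta)
  (beta : mform N 1) (beta_restr : is_pullback [set: N] iota alpha beta)
  (beta_contact : contact_form n.-1 beta)
  (alpha_adapted : adapted n (~` range iota) theta alpha)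
  (f0 g0 : R -> R) (normal_form : axisymmetric phi f0 g0 alpha beta)
  (nu : mform N 1) (nu_smooth : smooth_1form nu)
  (nu_neq0 : nowhere_zero nu) (nu_closed : mform_zero (md nu))
  (nu_beta : mform_zero (mwedge nu (mwedge_pow (md beta) n.-1))) :
  exists (alpha_ : R -> mform M 1) (alpha1 : mform M 1),
    [/\ forall t : R, 0 <= t < 1 -> contact_form n (alpha_ t),
        smooth_family alpha_,
        mform_eq (alpha_ 0) alpha,
        cvg_smooth alpha_ alpha1 &
        [/\ smooth_1form alpha1,
            nowhere_zero alpha1 &
            mform_zero (mwedge alpha1 (md alpha1))]].
Proof.
have [[phi0 [r r1 /= [phis [psi [psis phiK _]]]]] [thetas theta1 _] thetaE] := ob.
have [[f0s _ f0p f0d] [g0s g0p g0i] _ axisym] := normal_form.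
have phiK' q : sqr_radius q.2 < r -> psi (phi q) = q by move=> /phiK[].
have binding p : ~ (~` range iota) p -> exists x, p = phi (x, 0).
  by move=> /contrapT[x _ <-]; exists x.
have mn : (2 * n).+1 = (1 + n * 2)%N by rewrite mulnC.
have kn : (2 * n).-1 = (1 + n.-1 * 2)%N by lia.
pose L := limit_form phi psi r theta nu.
have Ls : smooth_1form L.
  exact: (limit_smooth_1form r1 phis psis phiK' N_closed thetas theta1 thetaE
    binding nu_smooth).
exists (linear_family alpha L), L; split.
- move=> t /andP[t0 t1]; split; first exact: linear_family_smooth_1form alpha_contact.1 Ls t.
  move=> i y iy.
  by apply: (limit_contact r1 phis psis phiK' N_closed thetas theta1 thetaE
    binding mn kn alpha_contact beta_contact axisym f0s f0p f0d g0s g0p g0i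
    alpha_adapted nu_smooth nu_closed nu_beta iy _ t0 (fun _ _ => erefl _));
    rewrite subr_gt0.
- exact: linear_family_smooth alpha_contact.1 Ls.
- by move=> i y iy v; rewrite /linear_family subr0 mul1r mul0r addr0.
- exact: linear_family_cvg alpha_contact.1 Ls.
split => //.
- exact: (limit_nowhere_zero r1 phis psis phiK' thetas thetaE
    binding alpha_contact alpha_adapted nu_smooth nu_neq0).
- exact: (limit_integrable r1 phis psis phiK' N_closed thetas theta1 thetaE
    binding nu_smooth nu_closed).
Qed.
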